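(* Let $q\in(0,1)$ and $j\in\{\tfrac12,1,\tfrac32,\dots\}$. (a) For all $L\in\mathbb N$, the ASEP$(q,j)$ on $\{1,\dots,L\}$ with closed boundary conditions admits a family, labeled by $\alpha>0$, of reversible product measures with marginals $$\mathbb P^{(\alpha)}(\eta_i=n)=\frac{\alpha^n}{Z_i^{(\alpha)}}\binom{2j}{n}_q\cdot q^{2n(1+j-2ji)},\qquad n=0,1,\dots,2j,$$ for $i\in\{1,\dots,L\}$, where $$Z_i^{(\alpha)}=\sum_{n=0}^{2j}\binom{2j}{n}_q\cdot\alpha^n q^{2n(1+j-2ji)}.$$ (b) The infinite-volume ASEP$(q,j)$ on $\mathbb Z$ is well-defined and admits the reversible product measures with marginals given by the same formulas as in (a) (now for $i\in\mathbb Z$). (c) Both the ASEP$(q,j)$ on $\{1,\dots,L\}$ with closed boundary conditions and its infinite-volume version are monotone processes. (d) For $L\ge3$, the ASEP$(q,j)$ on the torus $\mathbf T_L=\mathbb Z/L\mathbb Z$ with periodic boundary conditions does not have translation invariant stationary product measures for $j\ne\tfrac12$. (e) The infinite-volume ASEP$(q,j)$ on $\mathbb Z$ does not have translation invariant stationary product measures for $j\neq\tfrac12$.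
   Context: For $n\in\mathbb N_0$: $[n]_q=\frac{q^n-q^{-n}}{q-q^{-1}}$, $[n]_q!=[n]_q\cdots[1]_q$ (with $[0]_q!=1$), $\binom{n}{k}_q=\frac{[n]_q!}{[k]_q!\,[n-k]_q!}$. For a vertex set $V$, configurations are $\eta=(\eta_i)_{i\in V}\in\{0,1,\dots,2j\}^V$, and $\eta^{i,k}$ is obtained from $\eta$ by moving one particle from site $i$ to site $k$. Put $$(\mathcal L_{i,i+1}f)(\eta)=q^{\eta_i-\eta_{i+1}-(2j+1)}[\eta_i]_q[2j-\eta_{i+1}]_q\,(f(\eta^{i,i+1})-f(\eta))+q^{\eta_i-\eta_{i+1}+(2j+1)}[2j-\eta_i]_q[\eta_{i+1}]_q\,(f(\eta^{i+1,i})-f(\eta)).$$ The ASEP$(q,j)$ on $\{1,\dots,L\}$ with closed boundary conditions has generator $\sum_{i=1}^{L-1}\mathcal L_{i,i+1}$; on the torus $\mathbf T_L=\mathbb Z/L\mathbb Z$ it has generator $\sum_{i\in\mathbf T_L}\mathcal L_{i,i+1}$; the infinite-volume process on $\mathbb Z$ has generator $\sum_{i\in\mathbb Z}\mathcal L_{i,i+1}$. A function $f$ of configurations is monotone if $f(\eta)\le f(\eta')$ whenever $\eta\le\eta'$ in the (coordinatewise) partial order; a Markov process with semigroup $S(t)$ is monotone if, for every $t\ge0$, $S(t)f$ is monotone whenever $f$ is monotone. A translation invariant (homogeneous) product measure is one of the form $\bigotimes_i\mu$ with a single probability measure $\mu$ on $\{0,\dots,2j\}$.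
   Formalization: In (d) and (e) the two trivial translation invariant product measures, with μ the point mass at 0 (all sites empty) or at 2j (all sites full), are excluded; all rates vanish there, so they are stationary and the claim fails for them as literally stated. *)

(* Defs.v *)
From HB Require Import structures.
From mathcomp Require Import all_boot all_order all_algebra.
From mathcomp Require Import all_classical all_reals all_analysis.

Set Implicit Arguments.
Unset Strict Implicit.
Unset Printing Implicit Defensive.

Import Order.TTheory GRing.Theory Num.Theory.
Import numFieldNormedType.Exports.

Local Open Scope classical_set_scope.
Local Open Scope ring_scope.

(* Throughout, the half-integer spin j is encoded by the natural number
   N = 2j, so that j in {1/2, 1, 3/2, ...} means 0 < N, and j <> 1/2 means
   N <> 1. *)

Section qnumbers.
Variables (R : realType) (q : R).

Definition qnum (n : nat) : R := (q ^+ n - q ^- n) / (q - q^-1).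

Definition qfact (n : nat) : R := \prod_(1 <= k < n.+1) qnum k.

Definition qbinom (n k : nat) : R := qfact n / (qfact k * qfact (n - k)).

End qnumbers.

(* The space {0, ..., N}^V with the product of the discrete topologies (for a
   finite V it is therefore discrete, and every function on it is
   continuous). *)
Definition config (N : nat) (V : Type) : Type := V -> 'I_N.+1.

HB.instance Definition _ (N : nat) (V : Type) :=
  Topological.copy (config N V) {ptws V -> discrete_topology 'I_N.+1}.

HB.instance Definition _ (N : nat) (V : Type) :=
  isPointed.Build (config N V) (fun _ => ord0).

(* The same space with its Borel sigma-algebra; for a countable V this is the
   product sigma-algebra. *)
Definition bconfig (N : nat) (V : Type) :=
  g_sigma_algebraType (@open (config N V)).

Section configurations.
Variables (R : realType) (N : nat) (V : choiceType).
Implicit Types (eta xi : config N V) (f g : config N V -> R).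

(* [move x y eta] is eta^{x,y}. The value is meaningful for x <> y,
   0 < eta x and eta y < N; if eta x = 0 or eta y = N, the rate with which it
   occurs in [bond] vanishes. *)
Definition move (x y : V) eta : config N V := fun z =>
  if z == x then inord (eta x).-1
  else if z == y then inord (eta y).+1
  else eta z.

(* The operator L_{i,i+1}, for i = x and i+1 = y. *)
Definition bond (q : R) (x y : V) f eta : R :=
  q ^ ((eta x)%:Z - (eta y)%:Z - (N.+1)%:Z)
    * qnum q (eta x) * qnum q (N - eta y) * (f (move x y eta) - f eta)
  + q ^ ((eta x)%:Z - (eta y)%:Z + (N.+1)%:Z)
    * qnum q (N - eta x) * qnum q (eta y) * (f (move y x eta) - f eta).

Definition monotone f : Prop :=
  forall eta xi, (forall x, (eta x <= xi x)%N) -> f eta <= f xi.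

Definition cylinder f : Prop :=
  exists s : seq V, forall eta xi,
    (forall x, x \in s -> eta x = xi x) -> f eta = f xi.

(* P is the product measure with one-site marginals [rho]. *)
Definition product_measure (P : probability (bconfig N V) R)
    (rho : V -> 'I_N.+1 -> R) : Prop :=
  forall (s : seq V) (xi : config N V), uniq s ->
    P [set eta : config N V | forall x, x \in s -> eta x = xi x]
      = (\prod_(x <- s) rho x (xi x))%:E.

(* The point masses at the configurations [eta = 0] and [eta = N] (no particle
   and no hole, respectively) are invariant under any exclusion dynamics; they
   are the homogeneous product measures left out here. That [mu] is a
   probability vector follows from P being a probability. *)
Definition nondegenerate_homogeneous_product
    (P : probability (bconfig N V) R) : Prop :=
  exists mu : 'I_N.+1 -> R,
    [/\ product_measure P (fun=> mu), mu ord0 <> 1 & mu ord_max <> 1].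

(* A process is given by its family of transition operators
   (S t f) eta = E^eta [f (eta_t)], for t >= 0 and f continuous. *)
Definition operators := R -> (config N V -> R) -> (config N V -> R).

Implicit Types (S : operators) (P : probability (bconfig N V) R).

Definition reversible P S : Prop := forall (t : R) f g,
  0 <= t -> continuous f -> continuous g ->
  (\int[P]_eta (f eta * S t g eta)%:E = \int[P]_eta (g eta * S t f eta)%:E)%E.

Definition stationary P S : Prop := forall (t : R) f,
  0 <= t -> continuous f ->
  (\int[P]_eta (S t f eta)%:E = \int[P]_eta (f eta)%:E)%E.

Definition monotone_process S : Prop := forall (t : R) f,
  0 <= t -> continuous f -> monotone f -> monotone (S t f).

(* exp (t L); for a finite V, this is the semigroup of the Markov chain with
   generator L. *)
Definition exp_semigroup (L : (config N V -> R) -> (config N V -> R)) :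
    operators := fun t f eta =>
  limn (series (fun k => exp_coeff t k * iter k L f eta)).

(* Strongly continuous Markov semigroups on C({0, ..., N}^V), as in Liggett,
   Interacting Particle Systems, Definition I.1.4. *)
Record markov_semigroup S : Prop := MarkovSemigroup {
  ms_continuous : forall (t : R) f, 0 <= t -> continuous f -> continuous (S t f);
  ms_linear : forall (t a : R) f g, 0 <= t -> continuous f -> continuous g ->
    S t (fun eta => a * f eta + g eta) = fun eta => a * S t f eta + S t g eta;
  ms_zero : forall f, continuous f -> S 0 f = f;
  ms_add : forall (s t : R) f, 0 <= s -> 0 <= t -> continuous f ->
    S (s + t) f = S s (S t f);
  ms_one : forall t : R, 0 <= t -> S t (fun=> 1) = fun=> 1;
  ms_ge0 : forall (t : R) f, 0 <= t -> continuous f ->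
    (forall eta, 0 <= f eta) -> forall eta, 0 <= S t f eta;
  ms_right_continuous : forall (t : R) f, 0 <= t -> continuous f ->
    {uniform, (fun s => S s f) @ t^'+ --> S t f} }.

(* f is in the domain of the infinitesimal generator of S, which maps it
   to g. *)
Definition generator S f g : Prop :=
  continuous f /\
  {uniform, (fun t eta => t^-1 * (S t f eta - f eta)) @ 0^'+ --> g}.

(* (f, g) is in the closure of the graph of L on cylinder functions. *)
Definition closed_extension (L : (config N V -> R) -> (config N V -> R)) f g :
    Prop :=
  exists h : nat -> config N V -> R,
    [/\ forall n, cylinder (h n),
        {uniform, h @ \oo --> f} &
        {uniform, (fun n => L (h n)) @ \oo --> g}].

(* S is the semigroup of the process with generator L: the generator of S, as
   an unbounded operator, is the closure of L. *)
Definition generated_by (L : (config N V -> R) -> (config N V -> R)) S : Prop :=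
  markov_semigroup S /\ forall f g, generator S f g <-> closed_extension L f g.

Definition well_defined (L : (config N V -> R) -> (config N V -> R)) : Prop :=
  (exists S, generated_by L S) /\
  (forall S S', generated_by L S -> generated_by L S' ->
    forall (t : R) f, 0 <= t -> continuous f -> S t f = S' t f).

End configurations.

Section asep.
Variables (R : realType) (q : R) (N : nat).

(* Closed boundary on {1, ..., L}; the site i is the element i - 1 of 'I_L. *)
Definition asep_closed (L : nat) (f : config N 'I_L -> R) (eta : config N 'I_L)
    : R :=
  \sum_(i < L) \sum_(k < L | k == i.+1 :> nat) bond q i k f eta.

(* Z/LZ is represented by 'I_L with its cyclic successor. *)
Definition asep_torus (L : nat) (f : config N 'I_L -> R) (eta : config N 'I_L)
    : R :=
  \sum_(i < L) bond q i (ordS i) f eta.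

(* Only finitely many terms are nonzero when f is a cylinder function. *)
Definition asep_Z (f : config N int -> R) (eta : config N int) : R :=
  \sum_(i \in [set: int]) bond q i (i + 1) f eta.

(* q^{2n(1 + j - 2ji)}, with 2j = N. *)
Definition site_factor (i : int) (n : nat) : R :=
  q ^ (n%:Z * (2 + N%:Z - 2 * N%:Z * i)).

Definition partition_function (alpha : R) (i : int) : R :=
  \sum_(n < N.+1) qbinom q N n * alpha ^+ n * site_factor i n.

Definition asep_marginal (alpha : R) (i : int) (n : 'I_N.+1) : R :=
  alpha ^+ n / partition_function alpha i * qbinom q N n * site_factor i n.

End asep.

(* Main.v *)
(* With g = q^2, the rates of a bond are proportional to
   (1 - g^a)(1 - g^(N-b)) and g (g^a - g^N)(g^(N-b) - g^N). They are monotone in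
   the occupations a, b of the two sites, so that L + C maps monotone functions
   to monotone functions for C large, and so does
   exp(tL) = e^{-Ct} exp(t(L + C)).

   In infinite volume, L^k f is bounded by a multiple of k! C^k for a cylinder
   function f, uniformly over finite windows. Hence for small t the evolutions
   in finite windows converge, and any Markov semigroup whose generator extends
   L on cylinder functions has the same Taylor series; this gives existence and
   uniqueness, first for small t and then for all t by the semigroup property.
   Monotonicity and reversibility pass to the limit. A product measure on a
   countable set of sites is the image of the Lebesgue measure on [0, 1) under a
   digit expansion, and detailed balance holds bond by bond.

   If a homogeneous product measure with weights m is stationary, testing the
   generator on u(eta_x) v(eta_y) for neighbours x, y shows that the divergence
   K(a, b-1) - K(a-1, b) of the two-site current K is of the form
   d(a) m(b) - m(a) d(b). Either m is carried by {0, N}, which is excluded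
   directly, or m(0), m(1), m(2) > 0; then the relations with a + b <= 3 are
   contradictory. *)

From HB Require Import structures.
Require Import Defs.
From mathcomp Require Import all_boot all_order all_algebra.
From mathcomp Require Import all_classical all_reals all_analysis.
From mathcomp Require Import measurable_realfun.
From mathcomp Require Import ring lra zify.

Set Implicit Arguments.
Unset Strict Implicit.
Unset Printing Implicit Defensive.

Import Order.TTheory GRing.Theory Num.Theory.
Import numFieldNormedType.Exports.

Local Open Scope classical_set_scope.
Local Open Scope ring_scope.

(** * Taylor expansions *)

(** On Z each application of the generator widens the support of a cylinder function, and with it
    the number of bonds that act; this is where the factor k! comes from. So the exponential series
    is controlled only up to a fixed time, and the function reached by then need not be a cylinder
    function. Every small-time statement is therefore extended to all continuous functions, by
    density and contraction, before times are added. The norms of the window generators grow with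
    the window, so Taylor remainders are estimated through the n-th iterate of the given function
    alone, with contraction replacing the norm of the exponential.

    The definition of the process asks for more than an extension of L: the generator must be
    exactly the closure of L, that is, cylinder functions must form a core. This closure is
    invariant under the semigroup, because Taylor polynomials of cylinder functions are cylinder
    functions and commute with L. A finite sum approximating the resolvent then lies in the closure,
    and dissipativity brings every element of the domain close to such sums. *)

Section mean_value.
Context {R : realType}.
Implicit Types (a c t x B : R) (u w psi : R -> R).

(** The functions [psi - u] and [psi + u] have nonnegative derivatives. Differentiability is asked
    for in the open interval only, since semigroups have just a right derivative at time 0. *)
Lemma ler_dist_derive u u' psi psi' (T : R) : 0 <= T ->
  (forall x, 0 < x < T -> is_derive x 1 u (u' x)) ->
  (forall x, 0 < x < T -> is_derive x 1 psi (psi' x)) ->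
  {within `[0, T], continuous u} -> {within `[0, T], continuous psi} ->
  (forall x, 0 < x < T -> `|u' x| <= psi' x) ->
  `|u T - u 0| <= psi T - psi 0.
Proof.
move=> T0 du dpsi cu cpsi le_u.
suff H (s : R) : `|s| = 1 -> s * (u T - u 0) <= psi T - psi 0.
  have := H 1 (normr1 _); have := H (-1) (normrN1 _).
  by rewrite mul1r mulN1r ler_norml; lra.
move=> s1; set w := fun x => psi x - s * u x.
suff: w 0 <= w T by rewrite /w; lra.
apply: (@ger0_derive1_ndecr R w 0 T) => //.
- move=> x; rewrite in_itv /= => xT.
  have := du x xT; have := dpsi x xT => hp hu.
  by apply: derivableB => //; exact: derivableZ.
- move=> x; rewrite in_itv /= => xT.
  have := du x xT; have := dpsi x xT => hp hu.
  have hw : is_derive x 1 w (psi' x - s *: u' x) by exact: is_deriveB.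
  rewrite derive1E derive_val subr_ge0.
  rewrite (le_trans _ (le_u x xT))// (le_trans (ler_norm _))// normrZ s1.
  by rewrite mul1r.
- move=> x; apply: cvgB; first exact: cpsi.
  by apply: cvgM; [exact: cvg_cst|exact: cu].
Qed.

Lemma ler_dist_derive_cst (u u' : R -> R) c (B T : R) : 0 <= T ->
  (forall x, 0 < x < T -> is_derive x 1 u (u' x)) ->
  {within `[0, T], continuous u} ->
  (forall x, 0 < x < T -> `|u' x - c| <= B) ->
  `|u T - u 0 - T * c| <= T * B.
Proof.
move=> T0 du cu le_u.
have cid (k : R) : {within `[0, T], continuous (fun x : R => x * k)}.
  apply: continuous_subspaceT => x.
  by apply: cvgM; [exact: cvg_id|exact: cvg_cst].
have did (k x : R) : is_derive x 1 (fun x : R => x * k) k.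
  rewrite (_ : (fun x => _) = k \*: @idfun R); last first.
    by apply/funext => y; rewrite /= mulrC.
  by apply: is_derive_eq; exact: mulr1.
have := @ler_dist_derive (fun x => u x - x * c) (fun x => u' x - c)
  (fun x => x * B) (fun=> B) T T0.
rewrite !mul0r !subr0 addrAC; apply => //.
- by move=> x xT; have := du x xT => ?; exact: is_deriveB.
- by move=> x; apply: cvgB; [exact: cu|exact: cid].
Qed.

Lemma is_derive_exp_coeff k x :
  is_derive x 1 (fun y : R => exp_coeff y k.+1) (exp_coeff x k).
Proof.
have := @is_deriveZ _ _ _ _ (k.+1`!%:R^-1 : R) _ _ _
  (is_deriveX k.+1 (is_derive_id x (1 : R))).
rewrite (_ : _ \*: _ = fun y : R => exp_coeff y k.+1); last first.
  by apply/funext => y; rewrite exprfctE /exp_coeff /= mulrC.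
move/is_derive_eq; apply.
rewrite scalerA [LHS]mulr1 /exp_coeff /= factS natrM invfM mulrA.
by rewrite [_ / _ * _%:R]mulrAC mulVf ?pnatr_eq0// mul1r mulrC.
Qed.

(** Induction on K: the derivative of the remainder of order [K.+1] is the remainder of order K of
    the shifted family. A family [v] closed under differentiation replaces higher derivatives, so
    that the bound covers both exponential series and paths of an abstract semigroup. *)
Lemma taylor_bound (v : nat -> R -> R) (M : nat -> R) (T : R) : 0 <= T ->
  (forall k x, 0 < x < T -> is_derive x 1 (v k) (v k.+1 x)) ->
  (forall k, {within `[0, T], continuous (v k)}) ->
  (forall k x, 0 <= x <= T -> `|v k x| <= M k) ->
  forall K, `|v 0%N T - \sum_(k < K) exp_coeff T k * v k 0|
    <= exp_coeff T K * M K.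
Proof.
move=> T0 dv cv Mv K; elim: K v M T T0 dv cv Mv => [|K IH] v M T T0 dv cv Mv.
  rewrite big_ord0 subr0 /exp_coeff /= expr0 fact0 divr1 mul1r.
  by apply: Mv; rewrite T0 lexx.
have M0 : 0 <= M K.+1.
  by apply: le_trans (Mv K.+1 0 _) => //; rewrite lexx T0.
have exp0 k : exp_coeff (0 : R) k.+1 = 0 by rewrite /exp_coeff/= expr0n mul0r.
have cexp k (U : R) (c : R) :
    {within `[0, U], continuous (fun y : R => exp_coeff y k * c)}.
  apply: continuous_subspaceT => x; apply: cvgM; last exact: cvg_cst.
  apply: cvgM; last exact: cvg_cst.
  exact: exprn_continuous.
pose w y := v 0%N y - \sum_(k < K.+1) exp_coeff y k * v k 0.
pose w' y := v 1%N y - \sum_(k < K) exp_coeff y k * v k.+1 0.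
have w0 : w 0 = 0.
  rewrite /w big_ord_recl /= /exp_coeff /= expr0 fact0 divr1 mul1r.
  by rewrite big1 ?addr0 ?subrr// => k _; rewrite expr0n mul0r mul0r.
have := @ler_dist_derive w w' (fun y => exp_coeff y K.+1 * M K.+1)
  (fun y => exp_coeff y K * M K.+1) T T0.
rewrite w0 exp0 mul0r !subr0; apply.
- move=> x xT; have := dv 0%N x xT => d0; apply: is_deriveB.
  rewrite (_ : (fun y => _) = cst (v 0%N 0) +
      \sum_(k < K) (v k.+1 0 \*: fun y => exp_coeff y k.+1)); last first.
    apply/funext => y; rewrite /= fctE fct_sumE big_ord_recl /=; congr (_ + _).
      by rewrite /exp_coeff /= expr0 fact0 divr1 mul1r.
    by apply: eq_bigr => k _; rewrite mulrC.
  apply: is_derive_eq (is_deriveD (is_derive_cst _ _ _) (is_derive_sum _)) _.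
    by move=> k; apply: is_deriveZ; exact: is_derive_exp_coeff.
  by rewrite add0r; apply: eq_bigr => k _; rewrite /GRing.scale/= mulrC.
- move=> x xT; rewrite (_ : (fun y => _) = M K.+1 \*: (fun y => exp_coeff y K.+1)).
    apply: is_derive_eq (is_deriveZ _ (is_derive_exp_coeff _ _)) _.
    by rewrite /GRing.scale/= mulrC.
  by apply/funext => y; rewrite /= mulrC.
- move=> x; apply: cvgB; first exact: cv.
  apply: cvg_big; first exact: add_continuous.
  by move=> k _; exact: cexp.
- exact: cexp.
- move=> x /andP[x0 xT].
  apply: (IH (fun k => v k.+1) (fun k => M k.+1) x (ltW x0)) => k.
  + by move=> y /andP[y0 yx]; apply: dv; rewrite y0 (lt_trans yx).
  + apply: continuous_subspaceW (cv k.+1) => y /=; rewrite !in_itv /=.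
    by move=> /andP[-> yx]; rewrite (le_trans yx) ?ltW.
  + by move=> y /andP[y0 yx]; apply: Mv; rewrite y0 (le_trans yx) ?ltW.
Qed.

End mean_value.

(** * Exponential generating functions of geometrically bounded sequences *)

Section exponential_generating_function.
Context {R : realType}.
Implicit Types (a : nat -> R) (t C M : R).

Definition egf a t : R := limn (series (fun k => exp_coeff t k * a k)).

Lemma normr_exp_coeff t k : `|exp_coeff t k| = exp_coeff `|t| k.
Proof. by rewrite /exp_coeff /= normrM normrX normfV normr_nat. Qed.

Lemma exp_coeffM x y k : exp_coeff (x * y) k = exp_coeff x k * y ^+ k :> R.
Proof. by rewrite /exp_coeff /= exprMn mulrAC. Qed.

Lemma ler_egf_coeff a M C t k : `|a k| <= M * C ^+ k ->
  `|exp_coeff t k * a k| <= M * exp_coeff (`|t| * C) k.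
Proof.
move=> aM; rewrite normrM normr_exp_coeff exp_coeffM mulrCA.
by rewrite ler_wpM2l// exp_coeff_ge0.
Qed.

Lemma is_cvg_normed_egf a M C t : (forall k, `|a k| <= M * C ^+ k) ->
  cvgn [normed series (fun k => exp_coeff t k * a k)].
Proof.
move=> aM; apply: (@series_le_cvg _ _ (fun k => M * exp_coeff (`|t| * C) k)).
- by move=> k; exact: normr_ge0.
- by move=> k; apply: le_trans (ler_egf_coeff _ (aM k)); exact: normr_ge0.
- by move=> k; exact: ler_egf_coeff.
- by apply: is_cvg_seriesZ; exact: is_cvg_series_exp_coeff.
Qed.

Lemma is_cvg_egf a M C t : (forall k, `|a k| <= M * C ^+ k) ->
  cvgn (series (fun k => exp_coeff t k * a k)).
Proof. by move=> aM; apply: normed_cvg; exact: is_cvg_normed_egf aM. Qed.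

Lemma normr_egf a M C t : (forall k, `|a k| <= M * C ^+ k) ->
  `|egf a t| <= M * expR (`|t| * C).
Proof.
move=> aM; apply: le_trans (@lim_series_norm _ R^o _ _) _.
  exact: is_cvg_normed_egf aM.
have cE : cvgn (series (exp_coeff (`|t| * C))) by exact: is_cvg_series_exp_coeff.
have -> : M * expR (`|t| * C) = limn (series (M *: exp_coeff (`|t| * C))).
  by rewrite lim_seriesZ.
apply: lim_series_le.
- exact: is_cvg_normed_egf aM.
- exact: is_cvg_seriesZ.
- by move=> k; exact: ler_egf_coeff.
Qed.

Lemma pseries_egf a t : pseries (fun k => k`!%:R^-1 * a k) t =
  series (fun k => exp_coeff t k * a k).
Proof.
rewrite /pseries; congr series; apply/funext => k.
by rewrite /exp_coeff /= [LHS]mulrC mulrA.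
Qed.

Lemma pseries_diffs_egf a : pseries_diffs (fun k => k`!%:R^-1 * a k) =
  (fun k => k`!%:R^-1 * a k.+1).
Proof.
apply/funext => k; rewrite /pseries_diffs factS natrM invfM mulrA mulrA.
by rewrite mulfV ?pnatr_eq0// mul1r.
Qed.

Lemma is_derive_egf a M C t : (forall k, `|a k| <= M * C ^+ k) ->
  is_derive t 1 (egf a) (egf (fun k => a k.+1) t).
Proof.
move=> aM.
(* Termwise differentiation needs convergence of the series and of its first two derived series at a
   point beyond [|t|]; each shift of the coefficients costs one factor C. *)
have aM1 k : `|a k.+1| <= M * C * C ^+ k by rewrite -mulrA -exprS.
have aM2 k : `|a k.+2| <= M * C * C * C ^+ k by rewrite -mulrA -exprS.
have cvgE (b : nat -> R) (M' : R) : (forall k, `|b k| <= M' * C ^+ k) ->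
    cvgn (pseries (fun k => k`!%:R^-1 * b k) (`|t| + 1)).
  by move=> bM; rewrite pseries_egf; exact: is_cvg_egf bM.
have egfE b : egf b = fun x => limn (pseries (fun k => k`!%:R^-1 * b k) x).
  by apply/funext => x; rewrite pseries_egf.
rewrite egfE [in X in is_derive _ _ _ X]egfE -pseries_diffs_egf.
apply: (@pseries_snd_diffs _ _ (`|t| + 1)).
- exact: cvgE aM.
- by rewrite pseries_diffs_egf; exact: cvgE aM1.
- by rewrite !pseries_diffs_egf; exact: cvgE aM2.
- by rewrite [ltRHS]ger0_norm ?addr_ge0// ltrDl.
Qed.

End exponential_generating_function.

(** * Continuous functions on configurations *)

Section config_topology.
Context {N : nat} {V : choiceType}.
Implicit Types (eta xi : config N V) (s : seq V).

Definition agree s eta : set (config N V) :=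
  [set xi | forall x, x \in s -> xi x = eta x].

Lemma nbhs_agree s eta : nbhs eta (agree s eta).
Proof.
elim: s => [|x s IH]; first by apply: filterS filterT => xi _ x; rewrite in_nil.
have cx : nbhs eta [set xi : config N V | xi x = eta x].
  have := @proj_continuous V (fun _ => discrete_topology 'I_N.+1) x eta.
  by move=> /(_ [set eta x]) /=; apply; rewrite nbhs_principalE.
apply: filterS (filterI cx IH) => xi /= [xix xis] y; rewrite inE => /orP[/eqP->//|].
exact: xis.
Qed.

(** The product topology is a supremum of topologies induced by the coordinates, so it suffices that
    the filter generated by the sets [agree s eta] converges to [eta] in each coordinate. *)
Lemma nbhs_configP eta (A : set (config N V)) :
  nbhs eta A <-> exists s, agree s eta `<=` A.
Proof.
split; last by move=> [s sA]; apply: filterS sA (nbhs_agree s eta).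
pose G := filter_from [set: seq V] (fun s => agree s eta).
have GF : Filter G.
  apply: filter_from_filter; first by exists [::].
  move=> s1 s2 _ _; exists (s1 ++ s2) => // xi xis.
  by split=> x xs; apply: xis; rewrite mem_cat xs ?orbT.
suff: G --> eta by move=> /(_ A)/[apply] -[s _ sA]; exists s.
apply/cvg_sup => x U [W] [[B] oB <-] Weta WU; apply: (filterS WU).
by exists [:: x] => // xi /(_ x); rewrite mem_seq1 eqxx /= => -> //.
Qed.

Lemma compact_config : compact [set: config N V].
Proof.
have := @tychonoff V (fun _ => discrete_topology 'I_N.+1) (fun _ => setT).
rewrite (_ : [set f | _] = setT); last by apply/seteqP.
by apply=> x; apply: finite_compact; exact: finite_finset.
Qed.

End config_topology.

Section continuous_functions.
Context {R : realType} {N : nat} {V : choiceType}.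
Implicit Types (eta xi : config N V) (s : seq V) (f g : config N V -> R) (e : R).

Lemma uniform_cvgP {J : Type} (F : set_system J) (u : J -> config N V -> R) g :
  Filter F ->
  {uniform, u @ F --> g} <->
  forall e, 0 < e -> \forall i \near F, forall eta, `|u i eta - g eta| <= e.
Proof.
move=> FF; split=> [ug e e0|ug A].
  have : nbhs (g : {uniform config N V -> R})
      [set h | forall eta, `|h eta - g eta| <= e].
    apply/uniform_nbhs; exists [set xy | ball xy.1 e xy.2]; split.
      by rewrite -entourage_ballE; exists e.
    by move=> h /= hg eta; have := hg eta I; rewrite /ball /= distrC => /ltW.
  by move/ug; rewrite nbhs_simpl.
move=> /uniform_nbhs[E [+ EA]] => /=.
rewrite -entourage_ballE => -[e /= e0 eE].
have e20 : 0 < e / 2 by rewrite divr_gt0.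
rewrite nbhs_simpl /=; apply: filterS (ug _ e20) => i ui; apply: EA => eta _.
apply: eE; rewrite /= /ball /= distrC (le_lt_trans (ui eta))//.
by rewrite ltr_pdivrMr// ltr_pMr// ltr1n.
Qed.

Lemma continuous_configP f : continuous f <->
  forall eta e, 0 < e ->
    exists s, forall xi, agree s eta xi -> `|f eta - f xi| <= e.
Proof.
split=> [cf eta e e0|cf eta].
  have /cvgr_dist_le/(_ e e0)/nbhs_configP[s sf] := cf eta.
  by exists s => xi /sf.
apply/(@cvgrPdist_le _ _ _ _ (nbhs_filter eta)) => e e0; have [s sf] := cf eta e e0.
by apply/nbhs_configP; exists s => xi /sf.
Qed.

Lemma cylinder_continuous f : cylinder f -> continuous f.
Proof.
move=> [s sf]; apply/continuous_configP => eta e e0; exists s => xi xis.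
by rewrite (sf eta xi) ?subrr ?normr0 ?ltW// => x xs; rewrite xis.
Qed.

Lemma continuous_approx f :
  (forall e, 0 < e ->
    exists2 g, continuous g & forall eta, `|f eta - g eta| <= e) ->
  continuous f.
Proof.
move=> fg; apply/continuous_configP => eta e e0.
have e30 : 0 < e / 3 by rewrite divr_gt0.
have [g /continuous_configP/(_ eta _ e30)[s sg] gf] := fg _ e30.
exists s => xi /sg gg; have := gf eta; have := gf xi.
by move: gg; rewrite !ler_norml; lra.
Qed.

(** Replacing [eta] by 0 outside a finite set s changes f by at most e near any given point once s
    is large; compactness makes one s work everywhere. Finite sets directed by inclusion serve as
    the filter of the near-covering property. *)
Lemma cylinder_dense f e : continuous f -> 0 < e ->
  exists2 h, cylinder h & forall eta, `|f eta - h eta| <= e.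
Proof.
move=> cf e0; have e20 : 0 < e / 2 by rewrite divr_gt0.
pose trunc s eta : config N V := fun x => if x \in s then eta x else ord0.
pose F : set_system (seq V) := filter_from [set: seq V]
  (fun s => [set s' : seq V | {subset s <= s'}]).
have FF : Filter F.
  apply: filter_from_filter; first by exists [::].
  move=> s1 s2 _ _; exists (s1 ++ s2) => // s' ss'.
  by split=> x xs; apply: ss'; rewrite mem_cat xs ?orbT.
have /compact_near_coveringP := @compact_config N V.
move=> /(_ _ F (fun s eta => `|f eta - f (trunc s eta)| <= e) FF)[].
  move=> eta _; have /continuous_configP/(_ eta _ e20)[s sf] := cf.
  exists (agree s eta, [set s' : seq V | {subset s <= s'}]) => /=.
    by split; [exact: nbhs_agree|exists s].
  move=> [xi s'] /= [xis ss'].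
  have h1 := sf xi xis.
  have : agree s eta (trunc s' xi) by move=> x xs; rewrite /trunc ss'// xis.
  by move=> /sf h2; move: h1 h2; rewrite !ler_norml; lra.
move=> s _ /= sP; exists (f \o trunc s); last by move=> eta; exact: sP.
exists s => eta xi eta_xi /=; congr f; apply/funext => x; rewrite /trunc.
by case: ifP => // xs; rewrite eta_xi.
Qed.

Lemma continuous_bounded f : continuous f ->
  exists M : R, forall eta, `|f eta| <= M.
Proof.
move=> cf; have : compact (f @` [set: config N V]).
  apply: continuous_compact; last exact: compact_config.
  by apply: continuous_subspaceT => x; exact: cf.
move=> /compact_bounded[M [_ fM]]; exists (M + 1) => eta.
by apply: (fM (M + 1)); [rewrite ltrDl|exists eta].
Qed.

Lemma config_continuous_cst (a : R) : continuous (fun _ : config N V => a).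
Proof. by apply: cylinder_continuous; exists [::]. Qed.

Lemma config_continuousM f g : continuous f -> continuous g ->
  continuous (fun eta => f eta * g eta).
Proof.
by move=> cf cg eta; apply: (@cvgM _ _ _ (nbhs_filter eta)); [exact: cf|exact: cg].
Qed.

Lemma config_continuousZD (a : R) f g : continuous f -> continuous g ->
  continuous (fun eta => a * f eta + g eta).
Proof.
move=> cf cg eta; apply: (@cvgD _ _ _ _ (nbhs_filter eta)); last exact: cg.
by apply: config_continuousM => //; exact: config_continuous_cst.
Qed.

Lemma config_continuousD f g : continuous f -> continuous g ->
  continuous (fun eta => f eta + g eta).
Proof.
by move=> cf cg; have := config_continuousZD (a := 1) cf cg; under eq_fun do rewrite mul1r.
Qed.

Lemma config_continuousB f g : continuous f -> continuous g ->
  continuous (fun eta => f eta - g eta).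
Proof.
by move=> cf cg eta; apply: (@cvgB _ _ _ _ (nbhs_filter eta)); [exact: cf|exact: cg].
Qed.

Lemma config_continuous_sum (a : nat -> R) (u : nat -> config N V -> R) n :
  (forall k, continuous (u k)) ->
  continuous (fun eta => \sum_(k < n) a k * u k eta).
Proof.
move=> cu; elim: n => [|n IH].
  by under eq_fun do rewrite big_ord0; exact: config_continuous_cst.
under eq_fun do rewrite big_ord_recr /= addrC.
exact: config_continuousZD.
Qed.

End continuous_functions.

(** * Rates and attractiveness *)

Section rates.
Context {R : realType} (q : R) (N : nat).
Hypotheses (q_gt0 : 0 < q) (q_lt1 : q < 1).

Definition rate_right (a b : nat) : R :=
  q ^ (a%:Z - b%:Z - (N.+1)%:Z) * qnum q a * qnum q (N - b).

Definition rate_left (a b : nat) : R :=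
  q ^ (a%:Z - b%:Z + (N.+1)%:Z) * qnum q (N - a) * qnum q b.

(** The common factor of both rates, and an upper bound for them. The exponent 2N+1 is what remains
    of a - b - (N+1) = a + (N-b) - (2N+1) after the two q-numbers absorb the powers a and N-b. *)
Definition rate_max : R := (q^-1 - q)^-1 ^+ 2 * q ^- N.*2.+1.

Let q_neq0 : q != 0. Proof. by rewrite gt_eqF. Qed.

Lemma qnum_gap_gt0 : 0 < q^-1 - q.
Proof. by rewrite subr_gt0 (lt_trans q_lt1)// invf_gt1. Qed.

Lemma qnumE n : qnum q n = (q^-1 - q)^-1 * q ^- n * (1 - q ^+ 2 ^+ n).
Proof.
rewrite /qnum -exprM mulnC exprM expr2 -[q - _]opprB invrN.
have : q ^+ n != 0 by rewrite expf_neq0.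
by move: (q ^+ n) => x x0; set c := (_ - _)^-1; field.
Qed.

Lemma rate_max_gt0 : 0 < rate_max.
Proof. by rewrite mulr_gt0 ?exprn_gt0 ?invr_gt0 ?exprn_gt0 ?qnum_gap_gt0. Qed.

Lemma rate_rightE a b : (b <= N)%N ->
  rate_right a b = rate_max * ((1 - q ^+ 2 ^+ a) * (1 - q ^+ 2 ^+ (N - b))).
Proof.
move=> bN; rewrite /rate_right !qnumE /rate_max.
have -> : q ^ (a%:Z - b%:Z - (N.+1)%:Z) = q ^+ a * q ^+ (N - b) * q ^- N.*2.+1.
  rewrite (exprnP q a) (exprnP q (N - b)) (exprnN q) -!expfzDr//.
  by congr (q ^ _); lia.
have : q ^+ a != 0 by rewrite expf_neq0.
have : q ^+ (N - b) != 0 by rewrite expf_neq0.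
rewrite -![q ^+ 2 ^+ _]exprM.
move: (q ^+ a) (q ^+ (N - b)) => x y x0 y0.
rewrite expr2; set c := (q^-1 - q)^-1; set d := q ^- _.
by field; rewrite x0.
Qed.

Lemma rate_leftE a b : (a <= N)%N -> (b <= N)%N ->
  rate_left a b = rate_max * (q ^+ 2 *
    ((q ^+ 2 ^+ a - q ^+ 2 ^+ N) * (q ^+ 2 ^+ (N - b) - q ^+ 2 ^+ N))).
Proof.
move=> aN bN; rewrite /rate_left !qnumE /rate_max.
have -> : q ^ (a%:Z - b%:Z + (N.+1)%:Z) = q ^+ b * q ^+ (N - a) *
    (q ^- N.*2.+1 * (q ^+ 2 * (q ^+ 2 ^+ a * q ^+ 2 ^+ (N - b)))).
  rewrite -!exprM (exprnP q b) (exprnP q (N - a)) (exprnN q) (exprnP q 2).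
  rewrite (exprnP q (2 * a)) (exprnP q (2 * (N - b))) -!expfzDr//.
  by congr (q ^ _); lia.
have : q ^+ b != 0 by rewrite expf_neq0.
have : q ^+ (N - a) != 0 by rewrite expf_neq0.
have eb : q ^+ 2 ^+ (N - b) * (1 - q ^+ 2 ^+ b) = q ^+ 2 ^+ (N - b) - q ^+ 2 ^+ N.
  by rewrite mulrBr mulr1 -exprD subnK.
have ea : q ^+ 2 ^+ a * (1 - q ^+ 2 ^+ (N - a)) = q ^+ 2 ^+ a - q ^+ 2 ^+ N.
  by rewrite mulrBr mulr1 -exprD subnKC.
rewrite -ea -eb.
move: (q ^+ b) (q ^+ (N - a)) => x y x0 y0.
set c := (q^-1 - q)^-1; set d := q ^- _.
by field; rewrite x0 y0.
Qed.

Let g01 n : 0 <= q ^+ 2 ^+ n <= 1.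
Proof.
by rewrite -exprM exprn_ge0 ?exprn_ile1 ?ltW.
Qed.

Let gle m n : (m <= n)%N -> q ^+ 2 ^+ n <= q ^+ 2 ^+ m.
Proof.
move=> mn; rewrite ler_wiXn2l// ?exprn_ge0 ?ltW//.
by rewrite exprn_ilt1 ?ltW.
Qed.

Let mul01 (x y : R) : 0 <= x <= 1 -> 0 <= y <= 1 -> 0 <= x * y <= 1.
Proof. by move=> /andP[x0 x1] /andP[y0 y1]; rewrite mulr_ge0//= mulr_ile1. Qed.

Lemma rate_right_bounds a b : (b <= N)%N -> 0 <= rate_right a b <= rate_max.
Proof.
move=> bN; rewrite rate_rightE//.
have g1 n : 0 <= 1 - q ^+ 2 ^+ n <= 1 by have := g01 n; lra.
have /andP[? ?] := mul01 (g1 a) (g1 (N - b)%N).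
by rewrite mulr_ge0//= ?ler_piMr// ltW// rate_max_gt0.
Qed.

Lemma rate_left_bounds a b : (a <= N)%N -> (b <= N)%N ->
  0 <= rate_left a b <= rate_max.
Proof.
move=> aN bN; rewrite rate_leftE//.
have g1 n : (n <= N)%N -> 0 <= q ^+ 2 ^+ n - q ^+ 2 ^+ N <= 1.
  by move=> /gle; have := g01 n; have := g01 N; lra.
have /andP[? ?] := mul01 (g01 1) (mul01 (g1 _ aN) (g1 _ (leq_subr b N))).
by rewrite mulr_ge0//= ?ler_piMr// ltW// rate_max_gt0.
Qed.

(** A coupled jump can break the order of two configurations only where they agree at the site
    concerned; hence rates are compared under an equality of occupations: a fuller receiver slows
    the jump, a fuller donor speeds it up. *)
Lemma rate_right_attractive a b a' b' : (a <= a')%N -> (b <= b' <= N)%N ->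
  (a = a' -> rate_right a' b' <= rate_right a b) /\
  (b = b' -> rate_right a b <= rate_right a' b').
Proof.
move=> aa' /andP[bb' b'N]; have bN := leq_trans bb' b'N.
have := gle aa'; have := gle (leq_sub2l N bb').
have := g01 a; have := g01 a'; have := g01 (N - b); have := g01 (N - b').
have := rate_max_gt0.
rewrite !rate_rightE//; set c := rate_max => c0.
move=> /andP[? ?] /andP[? ?] /andP[? ?] /andP[? ?] h1 h2; split=> e; rewrite ?e.
  by rewrite ler_pM2l// ler_wpM2l ?subr_ge0// lerB.
by rewrite ler_pM2l// ler_wpM2r ?subr_ge0// lerB.
Qed.

Lemma rate_left_attractive a b a' b' : (a <= a' <= N)%N -> (b <= b' <= N)%N ->
  (a = a' -> rate_left a b <= rate_left a' b') /\
  (b = b' -> rate_left a' b' <= rate_left a b).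
Proof.
move=> /andP[aa' a'N] /andP[bb' b'N].
have aN := leq_trans aa' a'N; have bN := leq_trans bb' b'N.
have := gle aa'; have := gle (leq_sub2l N bb').
have := gle aN; have := gle a'N.
have := gle (leq_subr b N); have := gle (leq_subr b' N).
have c0 := ltW rate_max_gt0.
have g0 : 0 <= q ^+ 2 by have /andP[] := g01 1.
rewrite !rate_leftE// => ? ? ? ? ? ?; split=> e; rewrite ?e.
  by rewrite !ler_wpM2l// ?subr_ge0// lerB.
by rewrite !ler_wpM2l// ler_wpM2r ?subr_ge0// lerB.
Qed.

End rates.

(** * Bounded jump generators *)

Section jump_operators.
Context {R : realType} {N : nat} {V : choiceType}.
Implicit Types (eta xi : config N V) (s : seq V) (f g : config N V -> R).
Implicit Types (L : (config N V -> R) -> config N V -> R) (C : R).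

(* Generators with bounded total jump rate, bounded by C/2, and finitely many
   possible jumps from each configuration. *)
Record jump_operator L C : Prop := JumpOperator {
  jump_ge0 : 0 <= C;
  jump_linear : forall (a : R) f g,
    L (fun eta => a * f eta + g eta) = fun eta => a * L f eta + L g eta;
  jump_bounded : forall f (M : R), (forall eta, `|f eta| <= M) ->
    forall eta, `|L f eta| <= C * M;
  jump_cvg : forall (u : nat -> config N V -> R) f,
    (forall eta, u n eta @[n --> \oo] --> f eta) ->
    forall eta, L (u n) eta @[n --> \oo] --> L f eta;
  jump_cst : forall c, L (fun=> c) = fun=> 0;
  jump_positive : forall f, (forall eta, 0 <= f eta) ->
    forall eta, 0 <= L f eta + C * f eta;
  jump_continuous : forall f, continuous f -> continuous (L f) }.

Lemma jump_operator0 : jump_operator (fun f eta => 0) 0.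
Proof.
split => //.
- by move=> a f g; apply/funext => eta; rewrite mulr0 addr0.
- by move=> f M _ eta; rewrite normr0 mul0r.
- by move=> u f _ eta; exact: cvg_cst.
- by move=> f f0 eta; rewrite mul0r addr0.
- by move=> f _; apply: cylinder_continuous; exists [::].
Qed.

Lemma jump_operatorD L1 C1 L2 C2 :
  jump_operator L1 C1 -> jump_operator L2 C2 ->
  jump_operator (fun f eta => L1 f eta + L2 f eta) (C1 + C2).
Proof.
move=> J1 J2; split.
- by rewrite addr_ge0 ?(jump_ge0 J1) ?(jump_ge0 J2).
- move=> a f g; apply/funext => eta.
  by rewrite (jump_linear J1) (jump_linear J2); ring.
- move=> f M fM eta; rewrite mulrDl (le_trans (ler_normD _ _))//.
  by rewrite lerD ?(jump_bounded J1) ?(jump_bounded J2).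
- move=> u f uf eta; apply: cvgD; [exact: (jump_cvg J1)|exact: (jump_cvg J2)].
- by move=> c; rewrite (jump_cst J1) (jump_cst J2) addr0.
- move=> f f0 eta; rewrite mulrDl addrACA.
  by rewrite addr_ge0 ?(jump_positive J1) ?(jump_positive J2).
- move=> f cf eta; apply: (@cvgD _ _ _ _ (nbhs_filter eta)).
    exact: (jump_continuous J1 cf).
  exact: (jump_continuous J2 cf).
Qed.

End jump_operators.

Section bonds.
Context {R : realType} (q : R) {N : nat} {V : choiceType}.
Hypotheses (q_gt0 : 0 < q) (q_lt1 : q < 1).
Implicit Types (eta xi : config N V) (s : seq V) (f g : config N V -> R).
Implicit Types (x y : V).

Lemma bondE x y f eta : bond q x y f eta =
  rate_right q N (eta x) (eta y) * (f (move x y eta) - f eta) +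
  rate_left q N (eta x) (eta y) * (f (move y x eta) - f eta).
Proof. by []. Qed.

Lemma ord_leq (n : 'I_N.+1) : (n <= N)%N.
Proof. by rewrite -ltnS. Qed.

Lemma agree_move x y s eta xi : agree (x :: y :: s) eta xi ->
  agree s (move x y eta) (move x y xi).
Proof.
move=> exi z zs; rewrite /move !exi ?inE ?eqxx ?orbT//.
by rewrite zs !orbT.
Qed.

Let c := rate_max q N.
Let rr x y eta := rate_right_bounds q_gt0 q_lt1 (eta x) (ord_leq (eta y)).
Let rl x y eta :=
  rate_left_bounds q_gt0 q_lt1 (ord_leq (eta x)) (ord_leq (eta y)).

(** The constant comes from the norm: two directions, each with rate at most c and an increment of f
    of size at most 2M. Positivity of [L + 4c] then holds with room to spare. *)
Lemma jump_operator_bond x y : jump_operator (@bond R N V q x y) (4 * c).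
Proof.
have c0 : 0 < c := rate_max_gt0 N q_gt0 q_lt1.
split.
- by rewrite mulr_ge0// ltW.
- by move=> a f g; apply/funext => eta; rewrite !bondE; ring.
- move=> f M fM eta; rewrite bondE (le_trans (ler_normD _ _))//.
  have M0 : 0 <= M by apply: le_trans (fM eta).
  have diff xi : `|f xi - f eta| <= 2 * M.
    by rewrite (le_trans (ler_normB _ _))// mulr_natl mulr2n lerD.
  have -> : 4 * c * M = c * (2 * M) + c * (2 * M) by ring.
  have /andP[? ?] := rr x y eta; have /andP[? ?] := rl x y eta.
  by apply: lerD; rewrite normrM ler_pM// ger0_norm.
- move=> u f uf eta; under eq_fun do rewrite bondE; rewrite bondE.
  by apply: cvgD; apply: cvgM; try exact: cvg_cst; apply: cvgB.
- by move=> k; apply/funext => eta; rewrite bondE !subrr !mulr0 addr0.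
- move=> f f0 eta; rewrite bondE.
  have /andP[r0 rc] := rr x y eta; have /andP[l0 lc] := rl x y eta.
  have ? := f0 eta; set r := rate_right _ _ _ _ in r0 rc *.
  set l := rate_left _ _ _ _ in l0 lc *; have -> : r * (f (move x y eta) - f eta) +
      l * (f (move y x eta) - f eta) + 4 * c * f eta =
      r * f (move x y eta) + l * f (move y x eta) +
      ((c - r) + (c - l) + c + c) * f eta by ring.
  have c' := ltW c0; apply: addr_ge0.
    by apply: addr_ge0; apply: mulr_ge0.
  by apply: mulr_ge0 => //; move: rc lc; rewrite -/c; lra.
- move=> f /continuous_configP cf; apply/continuous_configP => eta e e0.
  have e'0 : 0 < e / (4 * c) by rewrite divr_gt0// mulr_gt0.
  have [s0 f_0] := cf eta _ e'0.
  have [s1 f_1] := cf (move x y eta) _ e'0.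
  have [s2 f_2] := cf (move y x eta) _ e'0.
  exists (x :: y :: (s0 ++ s1 ++ s2)) => xi exi; rewrite !bondE.
  have {f_0} : `|f eta - f xi| <= e / (4 * c).
    by apply: f_0 => z zs; apply: exi; rewrite !inE !mem_cat zs !orbT.
  have {f_1} : `|f (move x y eta) - f (move x y xi)| <= e / (4 * c).
    apply: f_1; apply: agree_move => z; rewrite !inE => zs; apply: exi.
    by rewrite !inE !mem_cat; move: zs => /or3P[] ->; rewrite ?orbT.
  have {f_2} : `|f (move y x eta) - f (move y x xi)| <= e / (4 * c).
    apply: f_2; apply: agree_move => z; rewrite !inE => zs; apply: exi.
    by rewrite !inE !mem_cat; move: zs => /or3P[] ->; rewrite ?orbT.
  rewrite (exi x) ?(exi y) ?inE ?eqxx ?orbT//.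
  have /andP[r0 rc] := rr x y eta; have /andP[l0 lc] := rl x y eta.
  set r := rate_right _ _ _ _; set l := rate_left _ _ _ _.
  set d1 := f _ - f _; set d2 := f _ - f _; set d3 := f _ - f _ => h2 h1 h0.
  have -> : r * (f (move x y eta) - f eta) + l * (f (move y x eta) - f eta) -
      (r * (f (move x y xi) - f xi) + l * (f (move y x xi) - f xi)) =
    r * (d2 - d3) + l * (d1 - d3) by rewrite /d1 /d2 /d3; ring.
  have -> : e = c * (e / (4 * c) + e / (4 * c)) + c * (e / (4 * c) + e / (4 * c)).
    by field; rewrite gt_eqF.
  rewrite (le_trans (ler_normD _ _))//.
  apply: lerD; rewrite [leLHS]normrM; apply: ler_pM; rewrite ?normr_ge0//.
  - by rewrite ger0_norm.
  - by rewrite (le_trans (ler_normB _ _))// lerD.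
  - by rewrite ger0_norm.
  - by rewrite (le_trans (ler_normB _ _))// lerD.
Qed.

Definition bonds (l : seq (V * V)) f eta : R :=
  \sum_(p <- l) bond q p.1 p.2 f eta.

Lemma jump_operator_bonds l :
  jump_operator (bonds l) (4 * c *+ size l).
Proof.
rewrite /bonds; elim: l => [|p l IH] /=.
  rewrite mulr0n; under eq_fun => f do under eq_fun => eta do rewrite big_nil.
  exact: jump_operator0.
under eq_fun => f do under eq_fun => eta do rewrite big_cons.
by rewrite mulrS; apply: jump_operatorD => //; exact: jump_operator_bond.
Qed.

Lemma bond_agree x y f s :
  (forall eta xi, agree s eta xi -> f eta = f xi) ->
  forall eta xi, agree (x :: y :: s) eta xi -> bond q x y f eta = bond q x y f xi.
Proof.
move=> fs eta xi exi; rewrite !bondE !exi ?inE ?eqxx ?orbT//.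
rewrite (fs eta xi) ?(fs (move x y eta) (move x y xi)) //.
- rewrite (fs (move y x eta) (move y x xi)) //; apply: agree_move.
  by move=> z zs; apply: exi; move: zs; rewrite !inE orbCA.
- exact: agree_move.
- by move=> z zs; apply: exi; rewrite !inE zs !orbT.
Qed.

Lemma bond_out x y f s : x \notin s -> y \notin s ->
  (forall eta xi, agree s eta xi -> f eta = f xi) ->
  bond q x y f = fun=> 0.
Proof.
move=> xs ys fs; apply/funext => eta; rewrite bondE.
rewrite -!(fs eta) ?subrr ?mulr0 ?addr0// => z zs; rewrite /move.
  by rewrite (negPf (memPn ys z zs)) (negPf (memPn xs z zs)).
by rewrite (negPf (memPn ys z zs)) (negPf (memPn xs z zs)).
Qed.

End bonds.

(** * Basic coupling and preservation of monotone functions *)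

Section attractiveness.
Context {R : realType} (q : R) {N : nat} {V : choiceType}.
Hypotheses (q_gt0 : 0 < q) (q_lt1 : q < 1).
Implicit Types (eta xi : config N V) (f : config N V -> R) (x y : V).

Let c := rate_max q N.

Lemma qnum0 : qnum q 0 = 0.
Proof. by rewrite /qnum expr0 invr1 subrr mul0r. Qed.

Lemma rate_right_gt0 a b : (b <= N)%N -> 0 < rate_right q N a b ->
  (0 < a)%N /\ (b < N)%N.
Proof.
move=> bN; rewrite /rate_right.
case: a => [|a]; first by rewrite qnum0 mulr0 mul0r ltxx.
case: (ltnP b N) => // Nb; have -> : b = N by apply/eqP; rewrite eqn_leq bN.
by rewrite subnn qnum0 mulr0 ltxx.
Qed.

Lemma rate_left_gt0 a b : (a <= N)%N -> 0 < rate_left q N a b ->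
  (a < N)%N /\ (0 < b)%N.
Proof.
move=> aN; rewrite /rate_left.
case: b => [|b]; first by rewrite qnum0 mulr0 ltxx.
case: (ltnP a N) => // Na; have -> : a = N by apply/eqP; rewrite eqn_leq aN.
by rewrite subnn qnum0 mulr0 mul0r ltxx.
Qed.

Lemma moveE x y eta z : (eta y < N)%N -> move x y eta z =
  (if z == x then (eta x).-1 else if z == y then (eta y).+1 else eta z) :> nat.
Proof.
move=> yN; rewrite /move; case: eqP => _.
  by rewrite inordK// (leq_trans _ (ltn_ord (eta x)))// ltnS leq_pred.
by case: eqP => _ //; rewrite inordK.
Qed.

(** The basic coupling written as an inequality: both copies jump together at rate min(r, r'), the
    faster copy jumps alone at the surplus rate, and at rate c - max(r, r') nothing moves. *)
Lemma coupling_ler (r r' fe fe' fx fx' : R) : 0 <= r <= c -> 0 <= r' <= c ->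
  fe <= fx -> (0 < r -> 0 < r' -> fe' <= fx') ->
  (r' < r -> fe' <= fx) -> (r < r' -> fe <= fx') ->
  r * (fe' - fe) + c * fe <= r' * (fx' - fx) + c * fx.
Proof.
move=> /andP[r0 rc] /andP[r'0 r'c] fex both only_eta only_xi; rewrite -subr_ge0.
have h3 (m : R) : 0 < m -> m <= r -> m <= r' -> 0 <= m * (fx' - fe').
  move=> m0 mr mr'; apply: mulr_ge0; first exact: ltW.
  by rewrite subr_ge0 both// (lt_le_trans m0).
case: (ltgtP r' r) => [rr|rr|rr].
- have -> : r' * (fx' - fx) + c * fx - (r * (fe' - fe) + c * fe) =
    r' * (fx' - fe') + (r - r') * (fx - fe') + (c - r) * (fx - fe) by ring.
  apply: addr_ge0; last by rewrite mulr_ge0 ?subr_ge0.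
  apply: addr_ge0; last by rewrite mulr_ge0 ?subr_ge0 ?only_eta ?ltW.
  case: (ltgtP 0 r') r'0 => // [r'0 _|<- _]; last by rewrite mul0r.
  by rewrite h3// ltW.
- have -> : r' * (fx' - fx) + c * fx - (r * (fe' - fe) + c * fe) =
    r * (fx' - fe') + (r' - r) * (fx' - fe) + (c - r') * (fx - fe) by ring.
  apply: addr_ge0; last by rewrite mulr_ge0 ?subr_ge0.
  apply: addr_ge0; last by rewrite mulr_ge0 ?subr_ge0 ?only_xi ?ltW.
  case: (ltgtP 0 r) r0 => // [r0 _|<- _]; last by rewrite mul0r.
  by rewrite h3// ltW.
- subst r'; have -> : r * (fx' - fx) + c * fx - (r * (fe' - fe) + c * fe) =
    r * (fx' - fe') + (c - r) * (fx - fe) by ring.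
  apply: addr_ge0; last by rewrite mulr_ge0 ?subr_ge0.
  case: (ltgtP 0 r) r0 => // [r0 _|<- _]; last by rewrite mul0r.
  by rewrite h3.
Qed.

(** The two directions are coupled separately. The lower copy jumping alone is harmful only if the
    copies agree at the receiving site, the upper copy only if they agree at the donating site;
    there attractiveness says that this copy has no surplus rate. *)
Lemma bond_monotone x y f : x != y -> Defs.monotone f ->
  Defs.monotone (fun eta => bond q x y f eta + 4 * c * f eta).
Proof.
move=> xy mf eta xi exi.
have c0 : 0 <= c by rewrite ltW// rate_max_gt0.
(* One c is spent on each direction; the other half of [4 * c * f] is monotone by itself. *)
suff : bond q x y f eta + (c * f eta + c * f eta) <=
       bond q x y f xi + (c * f xi + c * f xi).
  have : c * f eta + c * f eta <= c * f xi + c * f xi.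
    by rewrite lerD// ler_wpM2l// mf.
  have e z : 4 * c * z = c * z + c * z + (c * z + c * z) by ring.
  by move=> h1 h2; rewrite !e [leLHS]addrA [leRHS]addrA; exact: lerD.
have both u v : u != v -> (eta v < N)%N -> (xi v < N)%N ->
    f (move u v eta) <= f (move u v xi).
  move=> uv ev xv; apply: mf => z; rewrite !moveE//.
  by have := exi z; have := exi u; have := exi v; case: eqP => _; last case: eqP => _; lia.
have only_eta u v : u != v -> (eta v < xi v)%N -> f (move u v eta) <= f xi.
  move=> uv ev; apply: mf => z; rewrite !moveE//; last first.
    exact: leq_trans ev (ord_leq _).
  by have := exi z; have := exi u; case: eqP => [->|_]; last case: eqP => [->|_]; lia.
have only_xi u v : u != v -> (eta u < xi u)%N -> (xi v < N)%N ->
    f eta <= f (move u v xi).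
  move=> uv ev xv; apply: mf => z; rewrite !moveE//.
  by have := exi z; have := exi v; case: eqP => [->|_]; last case: eqP => [->|_]; lia.
have yx : y != x by rewrite eq_sym.
rewrite !bondE [leLHS]addrACA [leRHS]addrACA.
apply: lerD; apply: coupling_ler; rewrite ?(mf _ _ exi)//.
- by rewrite rate_right_bounds// ord_leq.
- by rewrite rate_right_bounds// ord_leq.
- move=> /(rate_right_gt0 (ord_leq _))[_ ?] /(rate_right_gt0 (ord_leq _))[_ ?].
  exact: both.
- move=> lt; apply: only_eta => //; rewrite ltn_neqAle exi andbT.
  apply/eqP => e; move: lt; rewrite ltNge.
  have [_ ->//] := rate_right_attractive q_gt0 q_lt1 (exi x)
    (introT andP (conj (exi y) (ord_leq (xi y)))).
- move=> lt; have r0 : 0 < rate_right q N (xi x) (xi y).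
    apply: le_lt_trans lt.
    by case/andP: (rate_right_bounds q_gt0 q_lt1 (eta x) (ord_leq (eta y))).
  have [_ ?] := rate_right_gt0 (ord_leq _) r0.
  apply: only_xi => //; rewrite ltn_neqAle exi andbT.
  apply/eqP => e; move: lt; rewrite ltNge.
  have [->//] := rate_right_attractive q_gt0 q_lt1 (exi x)
    (introT andP (conj (exi y) (ord_leq (xi y)))).
- by rewrite rate_left_bounds// ord_leq.
- by rewrite rate_left_bounds// ord_leq.
- move=> /(rate_left_gt0 (ord_leq _))[? _] /(rate_left_gt0 (ord_leq _))[? _].
  exact: both.
- move=> lt; apply: only_eta => //; rewrite ltn_neqAle exi andbT.
  apply/eqP => e; move: lt; rewrite ltNge.
  have [->//] := rate_left_attractive q_gt0 q_lt1
    (introT andP (conj (exi x) (ord_leq (xi x))))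
    (introT andP (conj (exi y) (ord_leq (xi y)))).
- move=> lt; have r0 : 0 < rate_left q N (xi x) (xi y).
    apply: le_lt_trans lt.
    by case/andP: (rate_left_bounds q_gt0 q_lt1 (ord_leq (eta x)) (ord_leq (eta y))).
  have [? _] := rate_left_gt0 (ord_leq _) r0.
  apply: only_xi => //; rewrite ltn_neqAle exi andbT.
  apply/eqP => e; move: lt; rewrite ltNge.
  have [_ ->//] := rate_left_attractive q_gt0 q_lt1
    (introT andP (conj (exi x) (ord_leq (xi x))))
    (introT andP (conj (exi y) (ord_leq (xi y)))).
Qed.

Lemma bonds_monotone (l : seq (V * V)) f :
  (forall p, p \in l -> p.1 != p.2) -> Defs.monotone f ->
  Defs.monotone (fun eta => bonds q l f eta + (4 * c *+ size l) * f eta).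
Proof.
rewrite /bonds; elim: l => [|p l IH] lP mf eta xi exi.
  by rewrite !big_nil mulr0n !mul0r.
rewrite !big_cons /= mulrS !(mulrDl (4 * c)) [leLHS]addrACA [leRHS]addrACA lerD//.
  by apply: bond_monotone => //; apply: lP; rewrite mem_head.
by apply: IH => // p' p'l; apply: lP; rewrite inE p'l orbT.
Qed.

End attractiveness.

(** * Semigroups *)

Section exponential_semigroup.
Context {R : realType} {N : nat} {V : choiceType}.
Implicit Types (eta xi : config N V) (f g : config N V -> R) (t s : R).
Variables (L : (config N V -> R) -> config N V -> R) (C : R).
Hypothesis (J : jump_operator L C).

Let C0 := jump_ge0 J.

Lemma jump0 : L (fun=> 0) = fun=> 0. Proof. exact: jump_cst J 0. Qed.

Lemma jumpD f g : L (fun eta => f eta + g eta) = fun eta => L f eta + L g eta.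
Proof.
have := jump_linear J 1 f g.
under eq_fun do rewrite mul1r.
by move=> ->; apply/funext => eta; rewrite mul1r.
Qed.

Lemma jumpZ (a : R) f : L (fun eta => a * f eta) = fun eta => a * L f eta.
Proof.
have := jump_linear J a f (fun=> 0); rewrite jump0.
under eq_fun do rewrite addr0.
by move=> ->; apply/funext => eta; rewrite addr0.
Qed.

Lemma jump_sum n (a : nat -> R) (u : nat -> config N V -> R) :
  L (fun eta => \sum_(0 <= k < n) a k * u k eta) =
  fun eta => \sum_(0 <= k < n) a k * L (u k) eta.
Proof.
elim: n => [|n IH].
  under eq_fun do rewrite big_nil.
  by rewrite jump0; apply/funext => eta; rewrite big_nil.
under eq_fun do rewrite big_nat_recr//=.
by rewrite jumpD IH jumpZ; apply/funext => eta; rewrite big_nat_recr.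
Qed.

Lemma iter_jump_bounded f (M : R) k : (forall eta, `|f eta| <= M) ->
  forall eta, `|iter k L f eta| <= M * C ^+ k.
Proof.
move=> fM; elim: k => [|k IH] eta /=; first by rewrite expr0 mulr1.
by rewrite exprS mulrCA; exact: (jump_bounded J).
Qed.

Lemma iter_jumpD k f g :
  iter k L (fun eta => f eta + g eta) = fun eta => iter k L f eta + iter k L g eta.
Proof. by elim: k => //= k ->; rewrite jumpD. Qed.

Lemma iter_jumpZ k (a : R) f :
  iter k L (fun eta => a * f eta) = fun eta => a * iter k L f eta.
Proof. by elim: k => //= k ->; rewrite jumpZ. Qed.

Lemma iter_jump_continuous k f : continuous f -> continuous (iter k L f).
Proof. by move=> cf; elim: k => //= k; exact: (jump_continuous J). Qed.

Lemma exp_semigroupE t f eta :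
  exp_semigroup L t f eta = egf (fun k => iter k L f eta) t.
Proof. by []. Qed.

Lemma is_cvg_exp_semigroup t f (M : R) eta : (forall eta, `|f eta| <= M) ->
  series (fun k => exp_coeff t k * iter k L f eta) @ \oo
    --> exp_semigroup L t f eta.
Proof. by move=> fM; apply: is_cvg_egf => k; exact: iter_jump_bounded. Qed.

Lemma exp_semigroup_bounded t f (M : R) : (forall eta, `|f eta| <= M) ->
  forall eta, `|exp_semigroup L t f eta| <= M * expR (`|t| * C).
Proof.
by move=> fM eta; rewrite exp_semigroupE; apply: normr_egf => k; exact: iter_jump_bounded.
Qed.

(** By [jump_cvg] the operator passes through pointwise limits, so it may be applied termwise to the
    series. *)
Lemma exp_semigroup_jump t f (M : R) : (forall eta, `|f eta| <= M) ->
  exp_semigroup L t (L f) = L (exp_semigroup L t f).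
Proof.
move=> fM; apply/funext => eta.
have h := jump_cvg J (fun xi => is_cvg_exp_semigroup (t := t) (eta := xi) fM).
apply: (cvg_unique _ _ (h eta)) => //.
rewrite (_ : (fun n => _) = series (fun k => exp_coeff t k * iter k L (L f) eta)).
  exact: (is_cvg_exp_semigroup (M := C * M)) (jump_bounded J fM).
by apply/funext => n; rewrite jump_sum; apply: eq_bigr => k _; rewrite -iterSr.
Qed.

Lemma exp_semigroup_iter t f (M : R) k : (forall eta, `|f eta| <= M) ->
  exp_semigroup L t (iter k L f) = iter k L (exp_semigroup L t f).
Proof.
move=> fM; elim: k => //= k <-; apply: exp_semigroup_jump.
exact: iter_jump_bounded.
Qed.

Lemma is_derive_exp_semigroup t f (M : R) eta : (forall eta, `|f eta| <= M) ->
  is_derive t 1 (fun s => exp_semigroup L s f eta) (exp_semigroup L t (L f) eta).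
Proof.
move=> fM; rewrite exp_semigroupE.
rewrite (_ : (fun k => _) = (fun k => iter k.+1 L f eta)); last first.
  by apply/funext => k; rewrite iterSr.
by apply: is_derive_egf => k; exact: iter_jump_bounded.
Qed.

Lemma exp_semigroup_linear t (a : R) f g (M M' : R) :
  (forall eta, `|f eta| <= M) -> (forall eta, `|g eta| <= M') ->
  exp_semigroup L t (fun eta => a * f eta + g eta) =
  fun eta => a * exp_semigroup L t f eta + exp_semigroup L t g eta.
Proof.
move=> fM gM; apply/funext => eta; apply/cvg_lim => //.
rewrite (_ : series _ = (fun n => a * series (fun k => exp_coeff t k * iter k L f eta) n +
    series (fun k => exp_coeff t k * iter k L g eta) n)).
  apply: cvgD; last exact: is_cvg_exp_semigroup gM.
  by apply: cvgM; [exact: cvg_cst|exact: is_cvg_exp_semigroup fM].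
apply/funext => n.
rewrite /series /= mulr_sumr -big_split /=; apply: eq_bigr => k _.
by rewrite iter_jumpD iter_jumpZ; ring.
Qed.

Lemma exp_semigroup0 f : exp_semigroup L 0 f = f.
Proof.
apply/funext => eta; apply/cvg_lim => //.
rewrite -(cvg_shiftn 1) /=; under eq_fun => n.
  rewrite addn1 /series /= big_nat_recl //= big1 => [|k _]; last first.
    by rewrite /exp_coeff /= expr0n !mul0r.
  rewrite /exp_coeff /= expr0 fact0 divr1 mul1r addr0; over.
exact: cvg_cst.
Qed.

Lemma exp_semigroup_cst t (c : R) : exp_semigroup L t (fun=> c) = fun=> c.
Proof.
apply/funext => eta; apply/cvg_lim => //.
rewrite -(cvg_shiftn 1) /=; under eq_fun => n.
  rewrite addn1 /series /= big_nat_recl //= big1 => [|k _]; last first.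
    by rewrite -iterS iterSr (jump_cst J) (_ : iter k L _ = fun=> 0) ?mulr0//;
      elim: k => //= k ->; exact: jump0.
  rewrite /exp_coeff /= expr0 fact0 divr1 mul1r addr0; over.
exact: cvg_cst.
Qed.

End exponential_semigroup.

Section taylor_series.
Context {R : realType}.

(** The remainder M (TC)^n / n! tends to 0, so such a family is determined by its values at 0.
    Identities between exponentials then follow by differentiating along a path, without multiplying
    series. *)
Lemma taylor_egf (v : nat -> R -> R) (M C T : R) : 0 <= T ->
  (forall k (x : R), 0 < x < T -> is_derive x 1 (v k) (v k.+1 x)) ->
  (forall k, {within `[0, T], continuous (v k)}) ->
  (forall k (x : R), 0 <= x <= T -> `|v k x| <= M * C ^+ k) ->
  v 0%N T = egf (fun k => v k 0) T.
Proof.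
move=> T0 dv cv vM.
have v0M k : `|v k 0| <= M * C ^+ k by apply: vM; rewrite lexx.
have h := is_cvg_egf (t := T) v0M; apply: (cvg_unique _ _ h) => //.
apply/cvgrPdist_le => e e0.
have : M * exp_coeff (T * C) n @[n --> \oo] --> M * 0.
  by apply: cvgM; [exact: cvg_cst|exact: cvg_exp_coeff].
rewrite mulr0 => /cvgr0Pnorm_le/(_ e e0); apply: filterS => n.
apply: le_trans; rewrite /series /= big_mkord.
apply: le_trans (taylor_bound T0 dv cv vM n) _.
by rewrite exp_coeffM mulrCA ler_norm.
Qed.

Lemma is_derive_continuous (u u' : R -> R) (T : R) :
  (forall x : R, is_derive x 1 u (u' x)) -> {within `[0, T], continuous u}.
Proof.
by move=> du; apply: derivable_within_continuous => x _; have [] := du x.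
Qed.

End taylor_series.

Section exponential_semigroup_properties.
Context {R : realType} {N : nat} {V : choiceType}.
Implicit Types (eta xi : config N V) (f g : config N V -> R) (t s M : R).
Variables (L : (config N V -> R) -> config N V -> R) (C : R).
Hypothesis (J : jump_operator L C).

Let C0 := jump_ge0 J.

Lemma exp_semigroup_add s t f M : 0 <= s -> 0 <= t -> (forall eta, `|f eta| <= M) ->
  exp_semigroup L (s + t) f = exp_semigroup L t (exp_semigroup L s f).
Proof.
move=> s0 t0 fM; apply/funext => eta.
have LM k := iter_jump_bounded J k fM.
pose v k x := exp_semigroup L (s + x) (iter k L f) eta.
have dv k (x : R) : is_derive x 1 (v k) (v k.+1 x).
  have h := is_derive_exp_semigroup J (s + x) eta (LM k).
  have hs : is_derive x 1 (cst s + id) (0 + 1 : R).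
    exact: is_deriveD.
  by have := is_derive1_comp h hs; rewrite add0r mulr1.
have := @taylor_egf R v (M * expR ((s + t) * C)) C t t0 (fun k x _ => dv k x)
  (fun k => is_derive_continuous (dv k)).
rewrite /v addr0 => ->; last move=> k x /andP[x0 xt].
  rewrite exp_semigroupE; congr egf; apply/funext => k.
  by rewrite (exp_semigroup_iter J _ _ fM).
apply: le_trans (exp_semigroup_bounded J (s + x) (LM k) eta) _.
rewrite mulrAC ler_wpM2r// ?exprn_ge0//.
rewrite ler_wpM2l ?(le_trans _ (fM eta))// ler_expR ler_wpM2r//.
by rewrite ger0_norm ?addr_ge0// lerD2l.
Qed.

(* exp(tL) = e^{-Ct} exp(t(L + C)), where L + C preserves K. *)
Lemma exp_semigroup_cone (K : (config N V -> R) -> Prop) t f M : 0 <= t ->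
  (forall eta, `|f eta| <= M) -> K f ->
  K (fun=> 0) ->
  (forall (a : R) f g, 0 <= a -> K f -> K g -> K (fun eta => a * f eta + g eta)) ->
  (forall (u : nat -> config N V -> R) g, (forall n, K (u n)) ->
    (forall eta, u n eta @[n --> \oo] --> g eta) -> K g) ->
  (forall f, K f -> K (fun eta => L f eta + C * f eta)) ->
  K (exp_semigroup L t f).
Proof.
move=> t0 fM Kf K0 KD Klim KB.
have M0 : 0 <= M by apply: le_trans (fM (fun=> ord0)).
pose B f eta := C * f eta + L f eta.
have KBk k : K (iter k B f).
  elim: k => //= k IH; have := KB _ IH; congr K.
  by apply/funext => eta; rewrite addrC.
have BM k : forall eta, `|iter k B f eta| <= M * (2 * C) ^+ k.
  elim: k => [|k IH] eta /=; first by rewrite expr0 mulr1.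
  rewrite (le_trans (ler_normD _ _))// exprS mulrCA.
  move: (M * _) IH => X IH; have -> : 2 * C * X = C * X + C * X by ring.
  rewrite lerD//.
    by rewrite normrM ger0_norm// ler_wpM2l.
  exact: (jump_bounded J IH).
(* The path x -> e^{Cx} exp(xL) f has the iterates of B = L + C as derivatives at 0, and these are
   bounded by powers of 2C. *)
have expE eta : expR (C * t) * exp_semigroup L t f eta =
    egf (fun k => iter k B f eta) t.
  pose v k x := expR (C * x) * exp_semigroup L x (iter k B f) eta.
  have dv k (x : R) : is_derive x 1 (v k) (v k.+1 x).
    have h := is_derive_exp_semigroup J x eta (BM k).
    have h1 : is_derive x 1 (C \*: id) (C *: 1 : R) by exact: is_deriveZ.
    have h2 := is_derive1_comp (is_derive_expR (C * x)) h1.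
    have := is_deriveM h2 h; move/is_derive_eq; apply.
    rewrite /v iterS [B (iter k B f)]/B.
    rewrite (exp_semigroup_linear J x C (BM k) (jump_bounded J (BM k))).
    rewrite /GRing.scale /=; ring.
  have := @taylor_egf R v (expR (C * t) * (M * expR (t * C))) (2 * C) t t0
    (fun k x _ => dv k x) (fun k => is_derive_continuous (dv k)).
  rewrite /v mulr0 expR0 => ->; last move=> k x /andP[x0 xt].
    congr egf; apply/funext => k.
    by rewrite exp_semigroup0 mul1r.
  rewrite normrM ger0_norm ?expR_ge0// -mulrA ler_pM ?expR_ge0//.
    by rewrite ler_expR ler_wpM2l.
  apply: le_trans (exp_semigroup_bounded J x (BM k) eta) _.
  rewrite mulrAC ler_wpM2r ?exprn_ge0 ?mulr_ge0// ler_wpM2l// ler_expR.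
  by rewrite ler_wpM2r// ger0_norm.
apply: (Klim (fun n eta => expR (- (C * t)) *
    series (fun k => exp_coeff t k * iter k B f eta) n)).
  move=> n; rewrite /series /=.
  suff H m : K (fun eta => \sum_(0 <= k < m) exp_coeff t k * iter k B f eta).
    have := KD (expR (- (C * t))) _ _ (expR_ge0 _) (H n) K0.
    by congr K; apply/funext => eta; rewrite addr0.
  elim: m => [|m IH].
    by rewrite (_ : (fun _ => _) = fun=> 0)//; apply/funext => eta; rewrite big_nil.
  have := KD (exp_coeff t m) _ _ (exp_coeff_ge0 _ t0) (KBk m) IH.
  by congr K; apply/funext => eta; rewrite big_nat_recr//= addrC.
move=> eta; rewrite -[exp_semigroup _ _ _ _]mul1r -(expR0 R) -(addNr (C * t)).
rewrite expRD -mulrA expE; apply: cvgM; first exact: cvg_cst.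
exact: is_cvg_egf (BM^~ eta).
Qed.

Lemma exp_semigroup_ge0 t f M : 0 <= t -> (forall eta, `|f eta| <= M) ->
  (forall eta, 0 <= f eta) -> forall eta, 0 <= exp_semigroup L t f eta.
Proof.
move=> t0 fM f0; apply: (@exp_semigroup_cone (fun f => forall eta, 0 <= f eta) t f M) => //.
- by move=> a g h a0 g0 h0 eta; rewrite addr_ge0 ?mulr_ge0.
- move=> u g u0 ug eta; apply: (cvgr_to_ge (ug eta)).
  by apply: nearW => n.
- exact: jump_positive.
Qed.

(** Positivity applied to M + f and M - f, together with conservation of constants. *)
Lemma exp_semigroup_contraction t f M : 0 <= t -> (forall eta, `|f eta| <= M) ->
  forall eta, `|exp_semigroup L t f eta| <= M.
Proof.
move=> t0 fM eta.
have h (a : R) : `|a| = 1 -> 0 <= a * exp_semigroup L t f eta + M.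
  move=> a1; have aM x : `|a * f x| <= M by rewrite normrM a1 mul1r.
  have MM (x : config N V) : `|cst M x| <= M by rewrite ger0_norm// (le_trans _ (fM x)).
  have := exp_semigroup_linear J t a fM MM.
  move=> /(congr1 (fun h => h eta)) /=; rewrite (exp_semigroup_cst J) => <-.
  apply: (@exp_semigroup_ge0 _ _ (M + M)) => // x.
    exact: le_trans (ler_normD _ _) (lerD (aM x) (MM x)).
  by have := aM x; rewrite ler_norml; lra.
have := h 1 (normr1 _); have := h (-1) (normrN1 _).
by rewrite mul1r mulN1r ler_norml; lra.
Qed.

Lemma exp_semigroup_monotone t f M : 0 <= t -> (forall eta, `|f eta| <= M) ->
  (forall g, Defs.monotone g -> Defs.monotone (fun eta => L g eta + C * g eta)) ->
  Defs.monotone f -> Defs.monotone (exp_semigroup L t f).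
Proof.
move=> t0 fM mL mf; apply: (@exp_semigroup_cone (@Defs.monotone R N V) t f M) => //.
- by move=> a g h a0 mg mh eta xi le; rewrite lerD ?ler_wpM2l ?mg ?mh.
- move=> u g mu ug eta xi le; apply: (ler_cvg_to (ug eta) (ug xi)).
  by apply: nearW => n; exact: mu.
Qed.

(** Contraction removes the norm C from the estimate: only the bound on the n-th iterate of f
    enters. For windows that bound does not depend on the window, whereas C does. The case
    distinction on [k == n] merely feeds [taylor_bound] some bound for the other orders. *)
Lemma exp_semigroup_taylor t f M n (Mn : R) : 0 <= t -> (forall eta, `|f eta| <= M) ->
  (forall eta, `|iter n L f eta| <= Mn) ->
  forall eta, `|exp_semigroup L t f eta -
    \sum_(k < n) exp_coeff t k * iter k L f eta| <= exp_coeff t n * Mn.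
Proof.
move=> t0 fM fMn eta; have LM k := iter_jump_bounded J k fM.
pose v k x := exp_semigroup L x (iter k L f) eta.
have dv k (x : R) : is_derive x 1 (v k) (v k.+1 x).
  exact: (is_derive_exp_semigroup J x eta (LM k)).
have := @taylor_bound R v (fun k => if k == n then Mn else M * C ^+ k) t t0
  (fun k x _ => dv k x) (fun k => is_derive_continuous (dv k)) _ n.
rewrite eqxx /v; under eq_bigr do rewrite exp_semigroup0.
apply=> k x /andP[x0 xt]; case: eqP => [->|_].
  exact: exp_semigroup_contraction.
exact: exp_semigroup_contraction.
Qed.

Lemma exp_semigroup_continuous t f : 0 <= t -> continuous f ->
  continuous (exp_semigroup L t f).
Proof.
move=> t0 cf; have [M fM] := continuous_bounded cf.
apply: continuous_approx => e e0.
have : M * exp_coeff (t * C) n @[n --> \oo] --> M * 0.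
  by apply: cvgM; [exact: cvg_cst|exact: cvg_exp_coeff].
rewrite mulr0 => /cvgr0Pnorm_le/(_ e e0)[n _ /(_ n (leqnn n)) ne].
exists (fun eta => \sum_(k < n) exp_coeff t k * iter k L f eta).
  apply: (@config_continuous_sum _ _ _ _ (fun k => iter k L f)) => k.
  exact: (iter_jump_continuous J).
move=> eta; have LM := iter_jump_bounded J n fM.
apply: le_trans (exp_semigroup_taylor t0 fM LM eta) _.
by rewrite (le_trans _ ne)// exp_coeffM mulrCA ler_norm.
Qed.

End exponential_semigroup_properties.

(** * Strongly continuous Markov semigroups and their generators *)

Section markov_semigroups.
Context {R : realType} {N : nat} {V : choiceType}.
Implicit Types (eta xi : config N V) (f g : config N V -> R).
Implicit Types (t s a h e d M T : R).

Lemma exp_semigroup_dist (L : (config N V -> R) -> config N V -> R) (C : R)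
    t f g M e : jump_operator L C -> 0 <= t ->
  (forall eta, `|f eta| <= M) -> (forall eta, `|f eta - g eta| <= e) ->
  forall eta, `|exp_semigroup L t f eta - exp_semigroup L t g eta| <= e.
Proof.
move=> J t0 fM fge eta.
have gM xi : `|g xi| <= M + e.
  have -> : g xi = f xi - (f xi - g xi) by ring.
  by rewrite (le_trans (ler_normB _ _))// lerD.
have := exp_semigroup_linear J t (-1) gM fM.
move=> /(congr1 (fun F => F eta)); rewrite mulN1r addrC => <-.
apply: (exp_semigroup_contraction J) => // xi.
by rewrite mulN1r addrC.
Qed.

Variable S : operators R N V.
Hypothesis markovS : markov_semigroup S.

Lemma markovB t f g : 0 <= t -> continuous f -> continuous g ->
  S t (fun eta => f eta - g eta) = fun eta => S t f eta - S t g eta.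
Proof.
move=> t0 cf cg; have := ms_linear markovS (-1) t0 cg cf.
under eq_fun do rewrite mulN1r addrC.
by move=> ->; apply/funext => eta; rewrite mulN1r addrC.
Qed.

Lemma markovZ t a f : 0 <= t -> continuous f ->
  S t (fun eta => a * f eta) = fun eta => a * S t f eta.
Proof.
move=> t0 cf; have c0 := @config_continuous_cst R N V 0.
have S0 : S t (fun=> 0) = fun=> 0.
  have := markovB t0 c0 c0; rewrite subrr => ->.
  by apply/funext => eta; rewrite subrr.
have := ms_linear markovS a t0 cf c0.
under eq_fun do rewrite addr0.
by rewrite S0 => ->; apply/funext => eta; rewrite addr0.
Qed.

Lemma markov_cst t a : 0 <= t -> S t (fun=> a) = fun=> a.
Proof.
move=> t0; have := @markovZ t a (fun=> 1) t0
  (@config_continuous_cst R N V 1).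
by rewrite (ms_one markovS t0); under eq_fun do rewrite mulr1.
Qed.

Lemma markov_contraction t f M : 0 <= t -> continuous f ->
  (forall eta, `|f eta| <= M) -> forall eta, `|S t f eta| <= M.
Proof.
move=> t0 cf fM eta.
have h a : `|a| = 1 -> 0 <= a * S t f eta + M.
  move=> a1; have cM := @config_continuous_cst R N V M.
  have := ms_linear markovS a t0 cf cM; rewrite markov_cst//.
  move=> /(congr1 (fun F => F eta)) <-; apply: (ms_ge0 markovS) => //.
    exact: config_continuousZD.
  move=> x; have : `|a * f x| <= M by rewrite normrM a1 mul1r.
  by rewrite ler_norml; lra.
have := h 1 (normr1 _); have := h (-1) (normrN1 _).
by rewrite mul1r mulN1r ler_norml; lra.
Qed.

Lemma markov_dist t f g e : 0 <= t -> continuous f -> continuous g ->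
  (forall eta, `|f eta - g eta| <= e) ->
  forall eta, `|S t f eta - S t g eta| <= e.
Proof.
move=> t0 cf cg fge eta; have := markovB t0 cf cg.
move=> /(congr1 (fun F => F eta)) <-; apply: markov_contraction => //.
exact: config_continuousB.
Qed.

Lemma markov_right0 f e : continuous f -> 0 < e ->
  exists2 d : R, 0 < d & forall h, 0 <= h < d -> forall eta, `|S h f eta - f eta| <= e.
Proof.
move=> cf e0; have := ms_right_continuous markovS (lexx 0) cf.
rewrite (ms_zero markovS cf) => /uniform_cvgP/(_ e e0).
rewrite near_withinE => -[d /= d0 dP]; exists d => // h /andP[].
rewrite le_eqVlt => /predU1P[<- _ eta|h0 hd eta].
  by rewrite (ms_zero markovS cf) subrr normr0 ltW.
by apply: dP => //=; rewrite sub0r normrN gtr0_norm.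
Qed.

(** For s <= t, S(t)f - S(s)f = S(s)(S(t-s)f - f), and contraction turns right continuity at 0 into
    continuity from both sides, uniform in time. *)
Lemma markov_equicontinuous f e : continuous f -> 0 < e ->
  exists2 d : R, 0 < d & forall s t, 0 <= s -> 0 <= t -> `|s - t| < d ->
    forall eta, `|S s f eta - S t f eta| <= e.
Proof.
move=> cf e0; have [d d0 dP] := markov_right0 cf e0; exists d => //.
have H s t : 0 <= s -> 0 <= t -> 0 <= t - s < d ->
    forall eta, `|S t f eta - S s f eta| <= e.
  move=> s0 t0 /[dup] /andP[ts _] tsd eta.
  rewrite -[in S t](subrKC s t) (ms_add markovS)//.
  by apply: markov_dist => //; [exact: (ms_continuous markovS)|exact: dP].
move=> s t s0 t0; case: (leP s t) => st.
  rewrite distrC ger0_norm ?subr_ge0// => tsd eta; rewrite distrC.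
  by apply: H; rewrite ?subr_ge0 ?st.
rewrite gtr0_norm ?subr_gt0// => std eta.
by apply: H; rewrite // subr_ge0 ltW.
Qed.

Lemma generatorP f g : generator S f g <-> continuous f /\
  forall e, 0 < e -> exists2 d : R, 0 < d & forall h, 0 < h < d ->
    forall eta, `|S h f eta - f eta - h * g eta| <= h * e.
Proof.
have eqv h e eta : 0 < h ->
    (`|h^-1 * (S h f eta - f eta) - g eta| <= e) =
    (`|S h f eta - f eta - h * g eta| <= h * e).
  move=> h0; rewrite -[in RHS](mulVKf (lt0r_neq0 h0) (S h f eta - f eta)).
  by rewrite -mulrBr normrM gtr0_norm// ler_pM2l.
split=> [[cf /uniform_cvgP H]|[cf H]]; split => //.
  move=> e e0; have := H e e0; rewrite near_withinE => -[d /= d0 dP].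
  exists d => // h /andP[h0 hd] eta; rewrite -eqv//.
  by apply: dP => //=; rewrite sub0r normrN gtr0_norm.
apply/uniform_cvgP => e e0; have [d d0 dP] := H e e0.
rewrite near_withinE; exists d => //= h; rewrite /ball_ /= sub0r normrN => hd h0 eta.
by rewrite eqv// dP// h0/= -(gtr0_norm h0).
Qed.

Lemma generator_continuous f g : generator S f g -> continuous g.
Proof.
move=> /[dup] -[cf _] /generatorP[_ H]; apply: continuous_approx => e e0.
have [d d0 dP] := H e e0; pose h := d / 2.
have h0 : 0 < h by rewrite divr_gt0.
have hd : h < d by rewrite ltr_pdivrMr// ltr_pMr// ltr1n.
exists (fun eta => h^-1 * (S h f eta - f eta)).
  apply: config_continuousM; first exact: config_continuous_cst.
  by apply: config_continuousB => //; exact: (ms_continuous markovS (ltW h0)).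
move=> eta; have := dP h; rewrite h0 hd => /(_ isT eta).
rewrite -[S h f eta - f eta](mulVKf (lt0r_neq0 h0)) -mulrBr normrM gtr0_norm//.
by rewrite ler_pM2l// distrC mulVKf ?lt0r_neq0.
Qed.

Lemma generator_increment f g t h e d : generator S f g -> 0 <= t ->
  0 < h < d -> (forall eta, `|S h f eta - f eta - h * g eta| <= h * e) ->
  forall eta, `|S (t + h) f eta - S t f eta - h * S t g eta| <= h * e.
Proof.
move=> /[dup] -[cf _] /generator_continuous cg t0 /andP[h0 _] H eta.
have cSh := ms_continuous markovS (ltW h0) cf.
rewrite (ms_add markovS t0 (ltW h0) cf).
have := markovB t0 (config_continuousB cSh cf)
  (config_continuousM (@config_continuous_cst R N V h) cg).
rewrite (markovB t0 cSh cf) (markovZ h t0 cg).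
move=> /(congr1 (fun F => F eta)) <-; apply: markov_contraction => //.
apply: config_continuousB; first exact: config_continuousB.
by apply: config_continuousM => //; exact: config_continuous_cst.
Qed.

(** The generator is defined by a right derivative at 0. Applying S(t) to the first-order estimate
    gives the right derivative at t. *)
Lemma is_derive_markov f g t eta : generator S f g -> 0 < t ->
  is_derive t 1 (fun s => S s f eta) (S t g eta).
Proof.
move=> gfg t0; have cg := generator_continuous gfg.
have [cf H] := (generatorP f g).1 gfg.
suff hD : h^-1 *: (S (h + t) f eta - S t f eta) @[h --> 0^'] --> S t g eta.
  have D : derivable (fun s => S s f eta) t 1.
    rewrite /derivable; under eq_fun do rewrite [_%:A]mulr1.
    by apply/cvg_ex; exists (S t g eta).
  split => //; rewrite -derive1E; exact: cvg_lim hD.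
apply/cvgrPdist_le => e e0; have e20 : 0 < e / 2 by rewrite divr_gt0.
have [d1 d10 dP1] := H _ e20; have [d2 d20 dP2] := markov_equicontinuous cg e20.
near=> h.
have hn0 : h != 0 by near: h; exact: nbhs_dnbhs_neq.
have [hd1 hd2 hdt] : [/\ `|h| < d1, `|h| < d2 & `|h| < t].
  split; near: h; apply: dnbhs0_lt => //.
suff : `|S (h + t) f eta - S t f eta - h * S t g eta| <= `|h| * e.
  rewrite -[in X in X -> _](mulVKf hn0 (S (h + t) f eta - _)) -mulrBr normrM.
  by rewrite ler_pM2l ?normr_gt0// distrC.
(* From the left, the increment is taken from the earlier time t + h, and equicontinuity replaces
   S(t+h)g by S(t)g; this is what the second e/2 pays for. *)
case: (ltgtP h 0) hn0 => // [h0 _|h0 _].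
  have Nh0 : 0 < - h by rewrite oppr_gt0.
  have Nhd1 : 0 < - h < d1 by rewrite Nh0 -(ltr0_norm h0).
  have ht : 0 <= h + t by move: hdt; rewrite ltr0_norm//; lra.
  have h1 := generator_increment gfg ht Nhd1 (dP1 _ Nhd1) eta.
  have h2 : `|S (h + t) g eta - S t g eta| <= e / 2.
    by apply: dP2 => //; [exact: ltW|rewrite addrK].
  move: h1; rewrite (_ : h + t + - h = t); last by ring.
  rewrite (ltr0_norm h0) => h1.
  have -> : S (h + t) f eta - S t f eta - h * S t g eta =
    - (S t f eta - S (h + t) f eta - - h * S (h + t) g eta) +
    - h * (S t g eta - S (h + t) g eta) by ring.
  rewrite (le_trans (ler_normD _ _))// normrN.
  have -> : - h * e = - h * (e / 2) + - h * (e / 2) by field.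
  by rewrite lerD// normrM gtr0_norm// ler_pM2l// distrC.
have hd : 0 < h < d1 by rewrite h0 -(gtr0_norm h0).
rewrite (gtr0_norm h0) (addrC h).
apply: le_trans (generator_increment gfg (ltW t0) hd (dP1 _ hd) eta) _.
by rewrite ler_pM2l// ler_pdivrMr// ler_pMr// ler1n.
Unshelve. all: by end_near. Qed.

Lemma markov_path_continuous f T eta : continuous f ->
  {within `[0, T], continuous (fun s => S s f eta)}.
Proof.
move=> cf; apply/subspace_continuousP => x /=; rewrite in_itv /= => /andP[x0 _].
apply/cvgrPdist_le => e e0; have [d d0 dP] := markov_equicontinuous cf e0.
rewrite near_withinE; exists d => //= y xy; rewrite in_itv /= => /andP[y0 _].
exact: dP.
Qed.

End markov_semigroups.

(** * Infinite volume *)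

Section windows.
Context {R : realType} {N : nat}.
Implicit Types (eta xi : config N int) (f g : config N int -> R).

Definition window (m : nat) : seq int := [seq k%:Z - m%:Z | k <- iota 0 m.*2].

Lemma mem_window m (x : int) : (x \in window m) = (- m%:Z <= x < m%:Z).
Proof.
apply/mapP/idP => [[k]|xm]; first by rewrite mem_iota add0n => km ->; lia.
by exists (absz (x + m%:Z)%R); [rewrite mem_iota; lia|lia].
Qed.

Lemma uniq_window m : uniq (window m).
Proof. by rewrite map_inj_uniq ?iota_uniq// => x y; lia. Qed.

Definition localized n f := forall eta xi, agree (window n) eta xi -> f eta = f xi.

Lemma localizedW n n' f : (n <= n')%N -> localized n f -> localized n' f.
Proof.
move=> nn' fn eta xi exi; apply: fn => x xn; apply: exi.
by move: xn; rewrite !mem_window; lia.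
Qed.

Lemma localized_cylinder n f : localized n f -> cylinder f.
Proof. by move=> fn; exists (window n) => eta xi exi; apply: fn => x /exi. Qed.

Lemma cylinder_localized f : cylinder f -> exists n, localized n f.
Proof.
move=> [s fs]; exists (\max_(x <- s) absz x).+1%N => eta xi exi.
suff H (x : int) : x \in s -> x \in window (\max_(x <- s) absz x).+1.
  by apply: fs => x /H/exi.
move=> xs; rewrite mem_window.
have := @leq_bigmax_seq _ s xpredT absz x xs isT.
by move: (\max_(i <- s) _)%N => k; lia.
Qed.

Lemma localizedZD n (a : R) f g : localized n f -> localized n g ->
  localized n (fun eta => a * f eta + g eta).
Proof. by move=> fn gn eta xi exi; rewrite (fn _ _ exi) (gn _ _ exi). Qed.

End windows.

(** * Finite windows and iterates of the generator on cylinder functions *)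

Section asep_windows.
Context {R : realType} (q : R) {N : nat}.
Implicit Types (eta xi : config N int) (f g : config N int -> R) (M : R).

Local Notation AZ := (@asep_Z R q N).

(** It acts on functions of configurations on all of Z, with sites away from the listed bonds
    frozen, so that different windows can be compared with each other and with [asep_Z]. *)
Definition asep_window m : (config N int -> R) -> config N int -> R :=
  bonds q [seq (x, x + 1) | x <- window m].

Lemma bond_localized0 n f (x : int) : localized n f -> x \notin window n.+1 ->
  bond q x (x + 1) f = fun=> 0.
Proof.
move=> fn xn; apply: (@bond_out R q N int _ _ _ (window n)) => //.
  by move: xn; rewrite !mem_window; lia.
by move: xn; rewrite !mem_window; lia.
Qed.

Lemma asep_Z_window n m f : localized n f -> (n < m)%N ->
  AZ f = asep_window m f.
Proof.
move=> fn nm; apply/funext => eta; rewrite /asep_Z /asep_window /bonds big_map /=.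
rewrite (fsbig_seq _ _ (uniq_window m)).
rewrite [RHS](fsbig_widen [set` window m] setT)//.
move=> x [_ /= xm]; rewrite (bond_localized0 fn)//.
by apply/negP => xn; apply: xm; move: xn; rewrite /= !mem_window; lia.
Qed.

(** A function of the sites of [window n] sees only boundedly many bonds, however large m is; hence
    all later bounds are uniform in the window. *)
Lemma asep_window_small n m f : localized n f ->
  exists2 l : seq (int * int), asep_window m f = bonds q l f &
    (size l <= n.+1.*2)%N.
Proof.
move=> fn; case: (leqP m n.+1) => mn.
  by exists [seq (x, x + 1) | x <- window m]; rewrite ?size_map ?size_iota ?leq_double.
exists [seq (x, x + 1) | x <- window n.+1]; last by rewrite size_map size_map size_iota.
by rewrite -(asep_Z_window fn (ltnW mn)) (asep_Z_window fn (ltnSn n)).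
Qed.

Lemma localized_asep_window n m f : localized n f ->
  localized n.+1 (asep_window m f).
Proof.
move=> fn eta xi exi; rewrite /asep_window /bonds [LHS]big_map [RHS]big_map /=.
apply: eq_bigr => x _; case: (boolP (x \in window n.+1)) => xn; last first.
  by rewrite (bond_localized0 fn xn).
(* The site n lies in [window n.+1], but its bond to n+1 leaves that window; the bond does not touch
   [window n] and contributes nothing. *)
have [xN|xN] := boolP ((x \in window n) || (x + 1 \in window n)); last first.
  by rewrite (@bond_out R q N int _ _ _ (window n)) //; apply: contra xN => ->; rewrite ?orbT.
apply: (bond_agree q fn) => y; rewrite !inE => /or3P[/eqP->|/eqP->|yn];
  apply: exi; move: xN xn; rewrite ?mem_window; first by lia.
  by lia.
by move: yn; rewrite mem_window; lia.
Qed.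

Lemma localized_iter_asep_window n m f k : localized n f ->
  localized (n + k) (iter k (asep_window m) f).
Proof.
move=> fn; elim: k => [|k IH] /=; first by rewrite addn0.
by rewrite addnS; exact: localized_asep_window.
Qed.

Lemma iter_asep_Z n m f k : localized n f -> (n + k <= m)%N ->
  iter k AZ f = iter k (asep_window m) f.
Proof.
move=> fn; elim: k => // k IH nkm /=; rewrite IH; last by rewrite (leq_trans _ nkm)// addnS.
apply: (@asep_Z_window (n + k)); last by rewrite -addnS.
exact: localized_iter_asep_window.
Qed.

Lemma iter_asep_Z_localized n f k : localized n f ->
  localized (n + k) (iter k AZ f).
Proof.
move=> fn; rewrite (iter_asep_Z fn (leqnn _)).
exact: localized_iter_asep_window.
Qed.

Hypotheses (q_gt0 : 0 < q) (q_lt1 : q < 1).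

(** At most 2(n+1) bonds act on a function localized in [window n], each with norm at most
    [4 * rate_max]. *)
Definition asep_speed : R := 8 * rate_max q N.

Lemma asep_speed_gt0 : 0 < asep_speed.
Proof. by rewrite mulr_gt0// rate_max_gt0. Qed.

Lemma asep_window_bounded n m f M : localized n f -> (forall eta, `|f eta| <= M) ->
  forall eta, `|asep_window m f eta| <= asep_speed * n.+1%:R * M.
Proof.
move=> fn fM eta; have [l -> ln] := asep_window_small m fn.
have M0 : 0 <= M by apply: le_trans (fM eta).
apply: le_trans (jump_bounded (jump_operator_bonds q_gt0 q_lt1 l) fM eta) _.
rewrite ler_wpM2r// -[leLHS]mulr_natr /asep_speed.
have r0 := ltW (rate_max_gt0 N q_gt0 q_lt1).
have -> : 8 * rate_max q N * n.+1%:R = 4 * rate_max q N * n.+1.*2%:R :> R.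
  by rewrite -mul2n natrM; ring.
by rewrite ler_wpM2l ?ler_nat// mulr_ge0.
Qed.

(** This is M s^k (n+1)(n+2)...(n+k) with s the speed: each step costs one factor s and the current
    size of the support. In the form k! times a binomial coefficient, the factorial cancels against
    the Taylor coefficient. *)
Definition iter_bound n M k : R := M * asep_speed ^+ k * k`!%:R * 'C(n + k, k)%:R.

Lemma iter_boundS n M k :
  iter_bound n M k.+1 = asep_speed * (n + k).+1%:R * iter_bound n M k.
Proof.
rewrite /iter_bound addnS exprS factS natrM.
have : (k.+1%:R * 'C((n + k).+1, k.+1)%:R = (n + k).+1%:R * 'C(n + k, k)%:R :> R).
  by rewrite -!natrM mul_bin_diag.
move: ('C(_, _)%:R) ('C(_, _)%:R) => a b e.
transitivity (M * (asep_speed * asep_speed ^+ k) * k`!%:R * (k.+1%:R * b)); first by ring.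
by rewrite e; ring.
Qed.

Lemma iter_asep_window_bounded n m f M k :
  localized n f -> (forall eta, `|f eta| <= M) ->
  forall eta, `|iter k (asep_window m) f eta| <= iter_bound n M k.
Proof.
move=> fn fM; elim: k => [|k IH] eta /=.
  by rewrite /iter_bound expr0 fact0 bin0 !mulr1.
rewrite iter_boundS; apply: asep_window_bounded => //.
exact: localized_iter_asep_window.
Qed.

Lemma iter_asep_Z_bounded n f M k : localized n f -> (forall eta, `|f eta| <= M) ->
  forall eta, `|iter k AZ f eta| <= iter_bound n M k.
Proof.
move=> fn fM; rewrite (iter_asep_Z fn (leqnn _)).
exact: iter_asep_window_bounded.
Qed.

(** With binomial coefficients bounded by 2^{n+k}, a time t with t s <= 1/4 leaves the geometric
    factor 2^{-k}. *)
Definition small_time : R := (4 * asep_speed)^-1.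

Lemma small_time_gt0 : 0 < small_time.
Proof. by rewrite invr_gt0 mulr_gt0// asep_speed_gt0. Qed.

Lemma bin_leq_exp2 n k : ('C(n, k) <= 2 ^ n)%N.
Proof.
elim: n k => [|n IH] [|k] //; first by rewrite bin0 expn_gt0.
by rewrite binS expnS mul2n -addnn leq_add.
Qed.

Lemma exp_coeff_iter_bound n M k (t : R) : 0 <= M -> 0 <= t <= small_time ->
  exp_coeff t k * iter_bound n M k <= M * 2 ^+ n * 2^-1 ^+ k.
Proof.
move=> M0 /andP[t0 ts]; have s0 := asep_speed_gt0.
have ts1 : t * asep_speed <= 4^-1.
  by move: ts; rewrite -(ler_pM2r s0) /small_time invfM mulfVK ?lt0r_neq0.
rewrite /iter_bound /exp_coeff /=.
have -> : t ^+ k / k`!%:R *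
    (M * asep_speed ^+ k * k`!%:R * 'C(n + k, k)%:R) =
    M * ((t * asep_speed) ^+ k * 'C(n + k, k)%:R).
  have : k`!%:R != 0 :> R by rewrite pnatr_eq0 -lt0n fact_gt0.
  rewrite (exprMn k t); move: (t ^+ k) (_ ^+ k) (k`!%:R) ('C(_, _)%:R).
  by move=> a b c d c0; field.
rewrite -mulrA ler_wpM2l//.
have -> : (2 ^+ n * 2^-1 ^+ k : R) = 4^-1 ^+ k * 2 ^+ (n + k).
  rewrite (_ : 4 = 2 * 2); last by ring.
  by rewrite invfM exprMn exprD mulrACA -[2^-1 ^+ k * 2 ^+ k]exprMn mulVf// expr1n mulr1 mulrC.
have ts0 : 0 <= t * asep_speed by rewrite mulr_ge0// ltW.
apply: ler_pM; rewrite ?exprn_ge0//; first by rewrite lerXn2r// nnegrE.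
by rewrite -natrX ler_nat bin_leq_exp2.
Qed.

End asep_windows.

Arguments asep_speed {R} q N.
Arguments iter_bound {R} q N n M k.
Arguments small_time {R} q N.

Section uniform_limits.
Context {R : realType}.
Implicit Types (e t s d : R).

Lemma geometric_small (a r e : R) : 0 <= r < 1 -> 0 < e ->
  exists K, a * r ^+ K <= e.
Proof.
move=> /andP[r0 r1] e0; have : a * r ^+ K @[K --> \oo] --> a * 0.
  by apply: cvgM; [exact: cvg_cst|apply: cvg_expr; rewrite ger0_norm].
rewrite mulr0 => /cvgr0Pnorm_le/(_ e e0)[K _ /(_ K (leqnn K))] h.
by exists K; rewrite (le_trans (ler_norm _)).
Qed.

Lemma uniform_cauchy_limit {T : Type} (u : nat -> T -> R) :
  (forall e, 0 < e -> exists m0, forall m m', (m0 <= m)%N -> (m0 <= m')%N ->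
    forall x, `|u m x - u m' x| <= e) ->
  forall e, 0 < e -> exists m0, forall m, (m0 <= m)%N ->
    forall x, `|u m x - limn (u ^~ x)| <= e.
Proof.
move=> uC e e0; have [m0 m0P] := uC e e0; exists m0 => m m0m x.
have cu : cvgn (u ^~ x).
  apply/cauchy_cvgP/cauchy_ballP => d d0.
  have d20 : 0 < d / 2 by rewrite divr_gt0.
  have [m1 m1P] := uC _ d20.
  pose tail := (u ^~ x) @` [set k | (m1 <= k)%N].
  exists (tail, tail) => /=.
    by split; exists m1 => // k m1k; exists k.
  move=> [_ _] /= [[k m1k <-] [l m1l <-]].
  rewrite /ball /= (le_lt_trans (m1P k l m1k m1l x))//.
  by rewrite ltr_pdivrMr// ltr_pMr// ltr1n.
have h : `|u m x - u k x| @[k --> \oo] --> `|u m x - limn (u ^~ x)|.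
  by apply: cvg_norm; apply: cvgB; [exact: cvg_cst|exact: cu].
apply: (cvgr_to_le h); exists m0 => // k m0k; exact: m0P.
Qed.

Lemma time_induction (D : R -> Prop) d : 0 < d ->
  (forall t, 0 <= t <= d -> D t) ->
  (forall s t, 0 <= s -> 0 <= t -> D s -> D t -> D (s + t)) ->
  forall t, 0 <= t -> D t.
Proof.
move=> d0 Dd DD t t0.
suff H n : forall t, 0 <= t <= n%:R * d -> D t.
  have td0 : 0 <= t / d by rewrite divr_ge0// ltW.
  by apply: (H (Num.bound (t / d))); rewrite t0 -ler_pdivrMr// ltW// archi_boundP.
elim: n => [|n IH] {t0}t /andP[t0 td].
  by apply: Dd; rewrite t0 (le_trans td)// mul0r ltW.
have [td'|td'] := leP t d; first by apply: Dd; rewrite t0.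
rewrite -(subrKC d t); apply: DD; rewrite ?(ltW d0) ?subr_ge0 ?(ltW td')//.
  by apply: Dd; rewrite lexx ltW.
by apply: IH; move: td; rewrite subr_ge0 (ltW td') -natr1 mulrDl mul1r; lra.
Qed.

End uniform_limits.

(** * Convergence of the window semigroups *)

Section thermodynamic_limit.
Context {R : realType} (q : R) {N : nat}.
Hypotheses (q_gt0 : 0 < q) (q_lt1 : q < 1).
Implicit Types (eta xi : config N int) (f g h : config N int -> R).
Implicit Types (s t e M : R).

Local Notation AZ := (@asep_Z R q N).
Local Notation Sw m := (exp_semigroup (@asep_window R q N m)).

Let JW m : jump_operator (@asep_window R q N m) _ :=
  jump_operator_bonds q_gt0 q_lt1 _.

Let half01 : 0 <= (2^-1 : R) < 1.
Proof. by rewrite invr_ge0 ler0n invf_lt1// ltr1n. Qed.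

(** The bridge between window semigroups and any Markov semigroup on Z: for cylinder f it is itself
    a cylinder function and refers to no window. *)
Definition taylor_sum K t f eta : R :=
  \sum_(k < K) exp_coeff t k * iter k AZ f eta.

Lemma localized_sum n K (a : nat -> R) (u : nat -> config N int -> R) :
  (forall k, (k < K)%N -> localized n (u k)) ->
  localized n (fun eta => \sum_(k < K) a k * u k eta).
Proof. by move=> un eta xi exi; apply: eq_bigr => k _; rewrite (un k _ _ _ exi). Qed.

Lemma localized_taylor_sum n K t f : localized n f ->
  localized (n + K) (taylor_sum K t f).
Proof.
move=> fn; apply: (@localized_sum _ _ _ (fun k => iter k AZ f)) => k kK.
apply: (@localizedW _ _ (n + k)); first by rewrite leq_add2l ltnW.
exact: iter_asep_Z_localized.
Qed.

Lemma asep_Z_taylor_sum n K t f : localized n f ->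
  AZ (taylor_sum K t f) = taylor_sum K t (AZ f).
Proof.
move=> fn; have ln := localized_taylor_sum (K := K) t fn.
rewrite (asep_Z_window q ln (ltnSn _)) /taylor_sum.
under eq_fun do rewrite -(big_mkord xpredT (fun k => exp_coeff t k * iter k AZ f _)).
rewrite (jump_sum (JW _)); apply/funext => eta; rewrite big_mkord.
apply: eq_bigr => k _; congr (_ * _).
rewrite -(@asep_Z_window _ _ _ (n + k)); first by rewrite -iterS iterSr.
  exact: iter_asep_Z_localized.
by rewrite ltnS leq_add2l ltnW.
Qed.

Lemma asep_Z_linear n (a : R) f g : localized n f -> localized n g ->
  AZ (fun eta => a * f eta + g eta) = fun eta => a * AZ f eta + AZ g eta.
Proof.
move=> fn gn; rewrite !(@asep_Z_window _ _ _ n n.+1)//; last exact: localizedZD.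
exact: (jump_linear (JW _)).
Qed.

(** For [n + K <= m] the first K iterates do not reach the boundary of the window, so window and
    infinite volume share the same Taylor polynomial. *)
Lemma window_taylor_sum n m K f M t : localized n f ->
  (forall eta, `|f eta| <= M) -> 0 <= t <= small_time q N -> (n + K <= m)%N ->
  forall eta, `|Sw m t f eta - taylor_sum K t f eta| <= M * 2 ^+ n * 2^-1 ^+ K.
Proof.
move=> fn fM tsmall nKm eta; have /andP[t0 _] := tsmall.
have M0 : 0 <= M by apply: le_trans (fM eta).
apply: le_trans (exp_coeff_iter_bound q_gt0 q_lt1 n K M0 tsmall).
have -> : taylor_sum K t f eta =
    \sum_(k < K) exp_coeff t k * iter k (asep_window q m) f eta.
  apply: eq_bigr => k _; congr (_ * _).
  have nkm : (n + k <= m)%N by rewrite (leq_trans _ nKm)// leq_add2l ltnW.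
  by rewrite (iter_asep_Z q fn nkm).
apply: (exp_semigroup_taylor (JW m)) => //.
exact: iter_asep_window_bounded.
Qed.

Definition window_limit t f g := forall e, 0 < e ->
  exists m0, forall m, (m0 <= m)%N -> forall eta, `|Sw m t f eta - g eta| <= e.

Lemma window_limit_continuous t f g : 0 <= t -> continuous f ->
  window_limit t f g -> continuous g.
Proof.
move=> t0 cf fg; apply: continuous_approx => e e0.
have [m0 /(_ m0 (leqnn _)) H] := fg e e0.
exists (Sw m0 t f); first exact: (exp_semigroup_continuous (JW m0)).
by move=> eta; rewrite distrC.
Qed.

Lemma window_limit_unique t f g g' : window_limit t f g -> window_limit t f g' ->
  g = g'.
Proof.
move=> fg fg'; apply/funext => eta; apply/eqP; rewrite -subr_eq0 -normr_le0.
apply/ler_addgt0Pr => e e0; rewrite add0r.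
have e20 : 0 < e / 2 by rewrite divr_gt0.
have [m1 H1] := fg _ e20; have [m2 H2] := fg' _ e20.
have := H1 _ (leq_maxl m1 m2) eta; have := H2 _ (leq_maxr m1 m2) eta.
by rewrite !ler_norml; lra.
Qed.

Lemma window_limitD s t f g g' : 0 <= s -> 0 <= t -> continuous f ->
  window_limit s f g -> window_limit t g g' -> window_limit (s + t) f g'.
Proof.
move=> s0 t0 cf fg gg' e e0; have e20 : 0 < e / 2 by rewrite divr_gt0.
have [M fM] := continuous_bounded cf.
have [m1 H1] := fg _ e20; have [m2 H2] := gg' _ e20.
exists (maxn m1 m2) => m; rewrite geq_max => /andP[m1m m2m] eta.
rewrite (exp_semigroup_add (JW m) s0 t0 fM).
have SM := exp_semigroup_contraction (JW m) s0 fM.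
have := exp_semigroup_dist (JW m) t0 SM (H1 m m1m) eta.
by have := H2 m m2m eta; rewrite !ler_norml; lra.
Qed.

Lemma window_limit_approx t f g : 0 <= t -> continuous f ->
  (forall e, 0 < e -> exists h, exists2 k, window_limit t h k &
    (forall eta, `|f eta - h eta| <= e) /\ (forall eta, `|g eta - k eta| <= e)) ->
  window_limit t f g.
Proof.
move=> t0 cf H e e0; have e30 : 0 < e / 3 by rewrite divr_gt0.
have [M fM] := continuous_bounded cf.
have [h [k hk [fh gk]]] := H _ e30; have [m0 Hm] := hk _ e30.
exists m0 => m m0m eta; have := exp_semigroup_dist (JW m) t0 fM fh eta.
by have := Hm m m0m eta; have := gk eta; rewrite !ler_norml; lra.
Qed.

Lemma window_limit_exists t f : 0 <= t -> continuous f ->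
  exists g, window_limit t f g.
Proof.
(* The function is quantified inside the inductive property, since adding times applies it to the
   limit at time s, which is only known to be continuous. *)
move: t f; suff H t : 0 <= t -> forall f, continuous f -> exists g, window_limit t f g.
  by move=> t f t0 cf; exact: H.
move: t; apply: (time_induction (@small_time_gt0 R q N q_gt0 q_lt1)) => [t tsmall f cf|].
  have /andP[t0 _] := tsmall.
  exists (fun eta => limn (fun m => Sw m t f eta)).
  have [M fM] := continuous_bounded cf.
  apply: uniform_cauchy_limit => e e0; have e40 : 0 < e / 4 by rewrite divr_gt0.
  have [h ch fh] := cylinder_dense cf e40; have [n hn] := cylinder_localized ch.
  have [M' hM'] := continuous_bounded (cylinder_continuous ch).
  have [K HK] := geometric_small (M' * 2 ^+ n) half01 e40.
  exists (n + K)%N => m m' nm nm' eta.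
  have := exp_semigroup_dist (JW m) t0 fM fh eta.
  have := exp_semigroup_dist (JW m') t0 fM fh eta.
  have := window_taylor_sum hn hM' tsmall nm eta.
  have := window_taylor_sum hn hM' tsmall nm' eta.
  by move: HK; rewrite !ler_norml; lra.
move=> s t s0 t0 Ds Dt f cf; have [g fg] := Ds f cf.
have [g' gg'] := Dt g (window_limit_continuous s0 cf fg).
by exists g'; apply: window_limitD fg gg'.
Qed.

Section given_semigroup.
Variable S : operators R N int.
Hypothesis markovS : markov_semigroup S.
Hypothesis generatorS : forall h, cylinder h -> generator S h (AZ h).

Lemma iter_generatorS n f k : localized n f ->
  generator S (iter k AZ f) (iter k.+1 AZ f).
Proof.
move=> fn; apply: generatorS; apply: localized_cylinder.
exact: (iter_asep_Z_localized q fn).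
Qed.

(** Iterates of a cylinder function are cylinder functions, hence in the domain; the Taylor bound
    then applies to the paths of S exactly as it does in a window. *)
Lemma markov_taylor_sum n K f M t : localized n f ->
  (forall eta, `|f eta| <= M) -> 0 <= t <= small_time q N ->
  forall eta, `|S t f eta - taylor_sum K t f eta| <= M * 2 ^+ n * 2^-1 ^+ K.
Proof.
move=> fn fM tsmall eta; have /andP[t0 _] := tsmall.
have M0 : 0 <= M by apply: le_trans (fM eta).
apply: le_trans (exp_coeff_iter_bound q_gt0 q_lt1 n K M0 tsmall).
have ck k : continuous (iter k AZ f).
  by apply: cylinder_continuous; apply: localized_cylinder; exact: (iter_asep_Z_localized q fn).
have := @taylor_bound R (fun k s => S s (iter k AZ f) eta)
  (iter_bound q N n M) t t0 _ _ _ K.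
have -> : taylor_sum K t f eta =
    \sum_(k < K) exp_coeff t k * S 0 (iter k AZ f) eta.
  by apply: eq_bigr => k _; rewrite (ms_zero markovS (ck k)).
apply.
- by move=> k x /andP[x0 _]; apply: is_derive_markov => //; exact: iter_generatorS fn.
- by move=> k; exact: markov_path_continuous.
- move=> k x /andP[x0 _]; apply: markov_contraction => //.
  exact: iter_asep_Z_bounded.
Qed.

(** Both S and the large windows are close to the same Taylor sums. This gives uniqueness, and it
    carries monotonicity and reversibility from windows to every process with this generator. *)
Lemma markov_window_limit t f : 0 <= t -> continuous f -> window_limit t f (S t f).
Proof.
move: t f; suff H t : 0 <= t -> forall f, continuous f -> window_limit t f (S t f).
  by move=> t f t0 cf; exact: H.
move: t; apply: (time_induction (@small_time_gt0 R q N q_gt0 q_lt1)) => [t tsmall f cf|].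
  have /andP[t0 _] := tsmall.
  apply: window_limit_approx => // e e0; have [h ch fh] := cylinder_dense cf e0.
  exists h; exists (S t h); last first.
    by split=> //; apply: markov_dist => //; exact: cylinder_continuous.
  move=> d d0; have d20 : 0 < d / 2 by rewrite divr_gt0.
  have [n hn] := cylinder_localized ch.
  have [M hM] := continuous_bounded (cylinder_continuous ch).
  have [K HK] := geometric_small (M * 2 ^+ n) half01 d20.
  exists (n + K)%N => m nm eta.
  have := window_taylor_sum hn hM tsmall nm eta.
  have := markov_taylor_sum K hn hM tsmall eta.
  by move: HK; rewrite !ler_norml; lra.
move=> s t s0 t0 Ds Dt f cf; rewrite addrC (ms_add markovS t0 s0 cf) addrC.
by apply: window_limitD (Ds f cf) (Dt _ (ms_continuous markovS s0 cf)).
Qed.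

End given_semigroup.

End thermodynamic_limit.

Section infinite_volume_semigroup.
Context {R : realType} (q : R) (N : nat).
Hypotheses (q_gt0 : 0 < q) (q_lt1 : q < 1).
Implicit Types (eta xi : config N int) (f g : config N int -> R).
Implicit Types (s t e M a : R).

Local Notation AZ := (@asep_Z R q N).
Local Notation Sw m := (exp_semigroup (@asep_window R q N m)).

Let JW m : jump_operator (@asep_window R q N m) _ :=
  jump_operator_bonds q_gt0 q_lt1 _.

(** The pointwise limit is a total definition; convergence, and then uniformly in [eta], is
    established for continuous f and t >= 0. *)
Definition asep_semigroup : operators R N int :=
  fun t f eta => limn (fun m => Sw m t f eta).

Lemma asep_semigroupP t f : 0 <= t -> continuous f ->
  window_limit q t f (asep_semigroup t f).
Proof.
move=> t0 cf; have [g fg] := window_limit_exists q_gt0 q_lt1 t0 cf.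
suff -> : asep_semigroup t f = g by [].
apply/funext => eta; apply/cvg_lim => //; apply/cvgrPdist_le => e e0.
have [m0 H] := fg e e0; exists m0 => // m /= m0m.
by rewrite distrC; exact: H.
Qed.

Lemma window_limit_le t f g B g' : window_limit q t f g ->
  (exists m0, forall m, (m0 <= m)%N -> forall eta, `|Sw m t f eta - g' eta| <= B) ->
  forall eta, `|g eta - g' eta| <= B.
Proof.
move=> fg [m0 H] eta; apply/ler_addgt0Pr => e e0; have [m1 H1] := fg e e0.
have := H _ (leq_maxl m0 m1) eta; have := H1 _ (leq_maxr m0 m1) eta.
by rewrite !ler_norml; lra.
Qed.

Lemma window_limit_linear t a f g f' g' : 0 <= t -> continuous f -> continuous g ->
  window_limit q t f f' -> window_limit q t g g' ->
  window_limit q t (fun eta => a * f eta + g eta) (fun eta => a * f' eta + g' eta).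
Proof.
move=> t0 cf cg ff' gg' e e0.
have [M fM] := continuous_bounded cf; have [M' gM'] := continuous_bounded cg.
have a1 : 0 < `|a| + 1 by rewrite ltr_wpDl.
have e10 : 0 < e / (`|a| + 1) by rewrite divr_gt0.
have [m1 H1] := ff' _ e10; have [m2 H2] := gg' _ e10.
exists (maxn m1 m2) => m; rewrite geq_max => /andP[m1m m2m] eta.
rewrite (exp_semigroup_linear (JW m) t a fM gM').
have -> : a * Sw m t f eta + Sw m t g eta - (a * f' eta + g' eta) =
  a * (Sw m t f eta - f' eta) + (Sw m t g eta - g' eta) by ring.
rewrite (le_trans (ler_normD _ _))// normrM.
have -> : e = `|a| * (e / (`|a| + 1)) + e / (`|a| + 1).
  by rewrite -[X in _ + X]mul1r -mulrDl mulrCA mulfV ?mulr1// gt_eqF.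
by rewrite lerD ?H2// ler_wpM2l// H1.
Qed.

Lemma asep_semigroup_contraction t f M : 0 <= t -> continuous f ->
  (forall eta, `|f eta| <= M) -> forall eta, `|asep_semigroup t f eta| <= M.
Proof.
move=> t0 cf fM eta; have := window_limit_le (B := M) (g' := fun=> 0) (asep_semigroupP t0 cf).
move=> /(_ _ eta); rewrite subr0; apply; exists 0%N => m _ xi.
by rewrite subr0; exact: (exp_semigroup_contraction (JW m)).
Qed.

Lemma asep_semigroup_linear t a f g : 0 <= t -> continuous f -> continuous g ->
  asep_semigroup t (fun eta => a * f eta + g eta) =
  fun eta => a * asep_semigroup t f eta + asep_semigroup t g eta.
Proof.
move=> t0 cf cg; apply: (@window_limit_unique _ q _ t (fun eta => a * f eta + g eta)).
  by apply: asep_semigroupP => //; exact: config_continuousZD.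
by apply: window_limit_linear => //; exact: asep_semigroupP.
Qed.

Lemma asep_semigroup_dist t f g e : 0 <= t -> continuous f -> continuous g ->
  (forall eta, `|f eta - g eta| <= e) ->
  forall eta, `|asep_semigroup t f eta - asep_semigroup t g eta| <= e.
Proof.
move=> t0 cf cg fge eta.
have := asep_semigroup_linear (-1) t0 cg cf.
move=> /(congr1 (fun F => F eta)); rewrite mulN1r addrC => <-.
apply: asep_semigroup_contraction => //; first exact: config_continuousZD.
by move=> xi; rewrite mulN1r addrC.
Qed.

Lemma asep_semigroup_continuous t f : 0 <= t -> continuous f ->
  continuous (asep_semigroup t f).
Proof.
move=> t0 cf; apply: (window_limit_continuous q_gt0 q_lt1 t0 cf).
exact: asep_semigroupP.
Qed.

Lemma asep_semigroup0 f : continuous f -> asep_semigroup 0 f = f.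
Proof.
move=> cf; apply: (@window_limit_unique _ q _ 0 f); first exact: asep_semigroupP.
move=> e e0; exists 0%N => m _ eta.
by rewrite exp_semigroup0 subrr normr0 ltW.
Qed.

Lemma asep_semigroup_add s t f : 0 <= s -> 0 <= t -> continuous f ->
  asep_semigroup (s + t) f = asep_semigroup s (asep_semigroup t f).
Proof.
move=> s0 t0 cf; apply: (@window_limit_unique _ q _ (s + t) f).
  by apply: asep_semigroupP; rewrite // addr_ge0.
rewrite addrC; apply: (window_limitD q_gt0 q_lt1 t0 s0 cf).
  exact: asep_semigroupP.
by apply: asep_semigroupP => //; exact: asep_semigroup_continuous.
Qed.

Lemma asep_semigroup_taylor1 n f M t : localized n f -> (forall eta, `|f eta| <= M) ->
  0 <= t -> forall eta, `|asep_semigroup t f eta - f eta| <= t * iter_bound q N n M 1.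
Proof.
move=> fn fM t0; have cf := cylinder_continuous (localized_cylinder fn).
apply: (window_limit_le (asep_semigroupP t0 cf)); exists 0%N => m _ eta.
have := exp_semigroup_taylor (JW m) t0 fM
  (iter_asep_window_bounded q_gt0 q_lt1 m 1 fn fM) eta.
by rewrite big_ord1 /exp_coeff /= expr0 expr1 fact0 !divr1 mul1r.
Qed.

Lemma asep_semigroup_taylor2 n f M t : localized n f -> (forall eta, `|f eta| <= M) ->
  0 <= t -> forall eta, `|asep_semigroup t f eta - f eta - t * AZ f eta| <=
    t * (t * iter_bound q N n M 2).
Proof.
move=> fn fM t0 eta; have cf := cylinder_continuous (localized_cylinder fn).
have B0 : 0 <= iter_bound q N n M 2.
  exact: le_trans (iter_asep_window_bounded q_gt0 q_lt1 0 2 fn fM eta).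
rewrite -addrA -opprD; apply: (window_limit_le (g' := fun eta => f eta + t * AZ f eta)
  (asep_semigroupP t0 cf)); exists n.+1 => m nm {}eta.
have := exp_semigroup_taylor (JW m) t0 fM
  (iter_asep_window_bounded q_gt0 q_lt1 m 2 fn fM) eta.
rewrite big_ord_recl big_ord1 /exp_coeff /= expr0 expr1 fact0 !divr1 mul1r.
rewrite -(asep_Z_window q fn nm) => /le_trans; apply.
rewrite mulrA -expr2 ler_wpM2r// ler_pdivrMr// ler_peMr ?exprn_ge0//.
by rewrite ler1n.
Qed.

Lemma markov_asep_semigroup : markov_semigroup asep_semigroup.
Proof.
split.
- by move=> t f; exact: asep_semigroup_continuous.
- by move=> t a f g; exact: asep_semigroup_linear.
- exact: asep_semigroup0.
- by move=> s t f; exact: asep_semigroup_add.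
- move=> t t0; have c1 := @config_continuous_cst R N int 1.
  apply: (@window_limit_unique _ q _ t (fun=> 1)); first exact: asep_semigroupP.
  move=> e e0; exists 0%N => m _ eta.
  by rewrite (exp_semigroup_cst (JW m)) subrr normr0 ltW.
- move=> t f t0 cf f0 eta; rewrite leNgt; apply/negP => lt0.
  have e0 : 0 < - asep_semigroup t f eta / 2 by rewrite divr_gt0// oppr_gt0.
  have [m /(_ m (leqnn m) eta)] := asep_semigroupP t0 cf e0.
  have [M fM] := continuous_bounded cf.
  have := exp_semigroup_ge0 (JW m) t0 fM f0 eta.
  by rewrite ler_norml; lra.
(* As S(s)f - S(t)f = S(t)(S(s-t)f - f), only small times matter; there a cylinder approximation h
   moves by at most a constant times s - t. *)
- move=> t f t0 cf; apply/uniform_cvgP => e e0.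
  have e30 : 0 < e / 3 by rewrite divr_gt0.
  have [h ch fh] := cylinder_dense cf e30; have [n hn] := cylinder_localized ch.
  have cch := cylinder_continuous ch.
  have [M hM] := continuous_bounded cch.
  have B0 : 0 <= iter_bound q N n M 1.
    exact: le_trans (iter_asep_window_bounded q_gt0 q_lt1 0 1 hn hM (fun=> ord0)).
  have B1 : 0 < iter_bound q N n M 1 + 1 by rewrite ltr_wpDl.
  rewrite near_withinE; exists (e / 3 / (iter_bound q N n M 1 + 1)).
    by rewrite /= divr_gt0.
  move=> s /=; rewrite distrC => std ts; have st0 : 0 <= s - t by rewrite subr_ge0 ltW.
  move=> eta; rewrite -(subrKC t s) asep_semigroup_add//.
  apply: asep_semigroup_dist => //; first exact: asep_semigroup_continuous.
  move=> {}eta.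
  have h1 := asep_semigroup_dist st0 cf cch fh eta.
  have h2 := asep_semigroup_taylor1 hn hM st0 eta.
  have h3 : (s - t) * iter_bound q N n M 1 <= e / 3.
    move: std; rewrite ger0_norm// => /ltW.
    rewrite ler_pdivlMr// mulrDr mulr1; lra.
  by have := fh eta; move: h1 h2 h3; rewrite !ler_norml; lra.
Qed.

Lemma generator_asep_semigroup h : cylinder h -> generator asep_semigroup h (AZ h).
Proof.
move=> ch; apply/generatorP.
have cch := cylinder_continuous ch; split=> // e e0.
have [n hn] := cylinder_localized ch; have [M hM] := continuous_bounded cch.
have B0 : 0 <= iter_bound q N n M 2.
  exact: le_trans (iter_asep_window_bounded q_gt0 q_lt1 0 2 hn hM (fun=> ord0)).
have B1 : 0 < iter_bound q N n M 2 + 1 by rewrite ltr_wpDl.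
exists (e / (iter_bound q N n M 2 + 1)); first by rewrite divr_gt0.
move=> t /andP[t0 td] eta.
apply: le_trans (asep_semigroup_taylor2 hn hM (ltW t0) eta) _.
rewrite ler_pM2l//; move: td; rewrite ltr_pdivlMr// mulrDr mulr1; lra.
Qed.

End infinite_volume_semigroup.

(** * The generator as a closure: cylinder functions form a core *)

Section generator_closure.
Context {R : realType} {N : nat} {V : choiceType}.
Implicit Types (eta xi : config N V) (f g h : config N V -> R) (t e M B a : R).

Lemma closed_extensionP (L : (config N V -> R) -> config N V -> R) f g :
  closed_extension L f g <-> forall e, 0 < e -> exists2 h, cylinder h &
    (forall eta, `|h eta - f eta| <= e) /\ (forall eta, `|L h eta - g eta| <= e).
Proof.
split=> [[h [ch hf hg]] e e0|H].
  have /uniform_cvgP/(_ e e0)[n1 _ H1] := hf.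
  have /uniform_cvgP/(_ e e0)[n2 _ H2] := hg.
  exists (h (maxn n1 n2)); first exact: ch.
  by split; [apply: H1; exact: leq_maxl|apply: H2; exact: leq_maxr].
have e0 n : 0 < n.+1%:R^-1 :> R by rewrite invr_gt0.
have /choice[h hP] : forall n : nat, exists h, cylinder h /\
    ((forall eta, `|h eta - f eta| <= n.+1%:R^-1) /\
     (forall eta, `|L h eta - g eta| <= n.+1%:R^-1)).
  by move=> n; have [h ch hn] := H _ (e0 n); exists h.
have small e : 0 < e -> \forall n \near \oo, n.+1%:R^-1 <= e.
  move=> e'0; have := @cvg_harmonic R; rewrite cvgr0Pnorm_le => /(_ e e'0).
  by apply: filterS => n; apply: le_trans; exact: ler_norm.
exists h; split=> [n||]; first by have [] := hP n.
  apply/uniform_cvgP => e e'0; apply: filterS (small e e'0) => n ne eta.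
  by have [_ [+ _]] := hP n => /(_ eta)/le_trans; apply.
apply/uniform_cvgP => e e'0; apply: filterS (small e e'0) => n ne eta.
by have [_ [_ +]] := hP n => /(_ eta)/le_trans; apply.
Qed.

Variable S : operators R N V.
Hypothesis markovS : markov_semigroup S.

Lemma generator_linear a f g f' g' : generator S f f' -> generator S g g' ->
  generator S (fun eta => a * f eta + g eta) (fun eta => a * f' eta + g' eta).
Proof.
move=> /generatorP[cf H] /generatorP[cg H']; apply/generatorP.
split=> [|e e0]; first exact: config_continuousZD.
have a1 : 0 < `|a| + 1 by rewrite ltr_wpDl.
have e10 : 0 < e / (`|a| + 1) by rewrite divr_gt0.
have [d1 d10 P1] := H _ e10; have [d2 d20 P2] := H' _ e10.
exists (Num.min d1 d2); first by rewrite lt_min d10.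
move=> h /andP[h0]; rewrite lt_min => /andP[hd1 hd2] eta.
rewrite (ms_linear markovS a (ltW h0) cf cg).
have -> : a * S h f eta + S h g eta - (a * f eta + g eta) -
    h * (a * f' eta + g' eta) = a * (S h f eta - f eta - h * f' eta) +
    (S h g eta - g eta - h * g' eta) by ring.
rewrite (le_trans (ler_normD _ _))// normrM.
have -> : h * e = `|a| * (h * (e / (`|a| + 1))) + h * (e / (`|a| + 1)).
  by field; rewrite gt_eqF.
by rewrite lerD ?P2 ?h0// ler_wpM2l// P1 ?h0.
Qed.

(** With g the image of f, (1+h) f = S(h)f + h(f - g) up to h e, whence (1+h) sup|f| <= sup|f| + h(B
    + e). *)
Lemma generator_dissipative f g B : generator S f g ->
  (forall eta, `|f eta - g eta| <= B) -> forall eta, `|f eta| <= B.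
Proof.
move=> /generatorP[cf H] fgB; pose A := range (fun eta => `|f eta|).
have [M0 fM0] := continuous_bounded cf.
have hA : has_sup A.
  by split; [exists `|f (fun=> ord0)|, (fun=> ord0)|exists M0 => _ [eta _ <-]].
have fM eta : `|f eta| <= sup A by apply: ub_le_sup; [case: hA|exists eta].
move=> eta; apply: le_trans (fM eta) _; apply/ler_addgt0Pr => e e0.
have [d d0 P] := H e e0; pose h := d / 2.
have h0 : 0 < h by rewrite divr_gt0.
have hd : h < d by rewrite ltr_pdivrMr// ltr_pMr// ltr1n.
have : sup A <= (sup A + h * (B + e)) / (1 + h).
  apply: ge_sup; first by case: hA.
  move=> _ [xi _ <-]; rewrite ler_pdivlMr ?addr_gt0//.
  have h1 := markov_contraction markovS (ltW h0) cf fM xi.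
  have h2 : `|S h f xi - f xi - h * g xi| <= h * e by apply: P; rewrite h0.
  have h3 : `|h * (f xi - g xi)| <= h * B by rewrite normrM gtr0_norm// ler_pM2l.
  rewrite -[1 + h]gtr0_norm ?addr_gt0// -normrM.
  have -> : f xi * (1 + h) = S h f xi + h * (f xi - g xi) -
    (S h f xi - f xi - h * g xi) by ring.
  rewrite (le_trans (ler_normB _ _))// (mulrDr h B) addrA lerD//.
  by rewrite (le_trans (ler_normD _ _))// lerD.
rewrite ler_pdivlMr ?addr_gt0// mulrDr mulr1 lerD2l mulrC ler_pM2l//.
Qed.

End generator_closure.

Section asep_generator.
Context {R : realType} (q : R) (N : nat).
Hypotheses (q_gt0 : 0 < q) (q_lt1 : q < 1).
Implicit Types (eta xi : config N int) (f g h : config N int -> R).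
Implicit Types (s t e M a : R).

Local Notation AZ := (@asep_Z R q N).

Definition in_closure f g := forall e, 0 < e -> exists2 h, cylinder h &
  (forall eta, `|h eta - f eta| <= e) /\ (forall eta, `|AZ h eta - g eta| <= e).

Lemma in_closure_cylinder h : cylinder h -> in_closure h (AZ h).
Proof. by move=> ch e e0; exists h => //; split=> eta; rewrite subrr normr0 ltW. Qed.

Lemma in_closure_closed f g :
  (forall e, 0 < e -> exists f' g', in_closure f' g' /\
    (forall eta, `|f' eta - f eta| <= e) /\ (forall eta, `|g' eta - g eta| <= e)) ->
  in_closure f g.
Proof.
move=> H e e0; have e20 : 0 < e / 2 by rewrite divr_gt0.
have [f' [g' [fg' [ff' gg']]]] := H _ e20; have [h ch [hf hg]] := fg' _ e20.
exists h => //; split=> eta.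
  by have := ff' eta; have := hf eta; rewrite !ler_norml; lra.
by have := gg' eta; have := hg eta; rewrite !ler_norml; lra.
Qed.

Lemma cylinder_asep_linear a f g : cylinder f -> cylinder g ->
  cylinder (fun eta => a * f eta + g eta) /\
  AZ (fun eta => a * f eta + g eta) = fun eta => a * AZ f eta + AZ g eta.
Proof.
move=> /cylinder_localized[n fn] /cylinder_localized[n' gn].
have {}fn := localizedW (leq_maxl n n') fn.
have {}gn := localizedW (leq_maxr n n') gn.
split; last exact: (asep_Z_linear q_gt0 q_lt1 a fn gn).
exact: (localized_cylinder (localizedZD a fn gn)).
Qed.

Lemma in_closure_linear a f g f' g' : in_closure f f' -> in_closure g g' ->
  in_closure (fun eta => a * f eta + g eta) (fun eta => a * f' eta + g' eta).
Proof.
move=> H H' e e0.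
have a1 : 0 < `|a| + 1 by rewrite ltr_wpDl.
have e10 : 0 < e / (`|a| + 1) by rewrite divr_gt0.
have [h ch [hf hf']] := H _ e10; have [k ck [kg kg']] := H' _ e10.
have [chk lin] := cylinder_asep_linear a ch ck.
have ee : e = `|a| * (e / (`|a| + 1)) + e / (`|a| + 1) by field; rewrite gt_eqF.
exists (fun eta => a * h eta + k eta) => //; split=> eta; rewrite ?lin.
  have -> : a * h eta + k eta - (a * f eta + g eta) =
    a * (h eta - f eta) + (k eta - g eta) by ring.
  by rewrite (le_trans (ler_normD _ _))// [leRHS]ee normrM lerD// ler_wpM2l.
have -> : a * AZ h eta + AZ k eta - (a * f' eta + g' eta) =
  a * (AZ h eta - f' eta) + (AZ k eta - g' eta) by ring.
by rewrite (le_trans (ler_normD _ _))// [leRHS]ee normrM lerD// ler_wpM2l.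
Qed.

Lemma cylinder_asep h : cylinder h -> cylinder (AZ h).
Proof.
move=> /cylinder_localized[n hn].
by apply: localized_cylinder; exact: (iter_asep_Z_localized q (k := 1) hn).
Qed.

Lemma in_closure_continuous f g : in_closure f g -> continuous f /\ continuous g.
Proof.
move=> H; split; apply: continuous_approx => e e0; have [h ch [hf hg]] := H e e0.
  by exists h; [exact: cylinder_continuous|move=> eta; rewrite distrC].
exists (AZ h); last by move=> eta; rewrite distrC.
by apply: cylinder_continuous; exact: cylinder_asep.
Qed.

Variable S : operators R N int.
Hypothesis markovS : markov_semigroup S.
Hypothesis generatorS : forall h, cylinder h -> generator S h (AZ h).

(** The generator of a Markov semigroup is closed. For a cylinder approximation h of f, the path s
    -> S(s)h has derivative S(s)(Lh), which stays near g for small s. *)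
Lemma in_closure_generator f g : in_closure f g -> generator S f g.
Proof.
move=> fg; have [cf cg] := in_closure_continuous fg.
apply/generatorP; split=> // e e0; have e20 : 0 < e / 2 by rewrite divr_gt0.
have [d d0 dP] := markov_right0 markovS cg e20; exists d => // t /andP[t0 td] eta.
(* The time t is fixed before h is chosen, so the approximation error may depend on t: it enters
   twice through f and once with weight t through g, hence the division by 2 + t. *)
apply/ler_addgt0Pr => e' e'0.
have t2 : 0 < 2 + t by rewrite addr_gt0.
have e''0 : 0 < e' / (2 + t) by rewrite divr_gt0.
have [h ch [hf hg]] := fg _ e''0; have gh := generatorS ch.
have cch := cylinder_continuous ch.
have cAh : continuous (AZ h) by apply: cylinder_continuous; exact: cylinder_asep.
have := @ler_dist_derive_cst R (fun s => S s h eta) (fun s => S s (AZ h) eta)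
  (g eta) (e / 2 + e' / (2 + t)) t (ltW t0).
rewrite (ms_zero markovS cch) => /(_ _ _ _)H.
have {}H : `|S t h eta - h eta - t * g eta| <= t * (e / 2 + e' / (2 + t)).
  apply: H.
  - by move=> x /andP[x0 _]; exact: is_derive_markov.
  - exact: markov_path_continuous.
  - move=> x /andP[x0 xt].
    have h1 := markov_dist markovS (ltW x0) cAh cg hg eta.
    have h2 : `|S x g eta - g eta| <= e / 2.
      by apply: dP; rewrite (ltW x0) (lt_trans xt).
    by move: h1 h2; rewrite !ler_norml; lra.
have h1 := markov_dist markovS (ltW t0) cch cf hf eta.
have h2 := hf eta.
have te0 : 0 <= t * (e / 2) by rewrite mulr_ge0 ?ltW.
have e'E : 2 * (e' / (2 + t)) + t * (e' / (2 + t)) = e' by field; rewrite gt_eqF.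
move: H h1 h2; rewrite mulrDr !ler_norml.
have : t * e = t * (e / 2) + t * (e / 2) by field.
lra.
Qed.

(** For small t and cylinder h, S(t)h is close to a Taylor sum, whose image under L is the Taylor
    sum of Lh and so is close to S(t)(Lh). The support of Lh is one site wider on each side, hence
    the exponent [n.+1]. *)
Lemma in_closure_semigroup t f g : 0 <= t -> in_closure f g ->
  in_closure (S t f) (S t g).
Proof.
move: t f g; suff H t : 0 <= t -> forall f g, in_closure f g -> in_closure (S t f) (S t g).
  by move=> t f g t0; exact: H.
move: t; apply: (time_induction (@small_time_gt0 R q N q_gt0 q_lt1)).
  move=> t tsmall f g fg; have /andP[t0 _] := tsmall.
  have [cf cg] := in_closure_continuous fg.
  apply: in_closure_closed => e e0; have [h ch [hf hg]] := fg e e0.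
  have cch := cylinder_continuous ch.
  have cAh := cylinder_continuous (cylinder_asep ch).
  exists (S t h), (S t (AZ h)); split; last by split; exact: markov_dist.
  move=> {hf hg e0}e e0; have [n hn] := cylinder_localized ch.
  have [M hM] := continuous_bounded cch; have [M' hM'] := continuous_bounded cAh.
  have M0 : 0 <= M by apply: le_trans (hM (fun=> ord0)).
  have M'0 : 0 <= M' by apply: le_trans (hM' (fun=> ord0)).
  have half01 : 0 <= (2^-1 : R) < 1 by rewrite invr_ge0 ler0n invf_lt1// ltr1n.
  have [K HK] := geometric_small (M * 2 ^+ n + M' * 2 ^+ n.+1) half01 e0.
  have hn1 : localized n.+1 (AZ h).
    by have := iter_asep_Z_localized q (k := 1) hn; rewrite addn1.
  exists (taylor_sum q K t h).
    exact: (localized_cylinder (localized_taylor_sum q t hn)).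
  rewrite (asep_Z_taylor_sum q_gt0 q_lt1 K t hn); split=> eta; rewrite distrC.
    apply: le_trans (markov_taylor_sum q_gt0 q_lt1 markovS generatorS K hn hM tsmall eta) _.
    apply: le_trans HK; rewrite ler_wpM2r ?exprn_ge0 ?invr_ge0// lerDl.
    by rewrite mulr_ge0 ?exprn_ge0.
  apply: le_trans (markov_taylor_sum q_gt0 q_lt1 markovS generatorS K hn1 hM' tsmall eta) _.
  apply: le_trans HK; rewrite ler_wpM2r ?exprn_ge0 ?invr_ge0// lerDr.
  by rewrite mulr_ge0 ?exprn_ge0.
move=> s t s0 t0 Hs Ht f g fg; have [cf cg] := in_closure_continuous fg.
by rewrite !(ms_add markovS)//; apply: Hs; exact: Ht.
Qed.

(* A discrete resolvent: with a = 1 - d, the function F = d sum_k a^k S(kd) v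
   almost solves F - A F = v, and A is dissipative. *)
Lemma generator_in_closure f g : generator S f g -> in_closure f g.
Proof.
move=> gfg; have cg := generator_continuous markovS gfg; have [cf _] := gfg.
(* The budget: F is within 4e of f, so G, which is within 3e of F - v, is within 3e + e + 4e of
   g. *)
apply: in_closure_closed => e0 e00; pose e := e0 / 8.
have e_gt0 : 0 < e by rewrite divr_gt0.
have cu := config_continuousB cf cg; have [v cv uv] := cylinder_dense cu e_gt0.
have ccv := cylinder_continuous cv; have cAv := cylinder_continuous (cylinder_asep cv).
have [M vM] := continuous_bounded ccv.
have [d1 d10 P1] := ((generatorP S v (AZ v)).1 (generatorS cv)).2 e e_gt0.
have [d2 d20 P2] := markov_right0 markovS ccv e_gt0.
pose m : R := Num.min (2^-1) (Num.min d1 d2).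
have m0 : 0 < m by rewrite !lt_min d10 d20 invr_gt0 ltr0n.
pose d : R := m / 2.
have d0 : 0 < d by rewrite divr_gt0.
have dm : d < m by rewrite ltr_pdivrMr// ltr_pMr ?ltr1n.
have [d_half dd1 dd2] : [/\ d < 2^-1, d < d1 & d < d2].
  by move: dm; rewrite /m !lt_min => /and3P.
pose a : R := 1 - d; have a01 : 0 <= a < 1 by rewrite /a; lra.
have [K HK] := geometric_small M a01 e_gt0.
pose F k eta := d * \sum_(i < k) a ^+ i * S (i%:R * d) v eta.
pose G k eta := d * \sum_(i < k) a ^+ i * S (i%:R * d) (AZ v) eta.
have id0 i : 0 <= i%:R * d by rewrite mulr_ge0// ltW.
have FG k : in_closure (F k) (G k).
  elim: k => [|k IH].
    have c0 : cylinder (fun _ : config N int => 0 : R) by exists [::].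
    have -> : F 0%N = fun=> 0 by apply/funext => eta; rewrite /F big_ord0 mulr0.
    have -> : G 0%N = AZ (fun=> 0).
      apply/funext => eta; rewrite /G big_ord0 mulr0.
      have [_ /(congr1 (fun F => F eta))] := cylinder_asep_linear (-1) c0 c0.
      rewrite mulr0 addr0 => ->; ring.
    exact: in_closure_cylinder.
  have -> : F k.+1 = fun eta => (d * a ^+ k) * S (k%:R * d) v eta + F k eta.
    by apply/funext => eta; rewrite /F big_ord_recr /=; ring.
  have -> : G k.+1 = fun eta => (d * a ^+ k) * S (k%:R * d) (AZ v) eta + G k eta.
    by apply/funext => eta; rewrite /G big_ord_recr /=; ring.
  apply: in_closure_linear => //; apply: in_closure_semigroup => //.
  exact: in_closure_cylinder.
have cS k : continuous (S (k%:R * d) v) by exact: (ms_continuous markovS).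
(* Up to an error of norm 2ed, d(v - Lv) equals v - a S(d)v. Applying a^k S(kd) and summing
   telescopes, and the errors add up to 2e times d sum a^i = 1 - a^k. *)
have tele k eta : `|F k eta - G k eta - v eta + a ^+ k * S (k%:R * d) v eta| <=
    2 * e * (1 - a ^+ k).
  elim: k => [|k IH].
    rewrite /F /G !big_ord0 !mulr0 mul0r expr0 (ms_zero markovS ccv) !subrr mulr0.
    by rewrite mul1r sub0r addNr normr0.
  pose err eta := d * (v eta - AZ v eta) - (v eta - a * S d v eta).
  have cSd := ms_continuous markovS (ltW d0) ccv.
  have errE xi : `|err xi| <= d * (2 * e).
    have -> : err xi = (S d v xi - v xi - d * AZ v xi) - d * (S d v xi - v xi).
      by rewrite /err /a; ring.
    have -> : d * (2 * e) = d * e + d * e by ring.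
    rewrite (le_trans (ler_normB _ _))// lerD//.
      by apply: P1; rewrite d0.
    by rewrite normrM gtr0_norm// ler_pM2l// P2// ltW.
  have cvA := config_continuousB ccv cAv.
  have cerr : continuous err.
    apply: config_continuousB.
      by apply: config_continuousM => //; exact: config_continuous_cst.
    apply: config_continuousB => //.
    by apply: config_continuousM => //; exact: config_continuous_cst.
  have Serr : S (k%:R * d) err eta = d * (S (k%:R * d) v eta - S (k%:R * d) (AZ v) eta) -
      (S (k%:R * d) v eta - a * S (k.+1%:R * d) v eta).
    have kd0 := id0 k.
    rewrite /err (markovB markovS kd0); last first.
    - apply: config_continuousB => //.
      by apply: config_continuousM => //; exact: config_continuous_cst.
    - by apply: config_continuousM => //; exact: config_continuous_cst.
    rewrite (markovZ markovS d kd0 cvA) (markovB markovS kd0 ccv cAv).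
    rewrite (markovB markovS kd0 ccv); last first.
      by apply: config_continuousM => //; exact: config_continuous_cst.
    rewrite (markovZ markovS a kd0 cSd) -(ms_add markovS kd0 (ltW d0) ccv).
    by have -> : k.+1%:R * d = k%:R * d + d by rewrite -natr1 mulrDl mul1r.
  have -> : F k.+1 eta - G k.+1 eta - v eta + a ^+ k.+1 * S (k.+1%:R * d) v eta =
      (F k eta - G k eta - v eta + a ^+ k * S (k%:R * d) v eta) +
      a ^+ k * S (k%:R * d) err eta.
    by rewrite Serr /F /G !big_ord_recr /= exprS; ring.
  rewrite (le_trans (ler_normD _ _))//.
  have -> : 2 * e * (1 - a ^+ k.+1) = 2 * e * (1 - a ^+ k) + a ^+ k * (d * (2 * e)).
    by rewrite exprS /a; ring.
  have ak0 : 0 <= a ^+ k by rewrite exprn_ge0//; case/andP: a01.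
  rewrite lerD// normrM ger0_norm// ler_wpM2l//.
  exact: (markov_contraction markovS (id0 k) cerr errE).
have FGv eta : `|F K eta - G K eta - v eta| <= 3 * e.
  have h1 := tele K eta.
  have aK0 : 0 <= a ^+ K by rewrite exprn_ge0//; case/andP: a01.
  have h2 : `|a ^+ K * S (K%:R * d) v eta| <= e.
    rewrite normrM ger0_norm// (le_trans _ HK)// mulrC ler_wpM2r//.
    exact: (markov_contraction markovS (id0 K) ccv vM).
  have h3 : 2 * e * (1 - a ^+ K) <= 2 * e.
    by apply: ler_piMr; [rewrite mulr_ge0// ltW|rewrite gerBl].
  move: h1 h2 h3; rewrite !ler_norml; move: (2 * e * _) (a ^+ K * _) => x y.
  lra.
(* Dissipativity for f - F: its image under 1 - A is (f - g - v) + (v - (F - G)), of size at most e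
   + 3e. *)
have FK eta : `|f eta - F K eta| <= 4 * e.
  have gFG := in_closure_generator (FG K).
  have := generator_linear markovS (-1) gFG gfg.
  move=> /(generator_dissipative markovS) D.
  have {D} := D (4 * e) _ eta; rewrite mulN1r addrC; apply=> xi.
  rewrite !mulN1r.
  by have := uv xi; have := FGv xi; rewrite !ler_norml; lra.
exists (F K), (G K); split=> //; split=> eta.
  by have := FK eta; rewrite distrC => /le_trans; apply; rewrite /e; lra.
have := FK eta; have := FGv eta; have := uv eta.
by rewrite !ler_norml /e; lra.
Qed.

Lemma generated_by_asep_Z : generated_by AZ S.
Proof.
split=> // f g; split=> [gfg|/closed_extensionP fg].
  by apply/closed_extensionP; exact: generator_in_closure.
exact: in_closure_generator.
Qed.

End asep_generator.

(** * Product measures *)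

Section unit_interval_digits.
Context {R : realType} {N : nat}.
Implicit Types (r : 'I_N.+1 -> R) (rho : nat -> 'I_N.+1 -> R) (x : R).

Definition cumulative r j : R := \sum_(0 <= i < j) r (inord i).

Lemma cumulativeS r j : cumulative r j.+1 = cumulative r j + r (inord j).
Proof. by rewrite /cumulative big_nat_recr. Qed.

Lemma cumulative0 r : cumulative r 0 = 0. Proof. exact: big_nil. Qed.

Lemma cumulative_full r : \sum_n r n = 1 -> cumulative r N.+1 = 1.
Proof.
move=> <-; rewrite /cumulative big_mkord.
by apply: eq_bigr => i _; rewrite inord_val.
Qed.

Lemma cumulative_le r i j : (forall n, 0 < r n) -> (i <= j)%N ->
  cumulative r i <= cumulative r j.
Proof.
move=> r0; elim: j => [|j IH]; first by rewrite leqn0 => /eqP ->.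
rewrite leq_eqVlt => /predU1P[->//|]; rewrite ltnS => /IH le.
by rewrite cumulativeS (le_trans le)// lerDl ltW.
Qed.

Definition digit r x : 'I_N.+1 :=
  odflt ord0 [pick n : 'I_N.+1 | cumulative r n <= x < cumulative r n.+1].

Lemma digitE r x (n : 'I_N.+1) : (forall n, 0 < r n) -> \sum_n r n = 1 ->
  0 <= x < 1 -> (digit r x == n) = (cumulative r n <= x < cumulative r n.+1).
Proof.
move=> r0 r1 /andP[x0 x1].
have uniq (i j : 'I_N.+1) : cumulative r i <= x < cumulative r i.+1 ->
    cumulative r j <= x < cumulative r j.+1 -> (i <= j)%N.
  move=> /andP[i1 _] /andP[_ j2]; rewrite leqNgt; apply/negP => ji.
  have := cumulative_le r0 ji; rewrite leNgt => /negP; apply.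
  exact: le_lt_trans j2.
have ex m : (m <= N.+1)%N -> x < cumulative r m ->
    exists i : 'I_N.+1, cumulative r i <= x < cumulative r i.+1.
  elim: m => [_|m IH mN xm]; first by rewrite cumulative0 ltNge x0.
  have [/(IH (ltnW mN))//|mx] := ltP x (cumulative r m).
  by exists (Ordinal mN); rewrite /= mx xm.
rewrite /digit; case: pickP => [i xi /=|none]; last first.
  by have [|i] := ex N.+1 (leqnn _); [rewrite cumulative_full|rewrite none].
apply/eqP/idP => [<-//|xn]; apply/val_inj/eqP.
by rewrite eqn_leq (uniq i n)// (uniq n i).
Qed.

(** The affine map of the cell containing x onto [0,1); the cells depend on the site, so the digits
    belong to a mixed expansion. *)
Definition next r x : R := (x - cumulative r (digit r x)) / r (digit r x).

Fixpoint digits rho x k : 'I_N.+1 :=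
  if k is k'.+1 then digits (fun i => rho i.+1) (next (rho 0%N) x) k'
  else digit (rho 0%N) x.

(** Peeling off the first digit, the interval of the remaining digits is mapped affinely into the
    first cell, and lengths multiply. Half-open cells tile [0,1) exactly, so no exceptional null set
    appears. *)
Lemma digits_interval rho (xi : nat -> 'I_N.+1) m :
  (forall k n, 0 < rho k n) -> (forall k, \sum_n rho k n = 1) ->
  exists2 a : R, 0 <= a /\ a + \prod_(k < m) rho k (xi k) <= 1 &
    forall x, 0 <= x < 1 -> ((forall k, (k < m)%N -> digits rho x k = xi k) <->
      a <= x < a + \prod_(k < m) rho k (xi k)).
Proof.
elim: m rho xi => [|m IH] rho xi rho0 rho1.
  exists 0; first by rewrite big_ord0 add0r !lexx.
  by move=> x x01; rewrite big_ord0 add0r; split.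
have [a [a0 a1] aP] := IH (fun k => rho k.+1) (fun k => xi k.+1)
  (fun k => rho0 k.+1) (fun k => rho1 k.+1).
rewrite big_ord_recl /=; set p := \prod_(i < m) _.
have {}a1 : a + p <= 1 by exact: a1.
set r := rho 0%N (xi 0%N); set c := cumulative (rho 0%N) (xi 0%N).
have r0 : 0 < r := rho0 _ _.
have c1E : cumulative (rho 0%N) (xi 0%N).+1 = c + r.
  by rewrite cumulativeS inord_val.
have c0 : 0 <= c by rewrite -(cumulative0 (rho 0%N)) cumulative_le.
have c1 : c + r <= 1.
  by rewrite -c1E -(cumulative_full (rho1 0%N)) cumulative_le.
exists (c + r * a).
  split; first by rewrite addr_ge0// mulr_ge0// ltW.
  by rewrite -addrA -mulrDr (le_trans _ c1)// lerD2l ler_piMr// ltW.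
move=> x x01.
have step : digit (rho 0%N) x = xi 0%N -> 0 <= next (rho 0%N) x < 1.
  move=> /eqP; rewrite digitE// c1E -/c /next => /[dup] xc /andP[cx xr].
  have -> : digit (rho 0%N) x = xi 0%N by apply/eqP; rewrite digitE// c1E.
  by rewrite -/c -/r divr_ge0 ?subr_ge0 ?(ltW r0)//= ltr_pdivrMr// mul1r ltrBlDl.
have eqv : digit (rho 0%N) x = xi 0%N ->
    (a <= next (rho 0%N) x < a + p) = (c + r * a <= x < c + r * a + r * p).
  move=> e; rewrite /next e -/c -/r ler_pdivlMr// ltr_pdivrMr//.
  by rewrite lerBrDl ltrBlDl (mulrC a) (mulrC _ r) mulrDr addrA.
split=> [H|].
  have e := H 0%N isT; rewrite -eqv//; apply/aP; first exact: step.
  by move=> k km; exact: (H k.+1).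
move=> /[dup] xa /andP[ax xap].
have e : digit (rho 0%N) x = xi 0%N.
  apply/eqP; rewrite digitE// c1E -/c; apply/andP; split.
    by rewrite (le_trans _ ax)// lerDl mulr_ge0// ltW.
  by rewrite (lt_le_trans xap)// -addrA -mulrDr lerD2l ler_piMr// ltW.
move: xa; rewrite -eqv// => /aP-/(_ (step e)) H [|k] //; exact: H.
Qed.

End unit_interval_digits.

Section config_measurability.
Context {R : realType} {N : nat} {V : choiceType}.

Lemma measurable_open (A : set (config N V)) : open A ->
  measurable (A : set (bconfig N V)).
Proof. by move=> oA; exact: sub_sigma_algebra. Qed.

Lemma open_agree s (eta : config N V) : open (agree s eta).
Proof.
rewrite openE => xi xis; apply/nbhs_configP; exists s => zeta zetas x xs.
by rewrite zetas// xis.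
Qed.

Lemma measurable_agree s (eta : config N V) :
  measurable (agree s eta : set (bconfig N V)).
Proof. exact: measurable_open (open_agree s eta). Qed.

Lemma continuous_measurable (f : config N V -> R) : continuous f ->
  measurable_fun setT (f : bconfig N V -> R).
Proof.
move=> cf; apply: (measurability _ (RGenOInfty.measurableE R)).
move=> _ [_ [x ->] <-]; rewrite setTI; apply: measurable_open.
apply: open_comp => [eta _|]; [exact: cf|exact: interval_open].
Qed.

End config_measurability.

Section measurable_into_config.
Context d (T : measurableType d) {N : nat}.

(** An open set is a countable union of cylinders: over the length n of the prefix and the finitely
    many patterns p on it that force membership. [ext] fills a pattern up with zeros. *)
Lemma measurable_to_config (F : T -> config N nat) :
  (forall n eta, measurable (F @^-1` agree (iota 0 n) eta)) ->
  measurable_fun setT (F : T -> bconfig N nat).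
Proof.
move=> mF; apply: (@measurability _ _ T (bconfig N nat) setT F (@open (config N nat)) erefl).
move=> _ [U oU <-]; rewrite setTI.
pose ext n (p : {ffun 'I_n -> 'I_N.+1}) : config N nat :=
  fun k => if insub k is Some i then p i else ord0.
have -> : F @^-1` U = \bigcup_n \bigcup_(p in [set p : {ffun 'I_n -> 'I_N.+1} |
    agree (iota 0 n) (ext n p) `<=` U]) F @^-1` agree (iota 0 n) (ext n p).
  apply/seteqP; split=> [x /= xU|x [n _ [p pU Fxp]]]; last exact: pU.
  have /nbhs_configP[s sU] : nbhs (F x) U by apply: open_nbhs_nbhs.
  pose n := (\max_(k <- s) k).+1%N.
  have sn k : k \in s -> k \in iota 0 n.
    by move=> ks; rewrite mem_iota add0n ltnS leq_bigmax_seq.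
  pose p : {ffun 'I_n -> 'I_N.+1} := [ffun i : 'I_n => F x i].
  have pE k : k \in iota 0 n -> ext n p k = F x k.
    by rewrite mem_iota add0n /= => kn; rewrite /ext insubT ffunE.
  exists n => //; exists p => [xi xip|k kn /=]; last by rewrite pE.
  by apply: sU => k /sn kn; rewrite xip// pE.
apply: bigcupT_measurable => n; apply: fin_bigcup_measurable => [|p _].
  exact: finite_finset.
exact: mF.
Qed.

End measurable_into_config.

Section unit_uniform.
Context {R : realType}.

Definition unit_uniform : set (measurableTypeR R) -> \bar R :=
  mrestr (@lebesgue_measure R) (measurable_itv `[0 : R, 1[).

HB.instance Definition _ := Measure.on unit_uniform.

Lemma unit_uniform_setT : unit_uniform setT = 1%E.
Proof.
rewrite /unit_uniform /mrestr setTI lebesgue_measure_itv /= lte_fin ltr01.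
by rewrite oppr0 adde0.
Qed.

HB.instance Definition _ :=
  Measure_isProbability.Build _ _ _ unit_uniform unit_uniform_setT.

End unit_uniform.

Section product_on_nat.
Context {R : realType} {N : nat} (rho : nat -> 'I_N.+1 -> R).
Hypotheses (rho_gt0 : forall k n, 0 < rho k n) (rho1 : forall k, \sum_n rho k n = 1).

(** The uniform law lives on the whole line, so points outside [0,1) are sent to 0;
    [digits_interval] then applies at every point, and the measure does not see the change. *)
Definition digit_config (x : measurableTypeR R) : bconfig N nat :=
  digits rho (\1_(`[0 : R, 1[%classic) x * x).

Let clip (x : R) : R := \1_(`[0 : R, 1[%classic) x * x.

Let clip01 x : 0 <= clip x < 1.
Proof.
rewrite /clip indicE; case: (boolP (x \in _)); last by rewrite mul0r lexx ltr01.
by rewrite inE /= in_itv /= mul1r.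
Qed.

Let clip_id x : 0 <= x < 1 -> clip x = x.
Proof. by move=> x01; rewrite /clip indicE mem_set ?mul1r//= in_itv. Qed.

Lemma measurable_digit_config : measurable_fun setT digit_config.
Proof.
apply: measurable_to_config => n eta.
have [a _ aP] := digits_interval eta n rho_gt0 rho1.
have mclip : measurable_fun setT clip.
  by apply: measurable_funM => //; exact: measurable_indic.
have -> : digit_config @^-1` agree (iota 0 n) eta =
    clip @^-1` `[a, a + \prod_(k < n) rho k (eta k)[%classic.
  apply/seteqP; split=> x /=.
    move=> H; rewrite in_itv /=; apply/(aP _ (clip01 x)) => k kn.
    by apply: H; rewrite mem_iota add0n.
  rewrite in_itv /= => /(aP _ (clip01 x)) H k; rewrite mem_iota add0n => kn.
  exact: H.
by rewrite -[X in measurable X]setTI; apply: mclip.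
Qed.

HB.instance Definition _ :=
  isMeasurableFun.Build _ _ _ _ digit_config measurable_digit_config.

Lemma distribution_digit_config n eta :
  distribution unit_uniform digit_config (agree (iota 0 n) eta) =
  (\prod_(k < n) rho k (eta k))%:E.
Proof.
have [a [a0 a1] aP] := digits_interval eta n rho_gt0 rho1.
transitivity (lebesgue_measure (digit_config @^-1` agree (iota 0 n) eta `&` `[0 : R, 1[)).
  by [].
set p := \prod_(k < n) _ in a1 aP *.
have p0 : 0 < p by apply: prodr_gt0.
have -> : digit_config @^-1` agree (iota 0 n) eta `&` `[0, 1[ = `[a, a + p[%classic.
  apply/seteqP; split=> x /=.
    move=> [H]; rewrite !in_itv /= => x01; apply/(aP _ x01) => k kn.
    by rewrite -(clip_id x01); apply: H; rewrite mem_iota add0n.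
  rewrite !in_itv /= => /[dup] xa /andP[ax xap].
  have x01 : 0 <= x < 1 by rewrite (le_trans a0)// (lt_le_trans xap).
  split=> // k; rewrite mem_iota add0n => /andP[_ kn].
  by rewrite /digit_config -/(clip x) clip_id//; move/(aP _ x01): xa; apply.
by rewrite lebesgue_measure_itv /= lte_fin ltrDl p0 -EFinD addrAC subrr add0r.
Qed.

Lemma digit_probability_exists : exists P : probability (bconfig N nat) R,
  forall n eta, P (agree (iota 0 n) eta) = (\prod_(k < n) rho k (eta k))%:E.
Proof.
exists (distribution unit_uniform digit_config) => n eta.
exact: distribution_digit_config.
Qed.

End product_on_nat.

Section product_probability.
Context {R : realType} {N : nat}.

Lemma agree_rcons_upd {V : choiceType} s (x : V) (xi : config N V) : x \notin s ->
  agree s xi = \big[setU/set0]_(n < N.+1)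
    agree (x :: s) (fun y => if y == x then n else xi y).
Proof.
move=> xs; apply/seteqP; split=> eta /=.
  move=> H; rewrite -bigcup_mkord_ord; exists (eta x) => //= y.
  rewrite inE inord_val; case: eqP => [->//|_] /=; exact: H.
rewrite -bigcup_mkord_ord => -[n /= nN H] y ys; rewrite H ?inE ?ys ?orbT//.
by case: eqP => // yx; move: xs; rewrite -yx ys.
Qed.

(** A finite set s of sites is completed by [s'] to an initial segment; the sites of [s'] are then
    summed out one at a time. *)
Lemma product_measure_windows (P : probability (bconfig N nat) R)
    (rho : nat -> 'I_N.+1 -> R) : (forall k, \sum_n rho k n = 1) ->
  (forall n eta, P (agree (iota 0 n) eta) = (\prod_(k < n) rho k (eta k))%:E) ->
  product_measure P rho.
Proof.
move=> rho1 Pn s xi us; rewrite -/(agree s xi).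
pose n := (\max_(k <- s) k).+1%N.
have sn k : k \in s -> k \in iota 0 n.
  by move=> ks; rewrite mem_iota add0n ltnS leq_bigmax_seq.
pose s' := [seq k <- iota 0 n | k \notin s].
have us's : uniq (s' ++ s).
  rewrite cat_uniq us filter_uniq ?iota_uniq// andbT /=.
  by apply/hasPn => k ks; rewrite mem_filter ks.
have: forall xi, P (agree (s' ++ s) xi) = (\prod_(x <- s' ++ s) rho x (xi x))%:E.
  move=> {}xi; have p : perm_eq (s' ++ s) (iota 0 n).
    apply: uniq_perm => //; first exact: iota_uniq.
    move=> k; rewrite mem_cat mem_filter.
    by case: (boolP (k \in s)) => [/sn ->|_] /=; rewrite ?orbF.
  have -> : agree (s' ++ s) xi = agree (iota 0 n) xi.
    by apply/seteqP; split=> eta H k ks; apply: H; rewrite ?(perm_mem p)// -(perm_mem p).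
  rewrite Pn (perm_big _ p) /=; congr EFin.
  by rewrite -(big_mkord xpredT (fun k => rho k (xi k))) /index_iota subn0.
elim: s' us's xi => //= x s1 IH /andP[xs1 us1] xi H.
apply: IH => // {}xi; rewrite (agree_rcons_upd xi xs1).
rewrite (measure_bigsetU_ord P xpredT); first last.
- apply/trivIsetP => i j _ _ ij; apply/seteqP; split=> // eta [H1 H2].
  move/eqP: ij; apply; have := H1 x; rewrite inE eqxx => /(_ isT) <-.
  by have := H2 x; rewrite inE eqxx => /(_ isT).
- by move=> i; exact: measurable_agree.
transitivity (\sum_(i < N.+1) (rho x i * \prod_(j <- s1 ++ s)
    rho j (if j == x then i else xi j))%:E).
  by apply: eq_bigr => i _; have := H (fun y => if y == x then i else xi y);
    rewrite big_cons eqxx.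
rewrite sumEFin; congr EFin.
transitivity (\sum_(i < N.+1) rho x i * \prod_(j <- s1 ++ s) rho j (xi j)).
  apply: eq_bigr => i _; congr (_ * _); apply: eq_big_seq => j js.
  by case: eqP => // jx; move: xs1; rewrite -jx js.
by rewrite -mulr_suml rho1 mul1r.
Qed.

Lemma product_measure_exists {V : countType} (rho : V -> 'I_N.+1 -> R) :
  (forall x n, 0 < rho x n) -> (forall x, \sum_n rho x n = 1) ->
  exists P : probability (bconfig N V) R, product_measure P rho.
Proof.
move=> rho_gt0 rho1.
(* Numbers that code no site carry the uniform law, a positive weight as the digit expansion
   requires; the map F below forgets them. *)
pose rho' k := if unpickle k is Some x then rho x else fun=> N.+1%:R^-1.
have rho'_gt0 k n : 0 < rho' k n.
  by rewrite /rho'; case: unpickle => // _; rewrite invr_gt0.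
have rho'1 k : \sum_n rho' k n = 1.
  rewrite /rho'; case: unpickle => //; rewrite sumr_const card_ord.
  by rewrite -[LHS]mulr_natr mulVf.
pose F (eta : bconfig N nat) : bconfig N V := fun x => eta (pickle x).
have mF : measurable_fun setT F.
  apply: (@measurability _ _ (bconfig N nat) (bconfig N V) setT F
    (@open (config N V)) erefl) => _ [U oU <-].
  rewrite setTI; apply: measurable_open; rewrite openE => eta /= Ueta.
  have /nbhs_configP[s sU] : nbhs (F eta) U by apply: open_nbhs_nbhs.
  apply/nbhs_configP; exists (map pickle s) => xi xis; apply: sU => x xs.
  by apply: xis; exact: map_f.
pose mFB := isMeasurableFun.Build _ _ _ _ F mF.
pose mF' : {mfun bconfig N nat >-> bconfig N V} := HB.pack F mFB.
have [P1 /(product_measure_windows rho'1) P1P] :=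
  digit_probability_exists rho'_gt0 rho'1.
exists (distribution P1 mF') => s xi us.
pose xi' k := if unpickle k is Some x then xi x else ord0.
have us' : uniq (map pickle s) by rewrite map_inj_uniq//; exact: (pcan_inj pickleK).
transitivity (P1 (agree (map pickle s) xi')).
  rewrite /distribution /pushforward /=; congr (P1 _).
  apply/seteqP; split=> eta /=.
    by move=> H _ /mapP[x xs ->]; rewrite /xi' pickleK; exact: H.
  by move=> H x xs; rewrite /F H ?map_f// /xi' pickleK.
rewrite P1P// big_map; congr EFin; apply: eq_bigr => x _.
by rewrite /rho' /xi' pickleK.
Qed.

End product_probability.

(** * Expectations under a product measure *)

Section expectation.
Context {R : realType} {N : nat} {V : choiceType}.
Variable P : probability (bconfig N V) R.
Implicit Types (eta xi : config N V) (f g : config N V -> R) (a e M : R).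

Definition expect f : R := Rintegral P setT (f : bconfig N V -> R).

Lemma config_integrable f : continuous f ->
  P.-integrable setT (EFin \o (f : bconfig N V -> R)).
Proof.
move=> cf; have [M fM] := continuous_bounded cf.
apply: measurable_bounded_integrable => //.
- by apply: le_lt_trans (probability_le1 P measurableT) _; rewrite ltry.
- exact: continuous_measurable.
- exists M; split=> [|x Mx eta _]; first exact: num_real.
  by rewrite /= (le_trans (fM eta))// ltW.
Qed.

Lemma expectE f : continuous f ->
  (\int[P]_eta (f eta)%:E)%E = (expect f)%:E.
Proof.
move=> cf; rewrite /expect /Rintegral fineK//.
exact: integrable_fin_num (config_integrable cf).
Qed.

Lemma expectD f g : continuous f -> continuous g ->
  expect (fun eta => f eta + g eta) = expect f + expect g.
Proof. by move=> cf cg; apply: RintegralD => //; exact: config_integrable. Qed.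

Lemma expectB f g : continuous f -> continuous g ->
  expect (fun eta => f eta - g eta) = expect f - expect g.
Proof. by move=> cf cg; apply: RintegralB => //; exact: config_integrable. Qed.

Lemma expectZ a f : continuous f ->
  expect (fun eta => a * f eta) = a * expect f.
Proof. by move=> cf; apply: RintegralZl => //; exact: config_integrable. Qed.

Lemma expect_cst a : expect (fun=> a) = a.
Proof.
rewrite /expect Rintegral_cst//.
transitivity (a * fine 1%E); last by rewrite mulr1.
by apply: (congr1 (fun z => a * fine z)); exact: probability_setT.
Qed.

Lemma expect_le f g : continuous f -> continuous g ->
  (forall eta, f eta <= g eta) -> expect f <= expect g.
Proof. by move=> cf cg fg; apply: le_Rintegral => //; exact: config_integrable. Qed.

Lemma expect_bounded f M : continuous f -> (forall eta, `|f eta| <= M) ->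
  `|expect f| <= M.
Proof.
move=> cf fM; rewrite ler_norml; apply/andP; split.
  rewrite -(expect_cst (- M)); apply: expect_le => //.
    exact: config_continuous_cst.
  by move=> eta; have := fM eta; rewrite ler_norml => /andP[].
rewrite -[leRHS](expect_cst M); apply: expect_le => //.
  exact: config_continuous_cst.
by move=> eta; have := fM eta; rewrite ler_norml => /andP[].
Qed.

Lemma expect_dist f g e : continuous f -> continuous g ->
  (forall eta, `|f eta - g eta| <= e) -> `|expect f - expect g| <= e.
Proof.
move=> cf cg fg; rewrite -expectB//; apply: expect_bounded => //.
exact: config_continuousB.
Qed.

Lemma expect_sum n (a : nat -> R) (u : nat -> config N V -> R) :
  (forall k, continuous (u k)) ->
  expect (fun eta => \sum_(k < n) a k * u k eta) = \sum_(k < n) a k * expect (u k).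
Proof.
move=> cu; elim: n => [|n IH].
  by under eq_fun do rewrite big_ord0; rewrite expect_cst big_ord0.
under eq_fun do rewrite big_ord_recr /=.
rewrite expectD ?expectZ ?IH ?big_ord_recr//; first exact: config_continuous_sum.
by apply: config_continuousM => //; exact: config_continuous_cst.
Qed.

Lemma expect_agree s xi : expect \1_(agree s xi) = fine (P (agree s xi)).
Proof.
rewrite /expect /Rintegral integral_indic// ?setIT//.
exact: measurable_agree.
Qed.

End expectation.

Section product_expectation.
Context {R : realType} {N : nat} {V : choiceType}.
Implicit Types (eta xi : config N V) (f g : config N V -> R) (s : seq V) (x y : V).

Definition upd eta x (n : 'I_N.+1) : config N V :=
  fun y => if y == x then n else eta y.

Variable rho : V -> 'I_N.+1 -> R.

Definition average x f eta : R := \sum_(n < N.+1) rho x n * f (upd eta x n).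

Definition averages s f : config N V -> R := foldr average f s.

Lemma agree_upd s x eta xi n : (forall y, y \in s -> y != x -> eta y = xi y) ->
  agree s (upd eta x n) (upd xi x n).
Proof.
move=> exi y ys; rewrite /upd; case: eqP => // /eqP yx.
by rewrite exi.
Qed.

Hypothesis rho_ge0 : forall x n, 0 <= rho x n.
Hypothesis rho1 : forall x, \sum_n rho x n = 1.

Lemma average_dist x f g e : (forall eta, `|f eta - g eta| <= e) ->
  forall eta, `|average x f eta - average x g eta| <= e.
Proof.
move=> fg eta; rewrite /average -sumrB (le_trans (ler_norm_sum _ _ _))//.
rewrite -[leRHS]mul1r -(rho1 x) mulr_suml; apply: ler_sum => n _.
by rewrite -mulrBr normrM ger0_norm// ler_wpM2l.
Qed.

Lemma average_cylinder x f s :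
  (forall eta xi, agree (rcons s x) eta xi -> f eta = f xi) ->
  forall eta xi, agree s eta xi -> average x f eta = average x f xi.
Proof.
move=> fs eta xi exi; apply: eq_bigr => n _; congr (_ * _); apply: fs.
apply: agree_upd => y; rewrite mem_rcons inE => /orP[/eqP->|ys _].
  by rewrite eqxx.
exact/esym/exi.
Qed.

Lemma average_continuous x f : continuous f -> continuous (average x f).
Proof.
move=> cf; apply: continuous_approx => e e0; have [h [s hs] fh] := cylinder_dense cf e0.
exists (average x h); last exact: average_dist.
apply: cylinder_continuous; exists s => eta xi exi; apply: eq_bigr => n _.
congr (_ * _); apply: hs => y ys; rewrite /upd; case: eqP => // _.
exact: exi.
Qed.

Variable P : probability (bconfig N V) R.
Hypothesis Prho : product_measure P rho.

(** The integral of a cylinder function as an iterated finite sum. The induction pins the sites of u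
    to [xi] by an indicator and moves one site at a time from s to u. *)
Lemma expect_averages s f : uniq s ->
  (forall eta xi, agree s eta xi -> f eta = f xi) ->
  forall xi, expect P f = averages s f xi.
Proof.
move=> us fs xi.
have cf : continuous f.
  by apply: cylinder_continuous; exists s => eta zeta ez; apply: fs => y /ez.
have cind u zeta : continuous (\1_(agree u zeta) : config N V -> R).
  apply: cylinder_continuous; exists u => eta eta' ee; rewrite !indicE.
  congr (nat_of_bool _)%:R; apply/idP/idP; rewrite !inE => H y yu.
    by rewrite -(H y yu) ee.
  by rewrite -(H y yu) ee.
suff H u : uniq (u ++ s) ->
    (forall eta xi, agree (u ++ s) eta xi -> f eta = f xi) ->
    expect P (fun eta => \1_(agree u xi) eta * f eta) =
    (\prod_(x <- u) rho x (xi x)) * averages s f xi.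
  have := H [::] us fs; rewrite big_nil mul1r => <-; congr (expect P _).
  apply/funext => eta; rewrite indicE mem_set ?mul1r// => y.
move: u xi; elim: s {us fs} => [|x s IH] u xi; rewrite ?cats0 => us fs.
  have -> : (fun eta => \1_(agree u xi) eta * f eta) =
      fun eta => f xi * \1_(agree u xi) eta.
    apply/funext => eta; rewrite indicE; case: (boolP (_ \in _)); last first.
      by rewrite mul0r mulr0.
    by rewrite inE => /fs ->; rewrite mul1r mulr1.
  by rewrite expectZ// expect_agree (Prho xi us) mulrC.
have xu : x \notin u.
  move: us; rewrite cat_uniq => /and3P[_ /hasPn/(_ x) H _]; apply: H.
  exact: mem_head.
have memE : (x :: u) ++ s =i u ++ x :: s.
  by move=> y; rewrite !(inE, mem_cat) orbCA orbA.
have usx : uniq ((x :: u) ++ s).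
  have p : perm_eq (u ++ [:: x] ++ s) ([:: x] ++ u ++ s) by rewrite perm_catCA.
  by move: us; rewrite (perm_uniq p).
have fsx eta zeta : agree ((x :: u) ++ s) eta zeta -> f eta = f zeta.
  by move=> H; apply: fs => y ys; apply: H; rewrite memE.
have -> : (fun eta => \1_(agree u xi) eta * f eta) = fun eta =>
    \sum_(k < N.+1) 1 * (\1_(agree (x :: u) (upd xi x (inord k))) eta * f eta).
  apply/funext => eta; under eq_bigr do rewrite mul1r.
  rewrite -mulr_suml; congr (_ * _).
  rewrite (bigD1 (eta x))//= big1 ?addr0; last first.
    move=> k kx; rewrite indicE memNset// => /(_ x); rewrite mem_head => /(_ isT).
    by rewrite /upd eqxx inord_val => /esym/eqP; rewrite (negPf kx).
  rewrite !indicE inord_val; congr (nat_of_bool _)%:R; apply/idP/idP; rewrite !inE.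
    move=> H y; rewrite inE /upd; case: eqP => [->//|_] /=; exact: H.
  move=> H y yu; have := H y; rewrite inE yu orbT /upd => /(_ isT) ->.
  by case: eqP => // yx; move: xu; rewrite -yx yu.
rewrite (@expect_sum _ _ _ _ _ (fun=> 1) (fun k eta =>
  \1_(agree (x :: u) (upd xi x (inord k))) eta * f eta)); last first.
  by move=> k; exact: config_continuousM.
rewrite /= /average mulr_sumr; apply: eq_bigr => k _.
rewrite mul1r inord_val IH// big_cons mulrCA mulrA; congr (_ * _ * _).
  by rewrite /upd eqxx.
apply: eq_big_seq => y yu; rewrite /upd; case: eqP => // yx.
by move: xu; rewrite -yx yu.
Qed.

Lemma expect_average x f : continuous f -> expect P (average x f) = expect P f.
Proof.
move=> cf; apply/eqP; rewrite -subr_eq0 -normr_le0; apply/ler_addgt0Pr => e e0.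
rewrite add0r; have e20 : 0 < e / 2 by rewrite divr_gt0.
have [h [s hs] fh] := cylinder_dense cf e20.
have ch : cylinder h by exists s.
(* The site x is added and then split off, so that [rcons l x] is a duplicate-free support of h
   whether or not x was in s, and x is averaged first. *)
pose l := rem x (undup (x :: s)).
have ul : uniq (rcons l x).
  by rewrite rcons_uniq rem_uniq ?undup_uniq// mem_rem_uniq ?undup_uniq// inE eqxx.
have hl eta xi : agree (rcons l x) eta xi -> h eta = h xi.
  move=> H; apply: hs => y ys; apply/esym/H; rewrite mem_rcons inE.
  by rewrite mem_rem_uniq ?undup_uniq// !inE mem_undup inE ys orbT andbT orbN.
have hE : expect P (average x h) = expect P h.
  have uul : uniq l by move: ul; rewrite rcons_uniq => /andP[].
  rewrite (expect_averages ul hl (fun=> ord0)).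
  rewrite (expect_averages uul (average_cylinder hl) (fun=> ord0)).
  by rewrite /averages foldr_rcons.
have cch := cylinder_continuous ch.
have cah : continuous (average x h) by exact: average_continuous.
have caf : continuous (average x f) by exact: average_continuous.
have h1 := expect_dist P caf cah (average_dist x fh).
have h2 := expect_dist P cf cch fh.
by move: h1 h2; rewrite hE !ler_norml; lra.
Qed.

End product_expectation.

(** * Reversibility *)

Section pair_average.
Context {R : realType} (q : R) {N : nat} {V : choiceType}.
Implicit Types (eta xi : config N V) (f g : config N V -> R) (x y : V).

(** Natural numbers as arguments allow [a.-1] and [b.+1] without side conditions; out-of-range
    values are truncated as in [move] and occur with rate 0. *)
Definition pair_config x y eta (a b : nat) : config N V :=
  upd (upd eta x (inord a)) y (inord b).

Lemma move_right_pair x y eta a b : x != y -> (a <= N)%N -> (b <= N)%N ->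
  move x y (pair_config x y eta a b) = pair_config x y eta a.-1 b.+1.
Proof.
move=> xy aN bN; apply/funext => z; rewrite /move /pair_config /upd !eqxx (negPf xy).
rewrite !inordK ?ltnS//; case: (eqVneq z x) => [->|zx]; first by rewrite (negPf xy).
by case: eqP.
Qed.

Lemma move_left_pair x y eta a b : x != y -> (a <= N)%N -> (b <= N)%N ->
  move y x (pair_config x y eta a b) = pair_config x y eta a.+1 b.-1.
Proof.
move=> xy aN bN; apply/funext => z; rewrite /move /pair_config /upd !eqxx (negPf xy).
by rewrite !inordK ?ltnS//; case: (eqVneq z y) => // zy; case: eqP.
Qed.

Lemma average_pair (rho : V -> 'I_N.+1 -> R) x y f eta :
  average rho x (average rho y f) eta = \sum_(0 <= a < N.+1) \sum_(0 <= b < N.+1)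
    rho x (inord a) * rho y (inord b) * f (pair_config x y eta a b).
Proof.
rewrite big_mkord; apply: eq_bigr => a _; rewrite mulr_sumr big_mkord.
by apply: eq_bigr => b _; rewrite /pair_config !inord_val mulrA.
Qed.

Lemma bond_pair x y f eta a b : x != y -> (a <= N)%N -> (b <= N)%N ->
  bond q x y f (pair_config x y eta a b) =
  rate_right q N a b *
    (f (pair_config x y eta a.-1 b.+1) - f (pair_config x y eta a b)) +
  rate_left q N a b *
    (f (pair_config x y eta a.+1 b.-1) - f (pair_config x y eta a b)).
Proof.
move=> xy aN bN; rewrite bondE move_right_pair// move_left_pair//.
by rewrite /pair_config /upd !eqxx (negPf xy) !inordK.
Qed.

Lemma rate_right0 b : rate_right q N 0 b = 0.
Proof. by rewrite /rate_right qnum0 mulr0 mul0r. Qed.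

Lemma rate_right_full a : rate_right q N a N = 0.
Proof. by rewrite /rate_right subnn qnum0 mulr0. Qed.

Lemma rate_left0 a : rate_left q N a 0 = 0.
Proof. by rewrite /rate_left qnum0 mulr0. Qed.

Lemma rate_left_full b : rate_left q N N b = 0.
Proof. by rewrite /rate_left subnn qnum0 mulr0 mul0r. Qed.

(** After the shift, the terms at (a, b) are the two directions of one transition between (a+1, b)
    and (a, b+1). *)
Lemma sum_jumps (A B : nat -> nat -> R) :
  (forall b, A 0%N b = 0) -> (forall a, A a N = 0) ->
  (forall b, B N b = 0) -> (forall a, B a 0%N = 0) ->
  \sum_(0 <= a < N.+1) \sum_(0 <= b < N.+1) (A a b + B a b) =
  \sum_(0 <= a < N) \sum_(0 <= b < N) (A a.+1 b + B a b.+1).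
Proof.
move=> A0 AN BN B0; under eq_bigr do rewrite big_split /=.
rewrite big_split /=; under [RHS]eq_bigr do rewrite big_split /=.
rewrite [RHS]big_split /=; congr (_ + _).
  rewrite big_nat_recl// big1 ?add0r//; apply: eq_bigr => a _.
  by rewrite big_nat_recr//= AN addr0.
rewrite big_nat_recr//= [X in _ + X]big1 ?addr0//; apply: eq_bigr => a _.
by rewrite big_nat_recl// B0 add0r.
Qed.

End pair_average.

Section detailed_balance.
Context {R : realType} (q : R) {N : nat} {V : choiceType}.
Hypotheses (q_gt0 : 0 < q) (q_lt1 : q < 1).
Variables (rho : V -> 'I_N.+1 -> R) (P : probability (bconfig N V) R).
Hypothesis rho_ge0 : forall x n, 0 <= rho x n.
Hypothesis rho1 : forall x, \sum_n rho x n = 1.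
Hypothesis Prho : product_measure P rho.
Implicit Types (eta xi : config N V) (f g : config N V -> R) (x y : V).

(** Averaged over the two sites of the bond, with everything else fixed, f Lg - g Lf already
    vanishes: opposite transitions cancel in pairs. *)
Lemma expect_bond_sym x y f g : x != y ->
  (forall a b, (a < N)%N -> (b < N)%N ->
    rho x (inord a.+1) * rho y (inord b) * rate_right q N a.+1 b =
    rho x (inord a) * rho y (inord b.+1) * rate_left q N a b.+1) ->
  continuous f -> continuous g ->
  expect P (fun eta => f eta * bond q x y g eta) =
  expect P (fun eta => g eta * bond q x y f eta).
Proof.
move=> xy db cf cg; have J := @jump_operator_bond R q N V q_gt0 q_lt1 x y.
have c1 := config_continuousM cf (jump_continuous J cg).
have c2 := config_continuousM cg (jump_continuous J cf).
apply/eqP; rewrite -subr_eq0 -expectB//; apply/eqP.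
set h := fun eta => _; have ch : continuous h by exact: config_continuousB.
have cah : continuous (average rho y h) by exact: average_continuous.
rewrite -(expect_average rho_ge0 rho1 Prho y ch).
rewrite -(expect_average rho_ge0 rho1 Prho x cah).
rewrite (_ : average _ _ _ = fun=> 0) ?expect_cst//; apply/funext => eta.
rewrite average_pair.
pose F a b := f (pair_config x y eta a b); pose G a b := g (pair_config x y eta a b).
pose A a b := rho x (inord a) * rho y (inord b) * rate_right q N a b *
  (F a b * G a.-1 b.+1 - G a b * F a.-1 b.+1).
pose B a b := rho x (inord a) * rho y (inord b) * rate_left q N a b *
  (F a b * G a.+1 b.-1 - G a b * F a.+1 b.-1).
transitivity (\sum_(0 <= a < N.+1) \sum_(0 <= b < N.+1) (A a b + B a b)).
  apply: eq_big_nat => a /andP[_ aN]; apply: eq_big_nat => b /andP[_ bN].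
  by rewrite /h !bond_pair// /A /B /F /G; ring.
rewrite sum_jumps.
- rewrite big_nat big1// => a /andP[_ aN]; rewrite big_nat big1// => b /andP[_ bN].
  by rewrite /A /B db//=; ring.
- by move=> b; rewrite /A rate_right0 mulr0 mul0r.
- by move=> a; rewrite /A rate_right_full mulr0 mul0r.
- by move=> b; rewrite /B rate_left_full mulr0 mul0r.
- by move=> a; rewrite /B rate_left0 mulr0 mul0r.
Qed.

Lemma expect_bonds_sym (l : seq (V * V)) f g :
  (forall p, p \in l -> p.1 != p.2 /\
    forall a b, (a < N)%N -> (b < N)%N ->
    rho p.1 (inord a.+1) * rho p.2 (inord b) * rate_right q N a.+1 b =
    rho p.1 (inord a) * rho p.2 (inord b.+1) * rate_left q N a b.+1) ->
  continuous f -> continuous g ->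
  expect P (fun eta => f eta * bonds q l g eta) =
  expect P (fun eta => g eta * bonds q l f eta).
Proof.
move=> lP cf cg; rewrite /bonds; elim: l lP => [|p l IH] lP.
  by congr (expect P _); apply/funext => eta; rewrite !big_nil !mulr0.
have cJ (h h' : config N V -> R) : continuous h -> continuous h' ->
    continuous (fun eta => h eta * bond q p.1 p.2 h' eta).
  move=> ch ch'; apply: config_continuousM => //.
  exact: (jump_continuous (jump_operator_bond q_gt0 q_lt1 _ _)).
have cL (h h' : config N V -> R) : continuous h -> continuous h' ->
    continuous (fun eta => h eta * \sum_(p <- l) bond q p.1 p.2 h' eta).
  move=> ch ch'; apply: config_continuousM => //.
  exact: (jump_continuous (jump_operator_bonds q_gt0 q_lt1 l)).
under eq_fun do rewrite big_cons mulrDr.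
under [in RHS]eq_fun do rewrite big_cons mulrDr.
rewrite !expectD; try by [exact: cJ|exact: cL]; congr (_ + _).
- by have [] := lP p (mem_head _ _) => ? ?; exact: expect_bond_sym.
- by apply: IH => p' p'l; apply: lP; rewrite inE p'l orbT.
Qed.

End detailed_balance.

Section reversible_semigroup.
Context {R : realType} {N : nat} {V : choiceType}.
Implicit Types (eta xi : config N V) (f g : config N V -> R).
Variables (P : probability (bconfig N V) R).
Variables (L : (config N V -> R) -> config N V -> R) (C : R).
Hypothesis (J : jump_operator L C).
Hypothesis L_sym : forall f g, continuous f -> continuous g ->
  expect P (fun eta => f eta * L g eta) = expect P (fun eta => g eta * L f eta).

Lemma expect_iter_sym k f g : continuous f -> continuous g ->
  expect P (fun eta => f eta * iter k L g eta) =
  expect P (fun eta => g eta * iter k L f eta).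
Proof.
elim: k f g => [|k IH] f g cf cg /=.
  by congr (expect P _); apply/funext => eta; rewrite mulrC.
rewrite L_sym//; last exact: (iter_jump_continuous J).
transitivity (expect P (fun eta => L f eta * iter k L g eta)).
  by congr (expect P _); apply/funext => eta; rewrite mulrC.
rewrite IH//; last exact: (jump_continuous J).
by rewrite -iterSr.
Qed.

Lemma expect_exp_semigroup_sym t f g : 0 <= t -> continuous f -> continuous g ->
  expect P (fun eta => f eta * exp_semigroup L t g eta) =
  expect P (fun eta => g eta * exp_semigroup L t f eta).
Proof.
move=> t0 cf cg; apply/eqP; rewrite -subr_eq0 -normr_le0; apply/ler_addgt0Pr => e e0.
rewrite add0r.
have [M0 fM0] := continuous_bounded cf; have [M1 gM1] := continuous_bounded cg.
pose M := Num.max M0 M1.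
have fM eta : `|f eta| <= M by rewrite le_max fM0.
have gM eta : `|g eta| <= M by rewrite le_max gM1 orbT.
have M_ge0 : 0 <= M by apply: le_trans (fM (fun=> ord0)).
have [n ne] : exists n, M * (M * exp_coeff (t * C) n) <= e / 2.
  have : M * (M * exp_coeff (t * C) n) @[n --> \oo] --> M * (M * 0).
    by do 2! (apply: cvgM; first exact: cvg_cst); exact: cvg_exp_coeff.
  have e20 : 0 < e / 2 by rewrite divr_gt0.
  rewrite !mulr0 => /cvgr0Pnorm_le/(_ _ e20)[n _ /(_ n (leqnn n))] h.
  by exists n; rewrite (le_trans (ler_norm _)).
pose T (h : config N V -> R) eta := \sum_(k < n) exp_coeff t k * iter k L h eta.
have cT (h : config N V -> R) : continuous h -> continuous (T h).
  move=> ch; apply: (@config_continuous_sum _ _ _ _ (fun k => iter k L h)) => k.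
  exact: (iter_jump_continuous J).
have ET (h h' : config N V -> R) : continuous h -> continuous h' ->
    expect P (fun eta => h eta * T h' eta) =
    \sum_(k < n) exp_coeff t k * expect P (fun eta => h eta * iter k L h' eta).
  move=> ch ch'.
  rewrite -(@expect_sum _ _ _ _ _ _ (fun k eta => h eta * iter k L h' eta)).
    congr (expect P _); apply/funext => eta; rewrite mulr_sumr.
    by apply: eq_bigr => k _; rewrite mulrCA.
  by move=> k; apply: config_continuousM => //; exact: (iter_jump_continuous J).
have close (h h' : config N V -> R) : continuous h -> continuous h' ->
    (forall eta, `|h eta| <= M) ->
    (forall eta, `|h' eta| <= M) ->
    `|expect P (fun eta => h eta * exp_semigroup L t h' eta) -
      expect P (fun eta => h eta * T h' eta)| <= e / 2.
  move=> ch ch' hM h'M; apply: expect_dist.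
  - by apply: config_continuousM => //; exact: (exp_semigroup_continuous J).
  - by apply: config_continuousM => //; exact: cT.
  move=> eta; rewrite -mulrBr normrM (le_trans _ ne)// ler_pM//.
  have := exp_semigroup_taylor J t0 h'M (iter_jump_bounded J n h'M) eta.
  by rewrite exp_coeffM mulrCA.
have := close _ _ cf cg fM gM; have := close _ _ cg cf gM fM.
have -> : expect P (fun eta => f eta * T g eta) = expect P (fun eta => g eta * T f eta).
  by rewrite !ET//; apply: eq_bigr => k _; rewrite expect_iter_sym.
by rewrite !ler_norml; lra.
Qed.

End reversible_semigroup.

(** * Homogeneous product measures *)

Section homogeneous_marginal.
Context {R : realType} {N : nat} {V : choiceType}.
Variables (P : probability (bconfig N V) R) (mu : 'I_N.+1 -> R) (x0 : V).
Hypothesis Pmu : product_measure P (fun=> mu).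

Lemma homogeneous_marginal_ge0 n : 0 <= mu n.
Proof.
have := Pmu (fun=> n) (isT : uniq [:: x0]); rewrite big_seq1 => H.
by rewrite -lee_fin -H; exact: measure_ge0.
Qed.

Lemma homogeneous_marginal_sum : \sum_n mu n = 1.
Proof.
pose xi : config N V := fun=> ord0.
have := @agree_rcons_upd N V [::] x0 xi isT.
have -> : agree [::] xi = setT by apply/seteqP; split.
move=> /(congr1 (P : set (bconfig N V) -> \bar R)).
rewrite probability_setT (measure_bigsetU_ord P xpredT); first last.
- apply/trivIsetP => i j _ _ ij; apply/seteqP; split=> // eta [H1 H2].
  move/eqP: ij; apply; have := H1 x0; rewrite inE eqxx => /(_ isT) <-.
  by have := H2 x0; rewrite inE eqxx => /(_ isT).
- by move=> i; exact: measurable_agree.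
rewrite (eq_bigr (fun i : 'I_N.+1 => (mu i)%:E)); last first.
  move=> i _; have := Pmu (fun y => if y == x0 then i else xi y) (isT : uniq [:: x0]).
  by rewrite big_seq1 eqxx.
by rewrite sumEFin => -[].
Qed.

End homogeneous_marginal.

(** * Two-site currents of a homogeneous product measure *)

Section current.
Context {R : realType} (q : R) {N : nat} (mu : 'I_N.+1 -> R).

(** Extension of [mu] by 0 beyond N, so that the current relations hold for all natural numbers. *)
Definition weight (n : nat) : R := if (n <= N)%N then mu (inord n) else 0.

Definition site_mean (u : nat -> R) : R := \sum_(n < N.+1) mu n * u n.

(** Net probability flow from (a+1, b) to (a, b+1) across a bond; it is zero exactly when detailed
    balance holds for this transition. *)
Definition current (a b : nat) : R :=
  weight a.+1 * weight b * rate_right q N a.+1 b -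
  weight a * weight b.+1 * rate_left q N a b.+1.

Definition pair_current (phi : nat -> nat -> R) : R :=
  \sum_(0 <= a < N) \sum_(0 <= b < N) current a b * (phi a b.+1 - phi a.+1 b).

Lemma weightE n : (n <= N)%N -> weight n = mu (inord n).
Proof. by rewrite /weight => ->. Qed.

Lemma weight_gtN n : (N < n)%N -> weight n = 0.
Proof. by rewrite /weight ltnNge => /negPf ->. Qed.

Lemma site_mean_delta n : site_mean (fun k => (k == n)%:R) = weight n.
Proof.
rewrite /site_mean /weight; case: ifPn => nN.
  rewrite (bigD1 (inord n))//= inordK// eqxx mulr1 big1 ?addr0// => k kn.
  case: eqP => [kE|]; last by rewrite mulr0.
  by move/eqP: kn; rewrite -kE inord_val.
rewrite big1// => k _; case: eqP => [kE|]; last by rewrite mulr0.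
by move: nN; rewrite -kE -ltnS ltn_ord.
Qed.

Lemma current_gtl a b : (N <= a)%N -> current a b = 0.
Proof.
move=> Na; rewrite /current weight_gtN//; move: Na.
rewrite leq_eqVlt => /predU1P[<-|Na]; first by rewrite rate_left_full; ring.
by rewrite (weight_gtN Na); ring.
Qed.

Lemma current_gtr a b : (N <= b)%N -> current a b = 0.
Proof.
move=> Nb; rewrite /current (@weight_gtN b.+1)//; move: Nb.
rewrite leq_eqVlt => /predU1P[<-|Nb]; first by rewrite rate_right_full; ring.
by rewrite (weight_gtN Nb); ring.
Qed.

Lemma pair_current_delta a b :
  pair_current (fun c d => (c == a)%:R * (d == b)%:R) =
  (if b is b'.+1 then current a b' else 0) -
  (if a is a'.+1 then current a' b else 0).
Proof.
have pick c d : \sum_(0 <= k < N) \sum_(0 <= l < N)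
    current k l * ((k == c)%:R * (l == d)%:R) = current c d.
  have [Nc|cN] := leqP N c.
    rewrite (current_gtl _ Nc) big_nat big1// => k /andP[_ kN].
    by rewrite big1// => l _; rewrite (ltn_eqF (leq_trans kN Nc)) mul0r mulr0.
  have [Nd|dN] := leqP N d.
    rewrite (current_gtr _ Nd) big1// => k _; rewrite big_nat big1// => l /andP[_ lN].
    by rewrite (ltn_eqF (leq_trans lN Nd)) !mulr0.
  rewrite (bigD1_seq c) ?iota_uniq ?mem_index_iota//=.
  rewrite (bigD1_seq d) ?iota_uniq ?mem_index_iota//=.
  rewrite !eqxx !mulr1 !big1 ?addr0//.
    by move=> k kc; rewrite big1// => l _; rewrite (negPf kc) mul0r mulr0.
  by move=> l ld; rewrite (negPf ld) !mulr0.
rewrite /pair_current; under eq_bigr do under eq_bigr do rewrite mulrBr.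
under eq_bigr do rewrite sumrB; rewrite sumrB; congr (_ - _).
  case: b => [|b]; last by rewrite -pick.
  by rewrite big1// => k _; rewrite big1// => l _; rewrite !mulr0.
case: a => [|a]; last by rewrite -pick.
by rewrite big1// => k _; rewrite big1// => l _; rewrite mul0r mulr0.
Qed.

End current.

Section homogeneous_expectation.
Context {R : realType} (q : R) {N : nat} {V : choiceType}.
Hypotheses (q_gt0 : 0 < q) (q_lt1 : q < 1).
Variables (P : probability (bconfig N V) R) (mu : 'I_N.+1 -> R).
Hypothesis mu_ge0 : forall n, 0 <= mu n.
Hypothesis mu1 : \sum_n mu n = 1.
Hypothesis Pmu : product_measure P (fun=> mu).
Implicit Types (eta xi : config N V) (f g : config N V -> R) (x y : V) (u v : nat -> R).

Let mu'_ge0 (x : V) n : 0 <= mu n. Proof. exact: mu_ge0. Qed.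
Let mu'1 (x : V) : \sum_n mu n = 1. Proof. exact: mu1. Qed.

Lemma site_continuous u x : continuous (fun eta : config N V => u (eta x)).
Proof.
apply: cylinder_continuous; exists [:: x] => eta xi H.
by rewrite H// mem_head.
Qed.

Lemma expect_site_mul u x f s : x \notin s ->
  (forall eta xi, agree s eta xi -> f eta = f xi) ->
  expect P (fun eta => u (eta x) * f eta) = site_mean mu u * expect P f.
Proof.
move=> xs fs; have cf : continuous f.
  by apply: cylinder_continuous; exists s => eta zeta ez; apply: fs => y /ez.
have cuf : continuous (fun eta => u (eta x) * f eta).
  by apply: config_continuousM => //; exact: site_continuous.
rewrite -(expect_average mu'_ge0 mu'1 Pmu x cuf) -expectZ//; congr (expect P _).
apply/funext => eta; rewrite /average /site_mean mulr_suml; apply: eq_bigr => n _.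
rewrite -mulrA /upd eqxx (fs _ eta)// => y ys.
by case: eqP => // yx; move: xs; rewrite -yx ys.
Qed.

Lemma expect_bond_pair x y (phi : nat -> nat -> R) : x != y ->
  expect P (bond q x y (fun eta => phi (eta x) (eta y))) = pair_current q mu phi.
Proof.
move=> xy; pose f (eta : config N V) := phi (eta x : nat) (eta y : nat) : R.
have cf : continuous f.
  apply: cylinder_continuous; exists [:: x; y] => eta xi H.
  by rewrite /f !H// !inE eqxx ?orbT.
have cb := jump_continuous (@jump_operator_bond R q N V q_gt0 q_lt1 x y) cf.
have cab := average_continuous mu'_ge0 mu'1 (x := y) cb.
rewrite -(expect_average mu'_ge0 mu'1 Pmu y cb).
rewrite -(expect_average mu'_ge0 mu'1 Pmu x cab).
rewrite (_ : average _ _ _ = fun=> pair_current q mu phi) ?expect_cst//.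
apply/funext => eta; rewrite average_pair.
pose A a b : R := weight mu a * weight mu b * rate_right q N a b *
  (phi a.-1 b.+1 - phi a b).
pose B a b : R := weight mu a * weight mu b * rate_left q N a b *
  (phi a.+1 b.-1 - phi a b).
have pairx a b : (a <= N)%N -> pair_config x y eta a b x = a :> nat.
  by move=> aN; rewrite /pair_config /upd (negPf xy) eqxx inordK.
have pairy a b : (b <= N)%N -> pair_config x y eta a b y = b :> nat.
  by move=> bN; rewrite /pair_config /upd eqxx inordK.
transitivity (\sum_(0 <= a < N.+1) \sum_(0 <= b < N.+1) (A a b + B a b)).
  apply: eq_big_nat => a /andP[_]; rewrite ltnS => aN.
  apply: eq_big_nat => b /andP[_]; rewrite ltnS => bN.
  rewrite bond_pair// mulrDr /A /B !weightE//; congr (_ + _); rewrite [LHS]mulrA.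
    have [->|b_neqN] := eqVneq b N; first by rewrite rate_right_full mulr0 !mul0r.
    by rewrite /f !pairx ?pairy// ?ltn_neqAle ?b_neqN// (leq_trans (leq_pred _)).
  have [->|a_neqN] := eqVneq a N; first by rewrite rate_left_full mulr0 !mul0r.
  by rewrite /f !pairx ?pairy// ?ltn_neqAle ?a_neqN// (leq_trans (leq_pred _)).
rewrite sum_jumps.
- apply: eq_big_nat => a /andP[_ aN]; apply: eq_big_nat => b /andP[_ bN].
  by rewrite /A /B /current /=; ring.
- by move=> b; rewrite /A rate_right0 mulr0 mul0r.
- by move=> a; rewrite /A rate_right_full mulr0 mul0r.
- by move=> b; rewrite /B rate_left_full mulr0 mul0r.
- by move=> a; rewrite /B rate_left0 mulr0 mul0r.
Qed.

Lemma bond_factor_l x y z u f : z != x -> z != y ->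
  bond q x y (fun eta => u (eta z) * f eta) = fun eta => u (eta z) * bond q x y f eta.
Proof.
move=> zx zy; apply/funext => eta; rewrite !bondE.
by rewrite /move (negPf zx) (negPf zy); ring.
Qed.

(* The outer bonds see only one of the two sites of the test function
   u (eta x) v (eta y); this yields the cocycle form of the pair current. *)
Lemma pair_current_cocycle w x y z u v :
  w != x -> w != y -> x != y -> y != z -> x != z ->
  (forall u v : nat -> R, let f eta : R := u (eta x) * v (eta y) in
    expect P (fun eta => bond q w x f eta + bond q x y f eta + bond q y z f eta) = 0) ->
  pair_current q mu (fun a b => u a * v b) =
  pair_current q mu (fun a _ => u a) * site_mean mu v -
  site_mean mu u * pair_current q mu (fun a _ => v a).
Proof.
move=> wx wy xy yz xz st.
pose lft (u : nat -> R) := pair_current q mu (fun a _ => u a).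
pose rgt (u : nat -> R) := pair_current q mu (fun _ b => u b).
have Jc (a b : V) g : continuous g -> continuous (bond q a b g).
  exact: (jump_continuous (@jump_operator_bond R q N V q_gt0 q_lt1 a b)).
have key (u' v' : nat -> R) : rgt u' * site_mean mu v' +
    pair_current q mu (fun a b => u' a * v' b) +
    site_mean mu u' * lft v' = 0.
  pose f (eta : config N V) : R := u' (eta x) * v' (eta y).
  have : expect P (fun eta => bond q w x f eta + bond q x y f eta + bond q y z f eta) = 0.
    exact: st.
  have cf : continuous f.
    by apply: config_continuousM; exact: site_continuous.
  have cD : continuous (fun eta => bond q w x f eta + bond q x y f eta).
    by apply: config_continuousD; exact: Jc.
  rewrite expectD//; last exact: Jc.
  rewrite expectD//; try exact: Jc.
  move=> <-; congr (_ + _ + _).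
  - have -> : f = fun eta => v' (eta y) * u' (eta x).
      by apply/funext => eta; rewrite /f mulrC.
    rewrite (@bond_factor_l w x y v' (fun eta => u' (eta x))) 1?eq_sym//.
    rewrite (@expect_site_mul v' y _ [:: w; x]).
    + by rewrite mulrC (expect_bond_pair (fun _ b => u' b)).
    + by rewrite !inE negb_or eq_sym wy eq_sym xy.
    + move=> eta xi exi; apply: (@bond_agree _ q _ _ w x _ [:: x]) => [eta1 xi1 h|].
        by rewrite h ?mem_head.
      by move=> a; rewrite !inE => H; apply: exi; rewrite !inE; move: H; do 2 case: (_ == _).
  - by rewrite (expect_bond_pair (fun a b => u' a * v' b)).
  - rewrite /f bond_factor_l//.
    rewrite (@expect_site_mul u' x _ [:: y; z]).
    + by rewrite (expect_bond_pair (fun a _ => v' a)).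
    + by rewrite !inE negb_or xy xz.
    + move=> eta xi exi; apply: (@bond_agree _ q _ _ y z _ [:: y]) => [eta1 xi1 h|].
        by rewrite h ?mem_head.
      by move=> a; rewrite !inE => H; apply: exi; rewrite !inE; move: H; do 2 case: (_ == _).
have mean1 : site_mean mu (fun=> 1) = 1.
  by rewrite /site_mean; under eq_bigr do rewrite mulr1.
have K0 : pair_current q mu (fun _ _ => 1) = 0.
  by rewrite /pair_current big1// => a _; rewrite big1// => b _; rewrite subrr mulr0.
have R0 : rgt (fun=> 1) = 0 by [].
(* Testing a single site balances its two bonds, so a bond affects the laws of its two end sites in
   opposite ways. *)
have opp (u' : nat -> R) : rgt u' = - lft u'.
  have := key (fun=> 1) u'; rewrite R0 mul0r add0r mean1 mul1r => /eqP.
  rewrite addr_eq0 => /eqP <-; congr (pair_current _ _ _).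
  by apply/funext => a; apply/funext => b; rewrite mul1r.
have := key u v; rewrite opp /lft; lra.
Qed.

End homogeneous_expectation.

Section positive_weights.
Context {R : realType}.

(* The first three relations determine m1^2/(m0 m2) and m0 m3/(m1 m2);
   substituted into the last one, they leave a nonzero polynomial in g and y. *)
Lemma no_positive_weights (g y m0 m1 m2 m3 : R) : 0 < g < 1 -> 0 < y <= 1 ->
  0 < m0 -> 0 < m1 -> 0 < m2 ->
  m2 * m0 * ((1 + g) * (1 - g ^+ 2 * y) * (1 + g * y)) =
    m1 ^+ 2 * ((1 - g * y) * (1 + g ^+ 3 * y)) ->
  m3 * m0 * ((1 - g ^+ 3) * (1 - g ^+ 2 * y) * (1 + y)) =
    m1 * m2 * ((1 - g) * (1 - y) * (1 + g ^+ 4 * y)) ->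
  m0 * (m3 * m0 * ((1 - g ^+ 3) * (1 - g ^+ 2 * y)) -
      m1 * m2 * ((1 - g ^+ 2) * (1 - g * y) +
        g ^+ 4 * y * (1 - y) * (1 - g) - g ^+ 2 * y * (1 - g * y) * (1 - g ^+ 2))) +
    m1 * (m2 * m0 * ((1 - g ^+ 2) * (1 - g ^+ 2 * y)) -
      m1 ^+ 2 * (g ^+ 3 * y * (1 - g) * (1 - g * y))) -
    m2 * (m1 * m0 * ((1 - g) * (1 - g ^+ 2 * y) * (1 - g ^+ 2 * y))) = 0 ->
  False.
Proof.
move=> /andP[g0 g1] /andP[y0 y1] m0_gt0 m1_gt0 m2_gt0 R1 R2 R3.
(* What remains after the elimination below. Its last factor is positive because gy <= g and g^2 y <
   1. *)
pose Q := y * (1 - g) ^+ 3 * (1 + g) * (1 - g ^+ 2 * y) *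
  (2 + g - g * y - 2 * g ^+ 2 * y).
suff : m0 * m1 * m2 * Q = 0.
  have gy : g * y < 1 by nra.
  have gy' : g * y <= g by nra.
  have ggy : g ^+ 2 * y < 1 by rewrite expr2; nra.
  apply/eqP; rewrite gt_eqF// /Q !mulr_gt0 ?exprn_gt0 ?subr_gt0//; by [lra|rewrite -mulrA; lra].
pose E1 : R := m2 * m0 * ((1 + g) * (1 - g ^+ 2 * y) * (1 + g * y)) -
    m1 ^+ 2 * ((1 - g * y) * (1 + g ^+ 3 * y)).
pose E2 : R := m3 * m0 * ((1 - g ^+ 3) * (1 - g ^+ 2 * y) * (1 + y)) -
    m1 * m2 * ((1 - g) * (1 - y) * (1 + g ^+ 4 * y)).
have E10 : E1 = 0 by rewrite /E1 R1 subrr.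
have E20 : E2 = 0 by rewrite /E2 R2 subrr.
(* The third relation is multiplied by the factors (1+y) and (1 + g^3 y), with which the first two
   relations clear m0 m3 and m1^2; the literal 0 is its left-hand side. *)
transitivity (- ((1 + y) * (1 + g ^+ 3 * y) * 0 -
  m1 * g ^+ 3 * y * (1 - g) * (1 + y) * E1 - m0 * (1 + g ^+ 3 * y) * E2)); last first.
  by rewrite E10 E20; ring.
by rewrite -R3 /E1 /E2 /Q; ring.
Qed.

End positive_weights.

(** * The cocycle relations have only degenerate solutions *)

Section no_current_cocycle.
Context {R : realType} (q : R) {N : nat} (mu : 'I_N.+1 -> R).
Hypotheses (q_gt0 : 0 < q) (q_lt1 : q < 1) (N_gt1 : (1 < N)%N).
Hypothesis mu_ge0 : forall n, 0 <= mu n.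
Hypothesis mu1 : \sum_n mu n = 1.
Hypothesis cocycle : forall u v : nat -> R,
  pair_current q mu (fun a b => u a * v b) =
  pair_current q mu (fun a _ => u a) * site_mean mu v -
  site_mean mu u * pair_current q mu (fun a _ => v a).

Local Notation m := (weight mu).
Local Notation K := (current q mu).
Local Notation g := (q ^+ 2).

Let N_gt0 : (0 < N)%N := ltnW N_gt1.

Lemma weight_ge0 n : 0 <= m n.
Proof. by rewrite /weight; case: ifP. Qed.

Lemma current_cocycle : exists d : nat -> R, forall a b,
  (if b is b'.+1 then K a b' else 0) - (if a is a'.+1 then K a' b else 0) =
  d a * m b - m a * d b.
Proof.
exists (fun a => pair_current q mu (fun c _ => (c == a)%:R)) => a b.
by rewrite -pair_current_delta cocycle !site_mean_delta.
Qed.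

(** The right-hand side of the cocycle relation is antisymmetric and vanishes on the diagonal. *)
Lemma current_diag a : K a.+1 a = K a a.+1.
Proof.
have [d /(_ a.+1 a.+1) /=] := current_cocycle; rewrite mulrC subrr => /eqP.
by rewrite subr_eq0 => /eqP.
Qed.

Lemma expr_gap_gt0 k : (0 < k)%N -> 0 < 1 - g ^+ k.
Proof.
move=> k0; have g1 : g < 1 by rewrite exprn_ilt1// ltW.
by rewrite subr_gt0 exprn_ilt1 ?exprn_ge0 ?ltW// -lt0n.
Qed.

Lemma rate_diag_gt0 a : (0 < a < N)%N -> 0 < rate_right q N a a.
Proof.
move=> /andP[a0 aN]; rewrite rate_rightE//; last exact: ltnW.
by rewrite mulr_gt0 ?rate_max_gt0// mulr_gt0// expr_gap_gt0// subn_gt0.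
Qed.

(** The diagonal relation equates a positive multiple of m(a+1)^2 with a nonnegative multiple of
    m(a) m(a+2). *)
Lemma weight_neighbours a : (a.+1 < N)%N -> 0 < m a.+1 -> 0 < m a /\ 0 < m a.+2.
Proof.
move=> aN ma; have := current_diag a; rewrite /current => H.
have r1 := rate_diag_gt0 (a := a.+1) aN.
have /andP[r2 _] := rate_left_bounds q_gt0 q_lt1 (ltnW aN) (ltnW aN).
have p1 := mulr_gt0 (mulr_gt0 ma ma) r1.
have p2 := mulr_ge0 (mulr_ge0 (weight_ge0 a.+1) (weight_ge0 a.+1)) r2.
have : m a * m a.+2 != 0.
  apply/eqP => E; move: H p1 p2; rewrite (mulrC (m a.+2)) E !mul0r sub0r subr0.
  move: (_ * _) (_ * _) => A B; lra.
rewrite mulf_eq0 negb_or => /andP[m0 m2].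
by rewrite !lt_neqAle !weight_ge0 !andbT ![0 == _]eq_sym.
Qed.

Lemma weight_interior a : (0 < a < N)%N -> 0 < m a -> 0 < m 1.
Proof.
elim: a => // -[|a] IH //= aN ma; apply: IH; first exact: ltnW.
by have [] := weight_neighbours aN ma.
Qed.

(** If m(1) = 0, all interior weights vanish. The relation at (N-1, 1) then says that two
    nonnegative terms add up to 0, one of them a positive multiple of m(N) m(0). *)
Lemma weight_boundary : m 1 = 0 -> m 0 = 0 \/ m N = 0.
Proof.
move=> m1; have m_int a : (0 < a < N)%N -> m a = 0.
  move=> aN; have := weight_ge0 a; rewrite le_eqVlt => /predU1P[//|/(weight_interior aN)].
  by rewrite m1 ltxx.
have NE : N.-2.+2 = N by lia.
have mN1 : m N.-2.+1 = 0 by apply: m_int; lia.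
have [d /(_ N.-2.+1 1%N) /=] := current_cocycle.
rewrite m1 mN1 mulr0 mul0r subrr /current mN1 m1 NE !(mul0r, mulr0) subr0 sub0r opprK => H.
have r1 : 0 < rate_right q N N 0.
  rewrite rate_rightE//.
  by rewrite subn0 mulr_gt0 ?rate_max_gt0// mulr_gt0// expr_gap_gt0.
have /andP[r2 _] := @rate_left_bounds R q N q_gt0 q_lt1 N.-2 2
  (leq_trans (leq_pred _) (leq_pred _)) N_gt1.
have p2 := mulr_ge0 (mulr_ge0 (weight_ge0 N.-2) (weight_ge0 2)) r2.
have : m N * m 0 * rate_right q N N 0 <= 0.
  by move: H p2; move: (_ * _) (_ * _) => A B; lra.
rewrite pmulr_lle0// => p0.
have /eqP : m N * m 0 = 0 by apply/le_anti; rewrite p0 mulr_ge0 ?weight_ge0.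
by rewrite mulf_eq0 => /orP[/eqP|/eqP]; [right|left].
Qed.

Lemma weights_positive : mu ord0 <> 1 -> mu ord_max <> 1 ->
  [/\ 0 < m 0, 0 < m 1 & 0 < m 2].
Proof.
move=> mu0 muN; have := weight_ge0 1; rewrite le_eqVlt => /predU1P[m1|m1]; last first.
  by have [] := weight_neighbours N_gt1 m1.
exfalso; have m_int a : (0 < a < N)%N -> m a = 0.
  move=> aN; have := weight_ge0 a; rewrite le_eqVlt => /predU1P[//|/(weight_interior aN)].
  by rewrite -m1 ltxx.
have : m 0 + m N = 1.
  rewrite -mu1 (bigD1 ord0)//= (bigD1 ord_max)/=; last by apply/eqP => /(congr1 val) /=; lia.
  rewrite big1 ?addr0; last first.
    move=> i /andP[i0 iN]; rewrite -[i]inord_val -weightE ?ord_leq// m_int//.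
    move: i0 iN; rewrite -!val_eqE /=; have := ltn_ord i; lia.
  by rewrite !weightE//; congr (mu _ + mu _); apply/val_inj; rewrite /= inordK.
have [m0|mN] := weight_boundary (esym m1).
  rewrite m0 add0r weightE// => H; apply: muN; rewrite -H; congr mu.
  by apply/val_inj; rewrite /= inordK.
rewrite mN addr0 weightE// => H; apply: mu0; rewrite -H; congr mu.
by apply/val_inj; rewrite /= inordK.
Qed.

Lemma homogeneous_degenerate : mu ord0 = 1 \/ mu ord_max = 1.
Proof.
have [|mu0] := eqVneq (mu ord0) 1; first by left.
have [|muN] := eqVneq (mu ord_max) 1; first by right.
have NE2 : (N - 2 = N.-2)%N by lia.
have NE2' : (N.+1 - 3 = N.-2)%N by lia.
have NE1 : (N - 1 = N.-2.+1)%N by lia.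
have NE0 : (N = 2 + N.-2)%N by lia.
exfalso; have [m0 m1 m2] := weights_positive (elimN eqP mu0) (elimN eqP muN).
have g0 : 0 < g by rewrite exprn_gt0.
have g1 : g < 1 by rewrite exprn_ilt1// ltW.
(* All rates needed below are polynomials in g and g^{N-2}, so one algebraic identity serves every N
   >= 2. *)
pose y := g ^+ N.-2.
have y0 : 0 < y by rewrite exprn_gt0.
have y1 : y <= 1 by rewrite exprn_ile1// ltW.
have c0 := rate_max_gt0 N q_gt0 q_lt1; set c := rate_max q N in c0.
have gN : g ^+ N = g ^+ 2 * y by rewrite /y -[RHS]exprD -NE0.
have gN1 : g ^+ (N - 1) = g * y by rewrite NE1 [LHS]exprS.
have gN2 : g ^+ (N - 2) = y by rewrite NE2.
have yE : N = 2 -> y = 1 by move=> N2; rewrite /y (_ : N.-2 = 0%N) ?expr0// N2.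
have gN3 : (2 < N)%N -> g * g ^+ (N - 3) = y.
  by move=> N3; rewrite /y -[LHS]exprS -subSn// NE2'.
clearbody y.
have [d H] := current_cocycle.
have gN0 : g ^+ (N - 0) = g ^+ 2 * y by rewrite subn0.
have K00 : K 0 0 = c * (m 1 * m 0 * ((1 - g) * (1 - g ^+ 2 * y) * (1 - g ^+ 2 * y))).
  by rewrite /current rate_rightE// rate_leftE// gN0 gN1 gN expr0 expr1 -/c; ring.
have K10 : K 1 0 = c * (m 2 * m 0 * ((1 - g ^+ 2) * (1 - g ^+ 2 * y)) -
    m 1 ^+ 2 * (g ^+ 3 * y * (1 - g) * (1 - g * y))).
  by rewrite /current rate_rightE// rate_leftE// gN0 gN1 gN expr1 -/c; ring.
have K01 : K 0 1 = c * (m 1 ^+ 2 * ((1 - g) * (1 - g * y)) -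
    m 2 * m 0 * (g * y * (1 - g ^+ 2) * (1 - g ^+ 2 * y))).
  by rewrite /current rate_rightE// rate_leftE// gN2 gN1 gN expr1 expr0 -/c; ring.
have K20 : K 2 0 = c * (m 3 * m 0 * ((1 - g ^+ 3) * (1 - g ^+ 2 * y)) -
    m 1 * m 2 * (g ^+ 4 * y * (1 - y) * (1 - g))).
  by rewrite /current rate_rightE// rate_leftE// gN0 gN1 gN -/c; ring.
have K11 : K 1 1 = c * (m 1 * m 2 * ((1 - g ^+ 2) * (1 - g * y) -
    g ^+ 2 * y * (1 - g * y) * (1 - g ^+ 2))).
  by rewrite /current rate_rightE// rate_leftE// gN1 gN2 gN expr1 -/c; ring.
have K02 : K 0 2 = c * (m 1 * m 2 * ((1 - g) * (1 - y)) -
    m 3 * m 0 * (y * (1 - g ^+ 3) * (1 - g ^+ 2 * y))).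
  (* For N = 2 the current vanishes because occupation 3 is out of range; the formula agrees, since
     then y = 1 and m(3) = 0. *)
  have [N2|N2] := eqVneq N 2.
    by rewrite (@current_gtr _ _ _ _ 0 2) ?N2// (@weight_gtN _ _ _ 3) ?N2// yE//; ring.
  have {N2} N3 : (3 <= N)%N by rewrite ltn_neqAle eq_sym N2.
  rewrite /current rate_rightE// rate_leftE// gN2 gN -/c -(gN3 N3) expr1 expr0; ring.
have cancel (a b : R) : c * a = c * b -> a = b.
  by move/(mulfI (lt0r_neq0 c0)).
apply: (@no_positive_weights R g y (m 0) (m 1) (m 2) (m 3)) => //; try by apply/andP.
- have := current_diag 0; rewrite K10 K01 => /cancel E.
  have gap : 1 - g != 0 by rewrite subr_eq0 eq_sym lt_eqF.
  by apply: (mulfI gap); lra.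
(* Antisymmetry again: the relations at (3, 0) and (0, 3) have opposite right-hand sides. *)
- have h1 := H 3%N 0%N; have h2 := H 0%N 3%N.
  have E : K 2 0 = K 0 2 by rewrite /= in h1 h2; lra.
  move: E; rewrite K20 K02 => /cancel E; lra.
(* The combination with coefficients m(0), -m(1), m(2) is a 3 by 3 determinant with two equal rows,
   so the unknown d drops out. *)
- have h1 := H 2%N 1%N; have h2 := H 2%N 0%N; have h3 := H 1%N 0%N.
  apply: cancel; rewrite mulr0 /= in h1 h2 h3 *.
  transitivity (m 0 * (K 2 0 - K 1 1) - m 1 * (0 - K 1 0) + m 2 * (0 - K 0 0)).
    by rewrite K00 K10 K20 K11; ring.
  by rewrite h1 h2 h3; ring.
Qed.

End no_current_cocycle.

Section stationary_generator.
Context {R : realType} {N : nat} {V : choiceType}.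
Implicit Types (eta xi : config N V) (f g : config N V -> R).
Variables (P : probability (bconfig N V) R) (S : operators R N V).
Hypothesis stP : stationary P S.

(** Stationarity differentiated at time 0. It is phrased with the increment estimate so as to cover
    both [exp_semigroup] and abstract Markov semigroups. *)
Lemma stationary_generator0 f g : continuous f -> continuous g ->
  (forall t, 0 <= t -> continuous (S t f)) ->
  (forall e, 0 < e -> exists2 d : R, 0 < d & forall h, 0 < h < d ->
    forall eta, `|S h f eta - f eta - h * g eta| <= h * e) ->
  expect P g = 0.
Proof.
move=> cf cg cS H; apply/eqP; rewrite -normr_le0; apply/ler_addgt0Pr => e e0.
have [d d0 /(_ (d / 2))] := H e e0; have h0 : 0 < d / 2 by rewrite divr_gt0.
set h := d / 2 in h0 * => {}H;
have {}H : forall eta, `|S h f eta - f eta - h * g eta| <= h * e.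
  by apply: H; rewrite h0 ltr_pdivrMr// ltr_pMr// ltr1n.
have cSh := cS h (ltW h0).
have chg : continuous (fun eta => h * g eta).
  by apply: config_continuousM => //; exact: config_continuous_cst.
have cd : continuous (fun eta => S h f eta - f eta) by exact: config_continuousB.
have := expect_dist P cd chg H.
have ES : expect P (S h f) = expect P f.
  by have := stP (ltW h0) cf; rewrite !expectE// => -[].
rewrite expectB// ES subrr sub0r normrN expectZ// normrM (gtr0_norm h0).
by rewrite ler_pM2l// add0r.
Qed.

Lemma jump_operator_stationary0 L (C : R) f : jump_operator L C ->
  S = exp_semigroup L -> continuous f -> expect P (L f) = 0.
Proof.
move=> J SE cf; have cL := jump_continuous J cf; have [M fM] := continuous_bounded cf.
apply: (@stationary_generator0 f) => //.
  by rewrite SE => t t0; exact: (exp_semigroup_continuous J).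
move=> e e0; pose B := M * C ^+ 2 + 1.
have M0 : 0 <= M by exact: le_trans (fM (fun=> ord0)).
have B0 : 0 < B by rewrite ltr_wpDl// mulr_ge0// sqr_ge0.
exists (e / B); first by rewrite divr_gt0.
move=> h /andP[h0 he] eta.
have := exp_semigroup_taylor J (ltW h0) fM (iter_jump_bounded J 2 fM) eta.
rewrite SE !big_ord_recl big_ord0 /= addr0 /bump /= /exp_coeff /= expr0 expr1.
have -> : ((1 + 0)`! = 1)%N by [].
have -> : (2`! = 2)%N by [].
rewrite fact0 !divr1 mul1r opprD addrA => /le_trans; apply.
rewrite ltr_pdivlMr// in he; apply: le_trans (_ : h * (h * B) <= _); last first.
  by rewrite ler_pM2l// ltW.
have := mulr_ge0 (sqr_ge0 h) (mulr_ge0 M0 (sqr_ge0 C)); have := sqr_ge0 h.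
have -> : h * (h * B) = h ^+ 2 * (M * C ^+ 2) + h ^+ 2 by rewrite /B; ring.
move=> X_ge0 Y_ge0; rewrite [leLHS]mulrAC; move: X_ge0 Y_ge0.
by move: (h ^+ 2) (h ^+ 2 * _) => Y X; lra.
Qed.

End stationary_generator.

Section no_homogeneous.
Context {R : realType} (q : R) {N : nat}.
Hypotheses (q_gt0 : 0 < q) (q_lt1 : q < 1) (N_gt1 : (1 < N)%N).

(** The sites w, x, y, z are consecutive, and a test function of x and y sees only the three bonds
    between them. The sites w and z may coincide, as they do on the torus with three sites. *)
Lemma no_homogeneous_stationary {V : choiceType} (P : probability (bconfig N V) R)
    (w x y z : V) : w != x -> w != y -> x != y -> y != z -> x != z ->
  (forall f : config N V -> R, (forall eta xi, agree [:: x; y] eta xi -> f eta = f xi) ->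
    expect P (fun eta => bond q w x f eta + bond q x y f eta + bond q y z f eta) = 0) ->
  ~ nondegenerate_homogeneous_product P.
Proof.
move=> wx wy xy yz xz st [mu [Pmu mu0 muN]].
have mu_ge0 := homogeneous_marginal_ge0 x Pmu.
have mu_sum := homogeneous_marginal_sum x Pmu.
have cocycle u v := pair_current_cocycle q_gt0 q_lt1 mu_ge0 mu_sum Pmu u v wx wy xy yz xz.
have [] // := @homogeneous_degenerate R q N mu q_gt0 q_lt1 N_gt1 mu_ge0 mu_sum _.
move=> u v; apply: cocycle => u' v' f; apply: st => eta xi H.
by rewrite /f !H// !inE eqxx ?orbT.
Qed.

Lemma asep_torusE L (f : config N 'I_L -> R) :
  asep_torus q f = bonds q [seq (i, ordS i) | i <- enum 'I_L] f.
Proof. by apply/funext => eta; rewrite /bonds big_map big_enum. Qed.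

Lemma no_homogeneous_torus L (P : probability (bconfig N 'I_L) R) : (3 <= L)%N ->
  stationary P (exp_semigroup (@asep_torus R q N L)) ->
  ~ nondegenerate_homogeneous_product P.
Proof.
(* From here on the torus has [L.+1] sites, so the predecessor of 0 is L. *)
case: L P => // L P L3 stP.
pose x : 'I_L.+1 := ord0; pose y := ordS x; pose z := ordS y; pose w := ord_pred x.
have yE : y = 1%N :> nat by rewrite /= modn_small//; lia.
have zE : z = 2%N :> nat by rewrite -[nat_of_ord z]/(y.+1 %% L.+1)%N yE modn_small.
have wE : w = L :> nat by rewrite -[nat_of_ord w]/(L %% L.+1)%N modn_small.
have xE : x = 0%N :> nat by [].
have Sw : ordS w = x by rewrite /w ord_predK.
have Sx : ordS x = y by [].
have Sy : ordS y = z by [].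
clearbody z y w x.
have neq (i k : 'I_L.+1) : nat_of_ord i <> nat_of_ord k -> i != k.
  by move=> ik; apply/eqP => E; apply: ik; rewrite E.
have wx : w != x by apply: neq; rewrite wE xE; lia.
have wy : w != y by apply: neq; rewrite wE yE; lia.
have xy : x != y by apply: neq; rewrite xE yE.
have yz : y != z by apply: neq; rewrite yE zE.
have xz : x != z by apply: neq; rewrite xE zE.
apply: (no_homogeneous_stationary wx wy xy yz xz) => f fxy.
have cf : continuous f.
  by apply: cylinder_continuous; exists [:: x; y] => eta xi H; apply: fxy => a /H.
have TE : @asep_torus R q N L.+1 = bonds q [seq (i, ordS i) | i <- enum 'I_L.+1].
  by apply/funext => h; exact: asep_torusE.
have J := jump_operator_bonds q_gt0 q_lt1 (N := N) [seq (i, ordS i) | i <- enum 'I_L.+1].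
rewrite -TE in J; rewrite -[RHS](jump_operator_stationary0 stP J erefl cf).
congr (expect P _); apply/funext => eta; rewrite /asep_torus.
rewrite (bigD1 w)//= (bigD1 x) 1?eq_sym//= (bigD1 y)/=; last by rewrite eq_sym wy eq_sym xy.
rewrite Sw Sx Sy big1 ?addr0 ?addrA// => i /andP[/andP[iw ix] iy].
rewrite (@bond_out R q N _ _ _ _ [:: x; y])//.
  by rewrite !inE negb_or ix iy.
rewrite !inE negb_or -[in X in _ && X]Sx -{1}Sw !(inj_eq (can_inj (@ordSK _))).
by rewrite iw ix.
Qed.

Lemma no_homogeneous_Z (S : operators R N int) (P : probability (bconfig N int) R) :
  markov_semigroup S -> (forall h, cylinder h -> generator S h (@asep_Z R q N h)) ->
  stationary P S -> ~ nondegenerate_homogeneous_product P.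
Proof.
move=> mS gS stP.
apply: (@no_homogeneous_stationary int P (-1) 0 1 2) => // f fxy.
have cyl : cylinder f by exists [:: 0; 1] => eta xi H; apply: fxy => x /H.
have cf := cylinder_continuous cyl.
have [_ H] := (generatorP S f _).1 (gS f cyl).
have cg := generator_continuous mS (gS f cyl).
rewrite -[RHS](stationary_generator0 stP cf cg _ H); last first.
  by move=> t t0; exact: ms_continuous.
congr (expect P _); apply/funext => eta.
rewrite (@asep_Z_window R q N 2 3 f)//; last first.
  move=> eta1 xi1 exi; apply: fxy => x; rewrite !inE => /orP[]/eqP->; apply: exi;
  by rewrite mem_window.
have -> : bond q (-1) 0 f eta + bond q 0 1 f eta + bond q 1 2 f eta =
  \sum_(x <- [:: -1; 0; 1]) bond q x (x + 1) f eta.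
  by rewrite !big_cons big_nil addr0 [RHS]addrA (addNr (1 : int)) (add0r (1 : int)).
rewrite /asep_window /bonds big_map (_ : window 3 = [:: -3; -2; -1; 0; 1; 2])//.
have out (x : int) : x \notin [:: -1; 0; 1] -> bond q x (x + 1) f eta = 0.
  move=> xn; rewrite (@bond_out R q N _ _ _ _ [:: 0; 1])//; rewrite !inE in xn *; lia.
by rewrite !big_cons !big_nil /= (out (-3))// (out (-2))// (out 2)// !add0r.
Qed.

End no_homogeneous.

(** * The ASEP(q,j) *)

Section marginals.
Context {R : realType} (q : R) (N : nat).
Hypotheses (q_gt0 : 0 < q) (q_lt1 : q < 1).

Lemma qnum_gt0 n : (0 < n)%N -> 0 < qnum q n.
Proof.
move=> n0; rewrite qnumE//; apply: mulr_gt0 (expr_gap_gt0 q_gt0 q_lt1 n0).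
by rewrite mulr_gt0 ?invr_gt0 ?exprn_gt0 ?qnum_gap_gt0.
Qed.

Lemma qfactS n : qfact q n.+1 = qfact q n * qnum q n.+1.
Proof. by rewrite /qfact big_nat_recr. Qed.

Lemma qfact_gt0 n : 0 < qfact q n.
Proof.
elim: n => [|n IH]; first by rewrite /qfact big_nil.
by rewrite qfactS mulr_gt0// qnum_gt0.
Qed.

Lemma qbinom_gt0 n k : 0 < qbinom q n k.
Proof.
by rewrite /qbinom divr_gt0 ?qfact_gt0//; exact: (mulr_gt0 (qfact_gt0 _) (qfact_gt0 _)).
Qed.

Lemma qbinom_step n k : (k < n)%N ->
  qbinom q n k.+1 * qnum q k.+1 = qbinom q n k * qnum q (n - k).
Proof.
move=> kn; have E : (n - k = (n - k.+1).+1)%N by rewrite -subSn.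
rewrite /qbinom E !qfactS.
have := lt0r_neq0 (qfact_gt0 k); have := lt0r_neq0 (qfact_gt0 (n - k.+1)).
have := lt0r_neq0 (qnum_gt0 (ltn0Sn k)).
have := lt0r_neq0 (qnum_gt0 (ltn0Sn (n - k.+1))).
move: (qfact q n) (qfact q k) (qfact q (n - k.+1)) (qnum q k.+1) (qnum q (n - k.+1).+1).
move=> A B C D F F0 D0 C0 B0; field.
by rewrite F0 D0 C0 B0.
Qed.

Let q_neq0 : q != 0 := lt0r_neq0 q_gt0.

Lemma site_factor_gt0 i n : 0 < site_factor q N i n.
Proof. exact: exprz_gt0. Qed.

Lemma site_factorS i n :
  site_factor q N i n.+1 = site_factor q N i n * q ^ (2 + N%:Z - 2 * N%:Z * i).
Proof. by rewrite /site_factor -expfzDr//; congr (_ ^ _); rewrite intS; ring. Qed.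

Variable alpha : R.
Hypothesis alpha_gt0 : 0 < alpha.

Lemma partition_function_gt0 i : 0 < partition_function q N alpha i.
Proof.
have t_gt0 n : 0 < qbinom q N n * alpha ^+ n * site_factor q N i n.
  apply: mulr_gt0 (site_factor_gt0 _ _); apply: mulr_gt0 (qbinom_gt0 _ _) _.
  exact: exprn_gt0.
rewrite /partition_function big_ord_recl ltr_wpDr//.
by apply: sumr_ge0 => n _; exact: ltW.
Qed.

Lemma asep_marginal_gt0 i (n : 'I_N.+1) : 0 < asep_marginal q alpha i n.
Proof.
apply: mulr_gt0 (site_factor_gt0 _ _); apply: mulr_gt0 (qbinom_gt0 _ _).
by apply: divr_gt0 (partition_function_gt0 _); exact: exprn_gt0.
Qed.

Lemma asep_marginal_sum i : \sum_(n < N.+1) asep_marginal q alpha i n = 1.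
Proof.
have := lt0r_neq0 (partition_function_gt0 i); set Z := partition_function _ _ _ _ => Z0.
rewrite -(mulfV Z0) {1}/Z mulr_suml.
by apply: eq_bigr => n _; rewrite /asep_marginal -/Z; ring.
Qed.

Local Notation rho := (@asep_marginal R q N alpha).

(** The q-binomial recursion absorbs the q-numbers of the rates. What remains is a ratio q^{2N}
    between the two rates, and the site factor per particle changes by q^{-2N} from i to i+1: this
    fixes the spatial profile. *)
Lemma asep_marginal_balance (i : int) a b : (a < N)%N -> (b < N)%N ->
  rho i (inord a.+1) * rho (i + 1) (inord b) *
    rate_right q N a.+1 b =
  rho i (inord a) * rho (i + 1) (inord b.+1) *
    rate_left q N a b.+1.
Proof.
move=> aN bN; rewrite /asep_marginal !inordK ?ltnS//; try exact: ltnW.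
rewrite !site_factorS !exprS /rate_right /rate_left.
have := qbinom_step aN; have := qbinom_step bN.
have -> : q ^ (a.+1%:Z - b%:Z - N.+1%:Z) = q ^ (a%:Z - b%:Z) * q ^ (- N%:Z).
  by rewrite -expfzDr//; congr (_ ^ _); rewrite !intS; ring.
have -> : q ^ (a%:Z - b.+1%:Z + N.+1%:Z) = q ^ (a%:Z - b%:Z) * q ^ N%:Z.
  by rewrite -expfzDr//; congr (_ ^ _); rewrite !intS; ring.
have -> : q ^ (2 + N%:Z - 2 * N%:Z * (i + 1)) =
    q ^ (2 + N%:Z - 2 * N%:Z * i) * (q ^ (- N%:Z) * q ^ (- N%:Z)).
  by rewrite -!expfzDr//; congr (_ ^ _); ring.
have : q ^ N%:Z * q ^ (- N%:Z) = 1 by rewrite -expfzDr// subrr expr0z.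
set X := q ^ N%:Z; set X' := q ^ (- N%:Z); set W := q ^ (a%:Z - b%:Z); set T := q ^ _.
move=> XX' Bb Ba.
set Z1 := partition_function _ _ _ _; set Z2 := partition_function _ _ _ _.
pose rest := alpha * alpha ^+ a * alpha ^+ b / Z1 / Z2 * site_factor q N i a *
  site_factor q N (i + 1) b * T * X' * W.
transitivity (rest * (qbinom q N a.+1 * qnum q a.+1) * (qbinom q N b * qnum q (N - b))).
  by rewrite /rest; ring.
rewrite Ba -Bb -[LHS]mulr1 -XX' /rest; ring.
Qed.

End marginals.

Section closed_boundary.
Context {R : realType} (q : R) (N L : nat).
Hypotheses (q_gt0 : 0 < q) (q_lt1 : q < 1).

Definition closed_bonds : seq ('I_L * 'I_L) :=
  [seq p : 'I_L * 'I_L <- enum {: 'I_L * 'I_L} | p.2 == p.1.+1 :> nat].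

Lemma asep_closedE : @asep_closed R q N L = bonds q closed_bonds.
Proof.
apply/funext => f; apply/funext => eta.
by rewrite /asep_closed /bonds big_filter pair_big_dep /= big_enum_cond.
Qed.

Lemma closed_bonds_neq p : p \in closed_bonds -> p.1 != p.2.
Proof.
rewrite mem_filter => /andP[/eqP pE _]; apply/eqP => E.
by move: pE; rewrite E => /n_Sn.
Qed.

Lemma asep_closed_monotone :
  monotone_process (exp_semigroup (@asep_closed R q N L)).
Proof.
move=> t f t0 cf mf; have [M fM] := continuous_bounded cf; rewrite asep_closedE.
apply: (exp_semigroup_monotone (jump_operator_bonds q_gt0 q_lt1 _) t0 fM _ mf) => g mg.
exact: (bonds_monotone q_gt0 q_lt1 closed_bonds_neq mg).
Qed.

Lemma asep_closed_reversible (alpha : R) : 0 < alpha ->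
  exists P : probability (bconfig N 'I_L) R,
    product_measure P (fun i : 'I_L => asep_marginal q alpha (i.+1)%:Z) /\
    reversible P (exp_semigroup (@asep_closed R q N L)).
Proof.
move=> a0; pose rho (i : 'I_L) := @asep_marginal R q N alpha (i.+1)%:Z.
have rho_gt0 i n : 0 < rho i n by exact: asep_marginal_gt0.
have rho1 i : \sum_n rho i n = 1 by exact: asep_marginal_sum.
have [P Prho] := product_measure_exists rho_gt0 rho1; exists P; split=> // t f g t0 cf cg.
have rho_ge0 i n := ltW (rho_gt0 i n).
have J := jump_operator_bonds q_gt0 q_lt1 (N := N) closed_bonds.
rewrite asep_closedE !expectE; first congr EFin.
- apply: (expect_exp_semigroup_sym J) => // h h' ch ch'.
  apply: (expect_bonds_sym q_gt0 q_lt1 rho_ge0 rho1 Prho) => // p pl.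
  split=> [|a b aN bN]; first exact: closed_bonds_neq.
  move: pl; rewrite mem_filter => /andP[/eqP pE _].
  have -> : rho p.2 = @asep_marginal R q N alpha ((p.1.+1)%:Z + 1).
    by rewrite /rho pE -[p.1.+2]addn1 PoszD.
  exact: asep_marginal_balance.
- by apply: config_continuousM => //; exact: (exp_semigroup_continuous J).
- by apply: config_continuousM => //; exact: (exp_semigroup_continuous J).
Qed.

End closed_boundary.

Section infinite_volume.
Context {R : realType} (q : R) {N : nat}.
Hypotheses (q_gt0 : 0 < q) (q_lt1 : q < 1).

Local Notation AZ := (@asep_Z R q N).
Local Notation Sw m := (exp_semigroup (@asep_window R q N m)).

Let JW m : jump_operator (@asep_window R q N m) _ :=
  jump_operator_bonds q_gt0 q_lt1 _.

Lemma generated_by_cylinder (S : operators R N int) h : generated_by AZ S ->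
  cylinder h -> generator S h (AZ h).
Proof.
move=> [_ SP] ch; apply/SP/closed_extensionP => e e0.
by exists h => //; split=> eta; rewrite subrr normr0 ltW.
Qed.

Lemma generated_by_window_limit (S : operators R N int) t f : generated_by AZ S ->
  0 <= t -> continuous f -> window_limit q t f (S t f).
Proof.
move=> SP t0 cf; have [mS _] := SP.
by apply: (markov_window_limit q_gt0 q_lt1 mS) => // h; exact: generated_by_cylinder.
Qed.

Lemma asep_Z_well_defined : well_defined AZ.
Proof.
split.
  exists (@asep_semigroup R q N).
  apply: (generated_by_asep_Z q_gt0 q_lt1); first exact: markov_asep_semigroup.
  exact: generator_asep_semigroup.
move=> S S' SP S'P t f t0 cf.
exact: (window_limit_unique (generated_by_window_limit SP t0 cf)
  (generated_by_window_limit S'P t0 cf)).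
Qed.

Lemma window_bonds_neq m p :
  p \in [seq (x, x + 1) | x <- window m] -> p.1 != p.2 :> int.
Proof. by move=> /mapP[x _ ->] /=; lia. Qed.

Lemma asep_Z_monotone (S : operators R N int) : generated_by AZ S ->
  monotone_process S.
Proof.
move=> SP t f t0 cf mf eta xi exi; apply/ler_addgt0Pr => e e0.
have e20 : 0 < e / 2 by rewrite divr_gt0.
have [m /(_ m (leqnn m)) H] := generated_by_window_limit SP t0 cf e20.
have [M fM] := continuous_bounded cf.
have : Sw m t f eta <= Sw m t f xi.
  apply: (exp_semigroup_monotone (JW m) t0 fM _ mf) => // g mg.
  exact: (bonds_monotone q_gt0 q_lt1 (@window_bonds_neq m) mg).
by have := H eta; have := H xi; rewrite !ler_norml; lra.
Qed.

(** The infinite product measure is already reversible for each window, whose bonds satisfy detailed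
    balance; uniform convergence of the window semigroups does the rest. *)
Lemma asep_Z_reversible (S : operators R N int) (alpha : R) :
  generated_by AZ S -> 0 < alpha ->
  exists P : probability (bconfig N int) R,
    product_measure P (fun i : int => asep_marginal q alpha i) /\ reversible P S.
Proof.
move=> SP a0; pose rho (i : int) := @asep_marginal R q N alpha i.
have rho_gt0 i n : 0 < rho i n by exact: asep_marginal_gt0.
have rho1 i : \sum_n rho i n = 1 by exact: asep_marginal_sum.
have [P Prho] := product_measure_exists rho_gt0 rho1; exists P; split=> // t f g t0 cf cg.
have rho_ge0 i n := ltW (rho_gt0 i n); have [mS _] := SP.
have cS h : continuous h -> continuous (S t h) by exact: ms_continuous.
rewrite !expectE; try by apply: config_continuousM => //; exact: cS.
congr EFin; apply/eqP; rewrite -subr_eq0 -normr_le0; apply/ler_addgt0Pr => e e0.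
rewrite add0r.
have [M0 fM0] := continuous_bounded cf; have [M1 gM1] := continuous_bounded cg.
pose M := Num.max M0 M1.
have fM eta : `|f eta| <= M by rewrite le_max fM0.
have gM eta : `|g eta| <= M by rewrite le_max gM1 orbT.
have M_ge0 : 0 <= M by apply: le_trans (fM (fun=> ord0)).
(* M + 1 rather than M, since M may be 0; multiplication by a function bounded by M turns d into at
   most e/2. *)
pose d := e / (2 * (M + 1)).
have M1_gt0 : 0 < M + 1 by rewrite ltr_wpDl.
have d0 : 0 < d by rewrite divr_gt0// mulr_gt0.
have Md : M * d <= e / 2.
  have -> : M * d = e / 2 * (M / (M + 1)) by rewrite /d; field; rewrite lt0r_neq0.
  apply: ler_piMr; first by rewrite ltW// divr_gt0.
  by rewrite ler_pdivrMr// mul1r lerDl.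
have [m1 H1] := generated_by_window_limit SP t0 cf d0.
have [m2 H2] := generated_by_window_limit SP t0 cg d0.
pose m := maxn m1 m2.
have {}H1 := H1 m (leq_maxl _ _); have {}H2 := H2 m (leq_maxr _ _).
have cSw h : continuous h -> continuous (Sw m t h).
  exact: (exp_semigroup_continuous (JW m)).
have close (h h' : config N int -> R) : continuous h -> continuous h' ->
    (forall eta, `|h eta| <= M) -> (forall eta, `|Sw m t h' eta - S t h' eta| <= d) ->
    `|expect P (fun eta => h eta * Sw m t h' eta) -
      expect P (fun eta => h eta * S t h' eta)| <= e / 2.
  move=> ch ch' hM hd; apply: expect_dist.
  - by apply: config_continuousM => //; exact: cSw.
  - by apply: config_continuousM => //; exact: cS.
  - by move=> eta; rewrite -mulrBr normrM (le_trans _ Md)// ler_pM.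
have := close _ _ cf cg fM H2; have := close _ _ cg cf gM H1.
have -> : expect P (fun eta => f eta * Sw m t g eta) =
    expect P (fun eta => g eta * Sw m t f eta).
  apply: (expect_exp_semigroup_sym (JW m)) => // h h' ch ch'.
  apply: (expect_bonds_sym q_gt0 q_lt1 rho_ge0 rho1 Prho) => // p pl.
  split=> [|a b aN bN]; first exact: (window_bonds_neq pl).
  by move: pl => /mapP[x _ ->] /=; exact: asep_marginal_balance.
by rewrite !ler_norml; lra.
Qed.

End infinite_volume.

Unset Implicit Arguments.

Theorem theorem3p1 (R : realType) (q : R) (N : nat)
    (q_gt0 : 0 < q) (q_lt1 : q < 1) (N_gt0 : (0 < N)%N) :
  [/\ (* (a) *)
      forall (L : nat) (alpha : R), (0 < L)%N -> 0 < alpha ->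
        exists P : probability (bconfig N 'I_L) R,
          product_measure P (fun i : 'I_L => asep_marginal q alpha (i.+1)%:Z) /\
          reversible P (exp_semigroup (@asep_closed R q N L)),
      (* (b) *)
      well_defined (@asep_Z R q N) /\
      (forall S : operators R N int, generated_by (@asep_Z R q N) S ->
        forall alpha : R, 0 < alpha ->
          exists P : probability (bconfig N int) R,
            product_measure P (fun i : int => asep_marginal q alpha i) /\
            reversible P S),
      (* (c) *)
      (forall L : nat, (0 < L)%N ->
        monotone_process (exp_semigroup (@asep_closed R q N L))) /\
      (forall S : operators R N int, generated_by (@asep_Z R q N) S ->
        monotone_process S),
      (* (d) *)
      forall L : nat, (3 <= L)%N -> N <> 1%N ->
        ~ exists P : probability (bconfig N 'I_L) R,
            nondegenerate_homogeneous_product P /\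
            stationary P (exp_semigroup (@asep_torus R q N L)) &
      (* (e) *)
      forall S : operators R N int, generated_by (@asep_Z R q N) S ->
        N <> 1%N ->
        ~ exists P : probability (bconfig N int) R,
            nondegenerate_homogeneous_product P /\
            stationary P S].
Proof.
have N_gt1 : N <> 1%N -> (1 < N)%N
  by move=> N1; rewrite ltn_neqAle N_gt0 andbT eq_sym; exact/eqP.
split.
- by move=> L alpha _; apply: asep_closed_reversible.
- split; first exact: asep_Z_well_defined.
  by move=> S SP alpha; apply: asep_Z_reversible.
- split; first by move=> L _; exact: (asep_closed_monotone q_gt0 q_lt1).
  by move=> S SP; exact: (asep_Z_monotone q_gt0 q_lt1 SP).
- move=> L L3 /N_gt1 N2 [P [hP stP]].
  exact: (no_homogeneous_torus q_gt0 q_lt1 N2 L3 stP hP).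
- move=> S SP /N_gt1 N2 [P [hP stP]]; have [mS _] := SP.
  apply: (no_homogeneous_Z q_gt0 q_lt1 N2 mS _ stP hP) => h.
  exact: generated_by_cylinder.
Qed.
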